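(* Let $G=\mathbb{Z}^d$, $d\geq1$, and let $V$ be a finite vector space. Let $M\subset G$ be a finite subset and let $S=V^{V^M}$ be the set of all maps $V^M\to V$. Let $s\in S^G$ be asymptotic to a constant configuration $c\in\mathcal{L}(V^M,V)^G$. Then it is decidable whether: (i) $\sigma_s$ is nilpotent; (ii) $\sigma_s$ is periodic, resp. eventually periodic; (iii) $\sigma_s$ is Cayley-Hamilton; (iv) $\sigma_s$ is injective.
   Context: For a group $G$ and a set $A$, $A^G$ is the set of maps (configurations) $G\to A$, and $G$ acts on it by $(gx)(h)=x(g^{-1}h)$. For $M\subset G$ and $s\in (A^{A^M})^G$, the non-uniform cellular automaton (NUCA) $\sigma_s\colon A^G\to A^G$ is $\sigma_s(x)(g)=s(g)((g^{-1}x)|_M)$. For a vector space $V$ over a field $k$, $\mathcal{L}(V^M,V)$ is the set of linear maps $V^M\to V$. Two configurations are asymptotic if they coincide outside some finite subset of $G$. Thus $s$ is specified by finite data: $M$, a finite $E\subset G$, $s|_E$, and the linear map which is the common value of $s$ outside $E$; ''decidable'' means that there is an algorithm deciding the property from such data. A NUCA $\tau\colon V^G\to V^G$ is: nilpotent if there exist a constant configuration $x_0\in V^G$ and an integer $n\ge1$ with $\tau^n(x)=x_0$ for all $x$; periodic if $\tau^n=\mathrm{Id}$ for some $n\ge1$; eventually periodic if $\tau^{n+m}=\tau^m$ for some integers $m,n\ge1$; Cayley-Hamilton if there is a nonzero polynomial $P(z)=\sum_i a_iz^i\in k[z]$ with $P(\tau)=0$, i.e. $\sum_i a_i\tau^i(x)=0$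 for all $x\in V^G$. *)

(* Defs.v *)
From mathcomp Require Import all_boot all_algebra finmap.

Set Implicit Arguments.
Unset Strict Implicit.
Unset Printing Implicit Defensive.

Import GRing.Theory.
Local Open Scope ring_scope.

(* Total recursive functions on the naturals, following Kleene: minimisation  *)
(* is only applied to regular functions, so that every function is total.     *)
(* Recursion and minimisation are given by the equations that characterise    *)
(* their result.                                                              *)
Inductive recursive : forall n, (n.-tuple nat -> nat) -> Prop :=
| recursive_zero n : recursive (fun _ : n.-tuple nat => 0%N)
| recursive_succ : recursive (fun v : 1.-tuple nat => (thead v).+1)
| recursive_proj n (i : 'I_n) : recursive (fun v : n.-tuple nat => tnth v i)
| recursive_comp m n (f : m.-tuple nat -> nat)
    (g : 'I_m -> n.-tuple nat -> nat) :
    recursive f -> (forall i, recursive (g i)) ->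
    recursive (fun v : n.-tuple nat => f [tuple g i v | i < m])
| recursive_rec n (f : n.-tuple nat -> nat) (g : n.+2.-tuple nat -> nat)
    (h : n.+1.-tuple nat -> nat) :
    recursive f -> recursive g ->
    (forall v : n.-tuple nat, h [tuple of 0%N :: v] = f v) ->
    (forall i (v : n.-tuple nat),
       h [tuple of i.+1 :: v] = g [tuple of i :: h [tuple of i :: v] :: v]) ->
    recursive h
| recursive_min n (f : n.+1.-tuple nat -> nat) (h : n.-tuple nat -> nat) :
    recursive f ->
    (forall v : n.-tuple nat, f [tuple of h v :: v] = 0%N) ->
    (forall (v : n.-tuple nat) i, (i < h v)%N -> f [tuple of i :: v] <> 0%N) ->
    recursive h.

(* A property of the elements of D, given to the algorithm by their codes.    *)
Definition algorithmically_decidable (D : Type) (code : D -> nat)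
    (P : D -> Prop) : Prop :=
  exists2 f : 1.-tuple nat -> nat, recursive f &
    forall x : D, P x <-> f [tuple code x] = 1%N.

Section Nuca.

(* The groups of interest are abelian and written additively. *)
Variables (G : zmodType) (A : Type).

Definition shift (g : G) (x : G -> A) : G -> A := fun h => x (- g + h).

Definition agree_outside (T : Type) (E : {fset G}) (x y : G -> T) : Prop :=
  forall g, g \notin E -> x g = y g.

Definition nuca (M : {fset G}) (s : G -> {ffun M -> A} -> A)
    (x : G -> A) : G -> A :=
  fun g => s g [ffun m : M => shift (- g) x (val m)].

Definition nilpotent (tau : (G -> A) -> G -> A) : Prop :=
  exists (a : A) (n : nat),
    (1 <= n)%N /\ forall x, iter n tau x = (fun _ => a).

Definition periodic (tau : (G -> A) -> G -> A) : Prop :=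
  exists n : nat, (1 <= n)%N /\ forall x, iter n tau x = x.

Definition eventually_periodic (tau : (G -> A) -> G -> A) : Prop :=
  exists m n : nat,
    [/\ (1 <= m)%N, (1 <= n)%N & forall x, iter (n + m) tau x = iter m tau x].

End Nuca.

Definition cayley_hamilton (G : zmodType) (k : fieldType) (V : lmodType k)
    (tau : (G -> V) -> G -> V) : Prop :=
  exists2 P : {poly k}, P != 0 &
    forall x g, \sum_(i < size P) P`_i *: iter i tau x g = 0.

Section Instances.

Variables (d : nat) (k : fieldType) (V : finLmodType k).

(* A finite presentation of a configuration s of local maps asymptotic to a   *)
(* constant configuration of linear maps; only the restriction of s to E and  *)
(* the map c enter its code.                                                  *)
Record presentation := Presentation {
  memory : {fset 'rV[int]_d};
  exceptions : {fset 'rV[int]_d};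
  rule : 'rV[int]_d -> {ffun memory -> V} -> V;
  limit_rule : {linear {ffun memory -> V} -> V};
  ruleP : agree_outside exceptions rule (fun _ => limit_rule)
}.

Definition int_code (z : int) : nat :=
  match z with Posz n => n.*2 | Negz n => n.*2.+1 end.

Definition point_code (g : 'rV[int]_d) : nat :=
  CodeSeq.code [seq int_code (g ord0 i) | i <- enum 'I_d].

Definition vector_code (v : V) : nat := enum_rank v.

(* The graph of a local map: each row holds a value f p followed by the       *)
(* pattern p, whose entries are in the order in which M is enumerated.        *)
Definition local_map_code (M : {fset 'rV[int]_d}) (f : {ffun M -> V} -> V) :
    nat :=
  CodeSeq.code
    [seq CodeSeq.code
           (vector_code (f p) :: [seq vector_code (p m) | m <- enum {: M}])
       | p <- enum {: {ffun M -> V}}].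

Definition presentation_code (D : presentation) : nat :=
  CodeSeq.code
    [:: CodeSeq.code [seq point_code (val m) | m <- enum {: memory D}];
        CodeSeq.code
          [seq CodeSeq.code
                 [:: point_code (val g); local_map_code (@rule D (val g))]
             | g <- enum {: exceptions D}];
        local_map_code (limit_rule D)].

Definition presented_nuca (D : presentation) :
    ('rV[int]_d -> V) -> 'rV[int]_d -> V :=
  nuca (@rule D).

End Instances.

(* Main.v *)
(* Write tau for the automaton, T for the linear automaton c that tau coincides
   with away from the finite set E of exceptional cells, and suppose V <> 0 (so
   that k is finite).

   Far from E the iterates of tau are those of T, so T inherits eventual
   periodicity from tau.  In a basis of V, T is a matrix A of Laurent
   polynomials.  If A has finitely many powers, then A^(p^r) = A^(p^s) for some
   r < s, p being the characteristic; as the coefficients a of the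
   characteristic polynomial are raised to the power p along with A, they
   satisfy a^(p^(s-r)) = a, hence are constant, and by Cayley-Hamilton two of
   the powers T^i with i <= |V| agree.  Conversely, if T^i = T^j then all the
   iterates of tau agree with those of T outside a fixed box, so tau is
   eventually periodic with explicit bounds: tau^(2q) = tau^q for an explicit q,
   and tau is nilpotent (periodic) if and only if moreover tau^q is zero (the
   identity).  Since k is finite, an annihilating polynomial forces two iterates
   to agree, so Cayley-Hamilton is the same as eventually periodic.  An equality
   of iterates is tested on finitely many finite space-time diagrams.

   Injectivity is equivalent to a finite condition on the patterns of a box of
   computable radius.  This rests on a bound of Hermann's type: if a linear
   system A y = w over the Laurent polynomials in d variables is solvable, then
   it has a solution of bounded support, with prescribed coefficients in a given
   box.  By duality a partial solution of T z = 0 on a large box then extends to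
   a global one.  The bound goes by induction on the number of variables: after
   a shear of Z^d the terms of a maximal minor Delta of A have distinct degrees
   in the last variable, so both extreme coefficients of Delta are units; by
   division by Delta the solution is brought to bounded degree in the last
   variable, and comparing coefficients leaves one variable less. *)
Require Import Defs.
From HB Require Import structures.
From mathcomp Require Import all_boot all_order all_algebra finmap.
From mathcomp Require Import perm zify ring.
From mathcomp Require mpoly.
From Stdlib Require Import FunctionalExtensionality Classical IndefiniteDescription.

Set Implicit Arguments.
Unset Strict Implicit.
Unset Printing Implicit Defensive.
Import GRing.Theory Num.Theory Order.TTheory.

(** * Recursive functions *)

Local Open Scope nat_scope.

(** For d >= 2 a pattern that satisfies T z = 0 on a large box need not belong to a global solution;
    this is the obstacle to testing injectivity. An obstruction is dual: a multiplier y that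
    combines the equations into a relation between the cells of the pattern alone. Nothing limits
    the size of y a priori, but if y can be replaced by a multiplier of bounded support with the
    same right-hand side, a box of bounded radius already detects every obstruction. The cells of E
    carry no linear equation, so a multiplier has to vanish there; hence the demand that the bounded
    solution keep the coefficients in a given box. Laurent polynomials do not form a type here. They
    are the elements of a field K that are combinations of a multiplicative and linearly independent
    family chi indexed by Z^d. Ranks, minors and inverses are thus those of matrices over a field,
    degree bounds are statements on supports, and a change of variables replaces chi while the
    elements of K stay the same. *)

Definition recursive1 (f : nat -> nat) : Prop :=
  recursive (fun v : 1.-tuple nat => f (thead v)).

Lemma recursive1_succ : recursive1 succn.
Proof. exact: recursive_succ. Qed.

Lemma recursive_comp1 m (f : nat -> nat) (g : m.-tuple nat -> nat) :
  recursive1 f -> recursive g ->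
  recursive (fun v => f (g v)).
Proof.
move=> rf rg; have := recursive_comp rf (fun _ : 'I_1 => rg).
by congr recursive; apply: functional_extensionality => v; rewrite /thead tnth_mktuple.
Qed.

Definition recursive2 (f : nat -> nat -> nat) : Prop :=
  recursive (fun v : 2.-tuple nat => f (thead v) (tnth v (inord 1))).

Lemma thead_cons n (x : nat) (v : n.-tuple nat) : thead [tuple of x :: v] = x.
Proof. by []. Qed.

Lemma tnth1_cons n (x : nat) (v : n.+1.-tuple nat) :
  tnth [tuple of x :: v] (inord 1) = thead v.
Proof.
by rewrite (tnth_nth 0%N) inordK //= /thead (tnth_nth 0%N); case: v => -[].
Qed.

Lemma recursive2_comp m (f : nat -> nat -> nat) (g h : m.-tuple nat -> nat) :
  recursive2 f -> recursive g -> recursive h ->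
  recursive (fun v => f (g v) (h v)).
Proof.
move=> rf rg rh.
have rgh (i : 'I_2) : recursive ((fun i : 'I_2 => if i == ord0 then g else h) i).
  by case: ifP.
have := recursive_comp rf rgh; congr recursive; apply: functional_extensionality => v.
by rewrite /thead !tnth_mktuple /= -val_eqE /= inordK.
Qed.

Lemma recursive_thead m : recursive (fun v : m.+1.-tuple nat => thead v).
Proof. exact: recursive_proj. Qed.

Lemma recursive_const m (c : nat) : recursive (fun _ : m.-tuple nat => c).
Proof.
elim: c => [|c IH]; first exact: recursive_zero.
exact: (recursive_comp1 recursive1_succ IH).
Qed.

Lemma recursive2_iter (I : nat -> nat) (S : nat -> nat -> nat) :
  recursive1 I -> recursive2 S ->
  recursive2 (fun n x => iter n (S x) (I x)).
Proof.
move=> rI rS.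
apply: (recursive_rec rI (g := fun w => S (tnth w (inord 2)) (tnth w (inord 1)))).
- by apply: recursive2_comp => //; apply: recursive_proj.
- by move=> v; rewrite thead_cons tnth1_cons.
- move=> i v; rewrite !thead_cons !tnth1_cons; congr S.
  by rewrite (tnth_nth 0%N) inordK //= /thead (tnth_nth 0%N).
Qed.

Lemma recursive2_swap (f : nat -> nat -> nat) :
  recursive2 f -> recursive2 (fun x y => f y x).
Proof. by move=> rf; exact: (recursive2_comp rf (recursive_proj (inord 1)) (recursive_thead 1)). Qed.

Lemma eq_recursive2 (f g : nat -> nat -> nat) :
  f =2 g -> recursive2 f -> recursive2 g.
Proof.
move=> fg; congr recursive; apply: functional_extensionality => v; exact: fg.
Qed.

Lemma eq_recursive1 (f g : nat -> nat) :
  f =1 g -> recursive1 f ->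
  recursive1 g.
Proof.
move=> fg; congr recursive; apply: functional_extensionality => v; exact: fg.
Qed.

Lemma recursive2_diag (f : nat -> nat -> nat) :
  recursive2 f -> recursive1 (fun x => f x x).
Proof. by move=> rf; apply: recursive2_comp => //; apply: recursive_thead. Qed.

Lemma recursive2_snd (f : nat -> nat) :
  recursive1 f -> recursive2 (fun _ y => f y).
Proof. by move=> rf; apply: recursive_comp1 => //; exact: (recursive_proj (inord 1)). Qed.

Lemma recursive2_addn : recursive2 addn.
Proof.
apply: (@eq_recursive2 (fun n x => iter n succn x)) => [n x|].
  by rewrite iter_succn addnC.
exact: (@recursive2_iter id (fun _ => succn) (recursive_thead 0) (recursive2_snd recursive1_succ)).
Qed.

Lemma recursive2_muln : recursive2 muln.
Proof.
apply: (@eq_recursive2 (fun n x => iter n (addn x) 0)) => [n x|].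
  by rewrite iter_addn_0 mulnC.
exact: (@recursive2_iter (fun _ => 0) addn (recursive_zero _) recursive2_addn).
Qed.

Lemma recursive2_expn : recursive2 expn.
Proof.
apply: (@recursive2_swap (fun n x => x ^ n)).
apply: (@eq_recursive2 (fun n x => iter n (muln x) 1)) => [n x|].
  by rewrite iter_muln_1.
exact: (@recursive2_iter (fun _ => 1) muln (recursive_const _ 1) recursive2_muln).
Qed.

Lemma recursive_pred : recursive1 predn.
Proof.
suff h : recursive2 (fun n _ => n.-1) by exact: (recursive2_diag h).
by apply: (recursive_rec (recursive_zero 1) (recursive_thead 2)).
Qed.

Lemma recursive2_subn : recursive2 subn.
Proof.
apply: (@recursive2_swap (fun n x => x - n)).
apply: (@eq_recursive2 (fun n x => iter n predn x)) => [n x|].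
  by elim: n => [|n /= ->]; rewrite ?subn0 ?subnS.
exact: (@recursive2_iter id (fun _ => predn) (recursive_thead 0) (recursive2_snd recursive_pred)).
Qed.

Lemma recursive_odd : recursive1 (fun n => odd n : nat).
Proof.
suff h : recursive2 (fun n _ => iter n (fun b => 1 - b) 0).
  apply: (eq_recursive1 _ (recursive2_diag h)) => n.
  by elim: n => //= n ->; case: odd.
apply: (@recursive2_iter (fun _ => 0) (fun _ b => 1 - b) (recursive_zero _)).
exact: (recursive2_comp recursive2_subn (recursive_const _ 1) (recursive_proj (inord 1))).
Qed.

Lemma recursive_half : recursive1 half.
Proof.
suff h : recursive2 (fun n _ => n./2) by exact: (recursive2_diag h).
have rg : recursive (fun w : 3.-tuple nat => tnth w (inord 1) + odd (thead w)).
  exact: (recursive2_comp recursive2_addn (recursive_proj (inord 1))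
           (recursive_comp1 recursive_odd (recursive_thead _))).
apply: (recursive_rec (recursive_zero 1) rg) => [v|i v] //.
by rewrite tnth1_cons !thead_cons -uphalfE uphalf_half addnC.
Qed.

(** This is the step of [CodeSeq.code] at a cons, the empty list having code 0. The code of a list
    is thus an iterated pair, and it is nonzero exactly when the list is nonempty. *)
Definition pair_code (a b : nat) : nat := 2 ^ a * b.*2.+1.

Lemma code_cons a s : CodeSeq.code (a :: s) = pair_code a (CodeSeq.code s).
Proof. by []. Qed.

Definition car (n : nat) : nat := head 0 (CodeSeq.decode n).
Definition cdr (n : nat) : nat := CodeSeq.code (behead (CodeSeq.decode n)).

Lemma car_pair a b : car (pair_code a b) = a.
Proof. by rewrite -{1}[b]CodeSeq.decodeK -code_cons /car CodeSeq.codeK. Qed.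

Lemma cdr_pair a b : cdr (pair_code a b) = b.
Proof.
by rewrite -{1}[b]CodeSeq.decodeK -code_cons /cdr CodeSeq.codeK /= CodeSeq.decodeK.
Qed.

Lemma pair_code_gt0 a b : 0 < pair_code a b.
Proof. by rewrite muln_gt0 expn_gt0. Qed.

Lemma pair_codeK n : 0 < n -> pair_code (car n) (cdr n) = n.
Proof.
move=> n_gt0; rewrite -{3}[n]CodeSeq.decodeK /car /cdr.
case E : (CodeSeq.decode n) => [|a s] //.
by move: n_gt0; rewrite -[n]CodeSeq.decodeK E.
Qed.

Lemma iter_half_mul a c m : iter a half (2 ^ (a + c) * m) = 2 ^ c * m.
Proof.
elim: a => [|a IH] //.
by rewrite iterSr addSn expnS -mulnA mul2n doubleK.
Qed.

Lemma iter_half_car n : 0 < n -> iter (car n) half n = (cdr n).*2.+1.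
Proof.
move=> n_gt0; rewrite -{2}(pair_codeK n_gt0) /pair_code -[X in 2 ^ X]addn0.
by rewrite iter_half_mul mul1n.
Qed.

Lemma odd_iter_half_car n a :
  0 < n -> odd (iter a half n) -> car n <= a.
Proof.
move=> n_gt0; case: (leqP (car n) a) => // lt_a.
rewrite -{1}(pair_codeK n_gt0) /pair_code -(subnKC lt_a) addSnnS iter_half_mul.
by rewrite expnS -mulnA mul2n odd_double.
Qed.

Lemma recursive2_iter_half : recursive2 (fun a n => iter a half n).
Proof. exact: (@recursive2_iter id (fun _ => half) (recursive_thead 0) (recursive2_snd recursive_half)). Qed.

Lemma recursive2_leq : recursive2 (fun a b => a <= b : nat).
Proof.
apply: (@eq_recursive2 (fun a b => 1 - (a - b))) => [a b|].
  by rewrite -subn_eq0; case: (a - b).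
by apply: (recursive2_comp recursive2_subn (recursive_const _ 1) recursive2_subn).
Qed.

(** [car n] is the exponent of 2 in [n], the least number of halvings that reach an odd number. For
    [n = 0] there is none; the truncated difference is then 0 at once, which keeps the minimisation
    regular and gives the value 0 of [car 0]. *)
Lemma recursive_car : recursive1 car.
Proof.
apply: (@recursive_min 1
  (fun w => (0 < tnth w (inord 1)) - odd (iter (thead w) half (tnth w (inord 1))))).
- have r1 : recursive (fun w : 2.-tuple nat => tnth w (inord 1)).
    exact: recursive_proj.
  exact: (recursive2_comp recursive2_subn
            (recursive2_comp recursive2_leq (recursive_const _ 1) r1)
            (recursive_comp1 recursive_odd
               (recursive2_comp recursive2_iter_half (recursive_thead _) r1))).
- move=> v; rewrite thead_cons tnth1_cons.
  by case: posnP => // v_gt0; rewrite iter_half_car // oddS odd_double.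
- move=> v i; rewrite thead_cons tnth1_cons.
  case: posnP => [->|v_gt0] // lt_i.
  by case: odd (odd_iter_half_car (a := i) v_gt0) => // /(_ isT); rewrite leqNgt lt_i.
Qed.

Lemma recursive_cdr : recursive1 cdr.
Proof.
apply: (@eq_recursive1 (fun n => (iter (car n) half n)./2) cdr) => [n|].
  by case: (posnP n) => [->|n_gt0] //; rewrite iter_half_car // -uphalfE uphalf_double.
exact: (recursive_comp1 recursive_half
          (recursive2_comp recursive2_iter_half recursive_car (recursive_thead _))).
Qed.

Lemma recursive2_pair : recursive2 pair_code.
Proof.
have r1 : recursive (fun w : 2.-tuple nat => tnth w (inord 1)).
  exact: recursive_proj.
apply: (@eq_recursive2 (fun a b => 2 ^ a * (b + b).+1)) => [a b|].
  by rewrite addnn.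
exact: (recursive2_comp recursive2_muln
          (recursive2_comp recursive2_expn (recursive_const _ 2) (recursive_thead _))
          (recursive_comp1 recursive1_succ (recursive2_comp recursive2_addn r1 r1))).
Qed.

(** * Closure properties of unary recursive functions *)

Lemma recursive1_id : recursive1 (fun e => e).
Proof. exact: recursive_thead. Qed.

Lemma recursive1_const c : recursive1 (fun _ => c).
Proof. exact: recursive_const. Qed.

Lemma recursive1_comp (f g : nat -> nat) :
  recursive1 f -> recursive1 g -> recursive1 (fun e => f (g e)).
Proof. exact: recursive_comp1. Qed.

Lemma recursive1_comp2 (f : nat -> nat -> nat) (g h : nat -> nat) :
  recursive2 f -> recursive1 g -> recursive1 h ->
  recursive1 (fun e => f (g e) (h e)).
Proof. exact: recursive2_comp. Qed.

Lemma recursive1_succn g : recursive1 g -> recursive1 (fun e => (g e).+1).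
Proof. exact: (recursive1_comp recursive1_succ). Qed.

Lemma recursive1_half g : recursive1 g -> recursive1 (fun e => (g e)./2).
Proof. exact: (recursive1_comp recursive_half). Qed.

Lemma recursive1_car g : recursive1 g -> recursive1 (fun e => car (g e)).
Proof. exact: (recursive1_comp recursive_car). Qed.

Lemma recursive1_cdr g : recursive1 g -> recursive1 (fun e => cdr (g e)).
Proof. exact: (recursive1_comp recursive_cdr). Qed.

Lemma recursive1_odd g : recursive1 g -> recursive1 (fun e => odd (g e) : nat).
Proof. exact: (recursive1_comp recursive_odd). Qed.

Lemma recursive1_pair g h :
  recursive1 g -> recursive1 h -> recursive1 (fun e => pair_code (g e) (h e)).
Proof. exact: (recursive1_comp2 recursive2_pair). Qed.

Lemma recursive1_addn g h :
  recursive1 g -> recursive1 h -> recursive1 (fun e => g e + h e).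
Proof. exact: (recursive1_comp2 recursive2_addn). Qed.

Lemma recursive1_muln g h :
  recursive1 g -> recursive1 h -> recursive1 (fun e => g e * h e).
Proof. exact: (recursive1_comp2 recursive2_muln). Qed.

Lemma recursive1_subn g h :
  recursive1 g -> recursive1 h -> recursive1 (fun e => g e - h e).
Proof. exact: (recursive1_comp2 recursive2_subn). Qed.

Lemma recursive1_expn g h :
  recursive1 g -> recursive1 h -> recursive1 (fun e => g e ^ h e).
Proof. exact: (recursive1_comp2 recursive2_expn). Qed.

Lemma recursive1_double g : recursive1 g -> recursive1 (fun e => (g e).*2).
Proof.
move=> rg; apply: (@eq_recursive1 (fun e => g e + g e)) => [e|].
  exact: addnn.
exact: recursive1_addn.
Qed.

Lemma recursive1_leq g h :
  recursive1 g -> recursive1 h -> recursive1 (fun e => g e <= h e : nat).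
Proof. exact: (recursive1_comp2 recursive2_leq). Qed.

Lemma recursive1_andb (p q : nat -> bool) :
  recursive1 p -> recursive1 q -> recursive1 (fun e => p e && q e : nat).
Proof.
move=> rp rq; apply: eq_recursive1 (recursive1_muln rp rq) => e.
by rewrite mulnb.
Qed.

Lemma recursive1_negb (p : nat -> bool) :
  recursive1 p -> recursive1 (fun e => ~~ p e : nat).
Proof.
move=> rp; apply: eq_recursive1 (recursive1_subn (recursive1_const 1) rp) => e.
by case: (p e).
Qed.

Lemma recursive1_orb (p q : nat -> bool) :
  recursive1 p -> recursive1 q -> recursive1 (fun e => p e || q e : nat).
Proof.
move=> rp rq.
have := recursive1_negb (recursive1_andb (recursive1_negb rp) (recursive1_negb rq)).
by apply: eq_recursive1 => e; rewrite negb_and !negbK.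
Qed.

Lemma recursive1_implyb (p q : nat -> bool) :
  recursive1 p -> recursive1 q -> recursive1 (fun e => p e ==> q e : nat).
Proof.
move=> rp rq; have := recursive1_orb (recursive1_negb rp) rq.
by apply: eq_recursive1 => e; rewrite implybE.
Qed.

Lemma recursive1_eqn g h :
  recursive1 g -> recursive1 h -> recursive1 (fun e => g e == h e : nat).
Proof.
move=> rg rh; have := recursive1_andb (recursive1_leq rg rh) (recursive1_leq rh rg).
by apply: eq_recursive1 => e; rewrite eqn_leq.
Qed.

Lemma recursive1_if (p : nat -> bool) g h :
  recursive1 p -> recursive1 g -> recursive1 h ->
  recursive1 (fun e => if p e then g e else h e).
Proof.
move=> rp rg rh.
have := recursive1_addn (recursive1_muln rp rg)
                        (recursive1_muln (recursive1_negb rp) rh).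
by apply: eq_recursive1 => e; case: (p e); rewrite ?mul1n ?mul0n ?addn0.
Qed.

(** The step has three arguments: index, accumulator and environment. They are packed in nested pair
    codes, so that all closure properties can be stated for unary functions. *)
Lemma recursive1_iteri (N I : nat -> nat) (S : nat -> nat -> nat -> nat) :
  recursive1 N -> recursive1 I ->
  recursive1 (fun w => S (car w) (car (cdr w)) (cdr (cdr w))) ->
  recursive1 (fun e => iteri (N e) (fun i a => S i a e) (I e)).
Proof.
move=> rN rI rS.
suff h : recursive2 (fun n e => iteri n (fun i a => S i a e) (I e)).
  exact: (recursive1_comp2 h rN recursive1_id).
pose T := fun w => S (car w) (car (cdr w)) (cdr (cdr w)).
have rg : recursive (fun w : 3.-tuple nat =>
    T (pair_code (thead w) (pair_code (tnth w (inord 1)) (tnth w (inord 2))))).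
  apply: (recursive_comp1 rS); apply: (recursive2_comp recursive2_pair).
    exact: recursive_thead.
  by apply: (recursive2_comp recursive2_pair); apply: recursive_proj.
apply: (recursive_rec rI rg) => [v|i v]; rewrite !tnth1_cons ?thead_cons //=.
rewrite /T !(car_pair, cdr_pair); congr S.
by rewrite (tnth_nth 0) inordK //= /thead (tnth_nth 0).
Qed.

Lemma recursive1_iter (N I : nat -> nat) (S : nat -> nat -> nat) :
  recursive1 N -> recursive1 I ->
  recursive1 (fun w => S (car w) (cdr w)) ->
  recursive1 (fun e => iter (N e) (fun a => S a e) (I e)).
Proof.
move=> rN rI rS.
apply: (@eq_recursive1 (fun e => iteri (N e) (fun _ a => S a e) (I e))) => [e|].
  by elim: (N e) => //= n ->.
apply: (recursive1_iteri (S := fun _ a e => S a e)) => //.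
have := recursive1_comp rS (recursive1_cdr recursive1_id); exact.
Qed.

Lemma recursive1_sum (N : nat -> nat) (F : nat -> nat -> nat) :
  recursive1 N -> recursive1 (fun w => F (car w) (cdr w)) ->
  recursive1 (fun e => \sum_(i < N e) F i e).
Proof.
move=> rN rF.
apply: (@eq_recursive1 (fun e => iteri (N e) (fun i a => a + F i e) 0)) => [e|].
  by elim: (N e) => [|n IH]; rewrite ?big_ord0 // big_ord_recr /= IH.
apply: (recursive1_iteri (S := fun i a e => a + F i e)) => //.
  exact: recursive1_const.
apply: recursive1_addn.
  exact: (recursive1_car (recursive1_cdr recursive1_id)).
have := recursive1_comp rF (recursive1_pair (recursive1_car recursive1_id)
   (recursive1_cdr (recursive1_cdr recursive1_id))).
by apply: eq_recursive1 => e; rewrite car_pair cdr_pair.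
Qed.

Lemma recursive1_exists (N : nat -> nat) (P : nat -> nat -> bool) :
  recursive1 N -> recursive1 (fun w => P (car w) (cdr w) : nat) ->
  recursive1 (fun e => [exists i : 'I_(N e), P i e] : nat).
Proof.
move=> rN rP; have := recursive1_leq (recursive1_const 1)
  (recursive1_sum (F := fun i e => P i e) rN rP).
apply: eq_recursive1 => e; congr nat_of_bool.
rewrite lt0n sum_nat_eq0 negb_forall.
by apply: eq_existsb => i; case: (P i e).
Qed.

Lemma recursive1_forall (N : nat -> nat) (P : nat -> nat -> bool) :
  recursive1 N -> recursive1 (fun w => P (car w) (cdr w) : nat) ->
  recursive1 (fun e => [forall i : 'I_(N e), P i e] : nat).
Proof.
move=> rN rP; have := recursive1_negb (recursive1_exists
  (P := fun i e => ~~ P i e) rN (recursive1_negb rP)).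
apply: eq_recursive1 => e; congr nat_of_bool.
by rewrite negb_exists; apply: eq_forallb => i; rewrite negbK.
Qed.

Lemma recursive1_divn g h :
  recursive1 g -> recursive1 h -> recursive1 (fun e => g e %/ h e).
Proof.
move=> rg rh.
(* The quotient counts the positive multiples of [h e] up to [g e]; the factor [0 < h e] gives
   division by 0 its value 0. *)
apply: (@eq_recursive1
  (fun e => (0 < h e) * \sum_(i < g e) (i.+1 * h e <= g e))) => [e|].
  case: posnP => [->|h_gt0]; first by rewrite divn0.
  rewrite mul1n; under eq_bigr do rewrite -leq_divRL //.
  have := leq_div (g e) (h e); move: (g e) (g e %/ h e) => a q le_qa.
  rewrite -(subnKC le_qa) big_split_ord /= [X in _ + X]big1 => [|i _].
    by rewrite addn0 (eq_bigr (fun=> 1)) ?sum1_card ?card_ord // => i _; rewrite ltn_ord.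
  by rewrite ltnNge leq_addr.
apply: recursive1_muln; first exact: (recursive1_leq (recursive1_const 1)).
apply: (recursive1_sum (F := fun i e => i.+1 * h e <= g e)) => //.
have r2 := recursive1_cdr recursive1_id.
apply: recursive1_leq (recursive1_comp rg r2).
apply: recursive1_muln (recursive1_comp rh r2).
exact: (recursive1_succn (recursive1_car recursive1_id)).
Qed.

Lemma recursive1_modn g h :
  recursive1 g -> recursive1 h -> recursive1 (fun e => g e %% h e).
Proof.
move=> rg rh.
have := recursive1_subn rg (recursive1_muln (recursive1_divn rg rh) rh).
by apply: eq_recursive1 => e; rewrite {1}(divn_eq (g e) (h e)) addKn.
Qed.

Lemma recursive1_factorial g : recursive1 g -> recursive1 (fun e => (g e)`!).
Proof.
apply: (recursive1_comp (f := fun n => n`!)).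
apply: (@eq_recursive1 (fun e => iteri e (fun i a => i.+1 * a) 1)) => [e|].
  by elim: e => //= n ->; rewrite factS.
apply: (recursive1_iteri (S := fun i a _ => i.+1 * a)).
- exact: recursive1_id.
- exact: recursive1_const.
- apply: recursive1_muln; first exact: (recursive1_succn (recursive1_car recursive1_id)).
  exact: (recursive1_car (recursive1_cdr recursive1_id)).
Qed.

(** * Laurent polynomials *)

Local Open Scope ring_scope.

Section Span.

Variables (k K : fieldType) (iota : {rmorphism k -> K}) (d : nat).
Notation G := 'rV[int]_d.

(** Laurent polynomials with exponents in [X], seen in the field [K]; [chi g] is the monomial of
    exponent [g]. *)
Definition span (chi : G -> K) (X : pred G) (a : K) : Prop :=
  exists2 s : seq (k * G), {in s, forall p, X p.2} &
    a = \sum_(p <- s) iota p.1 * chi p.2.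

(** The fields embed the group ring of Z^d over [k] in [K]. Independence of the monomials is stated
    through disjoint supports, the form in which coefficients are compared throughout. *)
Record independent_character (chi : G -> K) : Prop := {
  chiD : forall g h, chi (g + h) = chi g * chi h;
  chi0 : chi 0 = 1;
  chi_indep : forall (X Y : pred G) a, (forall g, X g -> ~~ Y g) ->
    span chi X a -> span chi Y a -> a = 0 }.

Section Theory.
Variable chi : G -> K.
Implicit Types (X Y Z : pred G) (a b : K) (g h : G).

Lemma span0 X : span chi X 0.
Proof. by exists [::]; rewrite ?big_nil. Qed.

Lemma spanD X a b : span chi X a -> span chi X b -> span chi X (a + b).
Proof.
move=> [s sX ->] [t tX ->]; exists (s ++ t); last by rewrite big_cat.
by move=> p; rewrite mem_cat => /orP[/sX|/tX].
Qed.

Lemma spanZ X c a : span chi X a -> span chi X (iota c * a).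
Proof.
move=> [s sX ->]; exists [seq (c * p.1, p.2) | p <- s].
  by move=> _ /mapP[p /sX Xp ->].
by rewrite big_map mulr_sumr; apply: eq_bigr => p _; rewrite rmorphM mulrA.
Qed.

Lemma spanN X a : span chi X a -> span chi X (- a).
Proof. by move=> /(spanZ (-1)); rewrite rmorphN1 mulN1r. Qed.

Lemma spanB X a b : span chi X a -> span chi X b -> span chi X (a - b).
Proof. by move=> Xa Xb; apply: spanD Xa (spanN Xb). Qed.

Lemma span_sum X (T : Type) (s : seq T) (P : pred T) (F : T -> K) :
  (forall i, P i -> span chi X (F i)) -> span chi X (\sum_(i <- s | P i) F i).
Proof.
by move=> XF; elim/big_rec: _ => [|i a /XF]; [apply: span0|apply: spanD].
Qed.

Lemma span_sub X Y a : {subset X <= Y} -> span chi X a -> span chi Y a.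
Proof. by move=> XY [s sX ->]; exists s => // p /sX/XY. Qed.

Lemma span_chi X c g : X g -> span chi X (iota c * chi g).
Proof.
by move=> Xg; exists [:: (c, g)]; rewrite ?big_seq1 // => p /[1!inE] /eqP->.
Qed.

Lemma span_ind X (P : K -> Prop) : P 0 ->
  (forall c g a, X g -> P a -> P (iota c * chi g + a)) ->
  forall a, span chi X a -> P a.
Proof.
move=> P0 PS _ [s sX ->]; elim: s sX => [|p s IH] sX; first by rewrite big_nil.
rewrite big_cons; apply: PS; first by apply: sX; rewrite mem_head.
by apply: IH => q qs; apply: sX; rewrite inE qs orbT.
Qed.

Lemma span_split X Y a : span chi X a ->
  exists b c, [/\ a = b + c, span chi (predI X Y) b & span chi (predD X Y) c].
Proof.
move: a; apply: span_ind => [|c g _ Xg [b [b' [-> Yb Yb']]]].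
  by exists 0, 0; split; [rewrite addr0|apply: span0|apply: span0].
have [Yg|nYg] := boolP (Y g).
  exists (iota c * chi g + b), b'; split; rewrite ?addrA //.
  by apply: spanD => //; apply: span_chi; rewrite /= Xg.
exists b, (iota c * chi g + b'); split; first by rewrite addrCA.
  by [].
by apply: spanD => //; apply: span_chi; rewrite /= nYg.
Qed.

Hypothesis chiP : independent_character chi.

Lemma chi_neq0 g : chi g != 0.
Proof.
apply: contra_eq_neq (chi0 chiP) => chi_g0.
by rewrite -(subrr g) (chiD chiP) chi_g0 mul0r eq_sym oner_neq0.
Qed.

Lemma spanM X Y Z a b : (forall g h, X g -> Y h -> Z (g + h)) ->
  span chi X a -> span chi Y b -> span chi Z (a * b).
Proof.
move=> XYZ Xa [t tY ->]; move: a Xa; apply: span_ind => [|c g a Xg Za].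
  by rewrite mul0r; apply: span0.
rewrite mulrDl; apply: spanD => //; rewrite mulr_sumr big_seq.
apply: span_sum => p /tY Yp; rewrite mulrACA -rmorphM -(chiD chiP).
exact/span_chi/XYZ.
Qed.

Lemma span_coef_eq0 c g X : ~~ X g -> span chi X (iota c * chi g) -> c = 0.
Proof.
move=> nXg Xc; have gc : span chi (pred1 g) (iota c * chi g).
  by apply: span_chi; rewrite /= eqxx.
have /eqP : iota c * chi g = 0.
  by apply: (chi_indep chiP _ gc Xc) => g1 /= /eqP ->.
by rewrite mulf_eq0 (negPf (chi_neq0 g)) orbF fmorph_eq0 => /eqP.
Qed.

(** Comparison of homogeneous components: the term at [t] is minus the sum of the others, whose
    support is disjoint from its own. *)
Lemma span_levels_eq0 (T : eqType) (lev : G -> T) (s : seq T) (u : T -> K) :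
  uniq s -> (forall t, span chi (fun g => lev g == t) (u t)) ->
  \sum_(t <- s) u t = 0 -> forall t, t \in s -> u t = 0.
Proof.
move=> us su sum0 t ts; move: sum0; rewrite (perm_big _ (perm_to_rem ts)).
rewrite big_cons => /eqP; rewrite addr_eq0 => /eqP ut.
apply: (chi_indep chiP _ (su t) (Y := fun g => lev g != t)).
  by move=> g ->.
rewrite ut; apply: spanN; rewrite big_seq; apply: span_sum => t' t's.
apply: span_sub (su t') => g; rewrite !unfold_in => /eqP ->.
by apply: contraTneq t's => ->; rewrite mem_rem_uniqF.
Qed.

End Theory.

End Span.

Section Levels.

Variables (k K : fieldType) (iota : {rmorphism k -> K}) (d : nat).
Notation G := 'rV[int]_d.
Variable chi : G -> K.
Notation span := (span iota chi).

Lemma span_repr X a : span X a -> exists (S : seq G) (c : G -> k),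
  [/\ uniq S, {in S, forall g, X g /\ c g != 0} &
      a = \sum_(g <- S) iota (c g) * chi g].
Proof.
move=> [s sX ->]; pose U := undup [seq p.2 | p <- s].
pose c g := \sum_(p <- s | p.2 == g) p.1.
exists [seq g <- U | c g != 0], c; split.
- by rewrite filter_uniq ?undup_uniq.
- move=> g; rewrite mem_filter mem_undup => /andP[cg /mapP[p ps gp]].
  by split; rewrite // gp; apply: sX.
rewrite big_filter [RHS]big_mkcond /=.
transitivity (\sum_(g <- U) iota (c g) * chi g); last first.
  by apply: eq_bigr => g _; case: eqP => [->|//]; rewrite rmorph0 mul0r.
under [RHS]eq_bigr do rewrite rmorph_sum mulr_suml /=.
rewrite (exchange_big_dep xpredT) //=; apply: eq_big_seq => p ps.
rewrite big_mkcond (bigD1_seq p.2) ?undup_uniq //=; last by rewrite mem_undup map_f.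
by rewrite eqxx big1 ?addr0 // => g /negPf; rewrite eq_sym => ->.
Qed.

Hypothesis chiP : independent_character iota chi.
Variable lev : G -> int.
Hypothesis levD : forall g h, lev (g + h) = lev g + lev h.

Lemma lev_max (S : seq G) : S != [::] ->
  exists2 h, h \in S & {in S, forall g, lev g <= lev h}.
Proof.
elim: S => // g S IH _; have [->|/IH[h hS hmax]] := eqVneq S [::].
  by exists g; rewrite ?inE // => g1; rewrite !inE => /eqP->.
case: (leP (lev h) (lev g)) => [le_hg|/ltW le_gh].
  exists g => [|g1]; rewrite inE ?eqxx // => /predU1P[->//|/hmax/le_trans]; exact.
exists h => [|g1]; rewrite inE ?hS ?orbT // => /predU1P[->//|]; exact: hmax.
Qed.

(** A level that separates the exponents leaves a single term on top. Applied to a sheared minor,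
    this makes the extreme coefficients monomials, hence units. *)
Lemma span_lead X a : {in X &, injective lev} -> span X a -> a != 0 ->
  exists c h rest, [/\ c != 0, X h,
    span (fun g => X g && (lev g < lev h)) rest & a = iota c * chi h + rest].
Proof.
move=> injX /span_repr[S [c [uS SX ->]]] a_neq0.
have /lev_max[h hS hmax] : S != [::].
  by apply: contraNneq a_neq0 => ->; rewrite big_nil.
have [Xh ch] := SX h hS.
exists (c h), h, (\sum_(g <- rem h S) iota (c g) * chi g); split => //.
  rewrite big_seq; apply: span_sum => g; rewrite mem_rem_uniq // inE => /andP[gh gS].
  have [Xg _] := SX g gS; apply: span_chi; rewrite Xg /=.
  rewrite lt_neqAle hmax // andbT; apply: contraNneq gh => /injX -> //; exact.
by rewrite (perm_big _ (perm_to_rem hS)) big_cons.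
Qed.

(* Compare top levels: the top level of [Delta * a] is [c * chi h] times the
   top level of [a]. *)
Lemma span_lev_le_div Y Delta rest c h a (m : int) :
  c != 0 -> span (fun g => lev g < lev h) rest ->
  Delta = iota c * chi h + rest -> span Y a ->
  span (fun g => lev g <= m) (Delta * a) ->
  span (fun g => Y g && (lev g <= m - lev h)) a.
Proof.
move=> c_neq0 rest_lt defD /span_repr[S [f [uS SY defa]]] Da.
have [/allP le_S|] := boolP (all (fun g => lev g <= m - lev h) S).
  rewrite defa big_seq; apply: span_sum => g gS; apply: span_chi.
  by rewrite le_S // (SY g gS).1.
rewrite -has_predC => /hasP[g0 g0S]; rewrite /= -ltNge => lt_g0.
have /lev_max[g1 g1S g1max] : S != [::] by case: (S) g0S.
pose t := lev g1.
have lt_t : m - lev h < t by apply: lt_le_trans lt_g0 (g1max _ g0S).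
pose top := \sum_(g <- S | lev g == t) iota (f g) * chi g.
pose low := \sum_(g <- S | lev g != t) iota (f g) * chi g.
have top_t : span (fun g => lev g == t) top.
  by apply: span_sum => g; apply: span_chi.
have low_t : span (fun g => lev g < t) low.
  rewrite /low big_seq_cond; apply: span_sum => g /andP[gS gt]; apply: span_chi.
  by rewrite lt_neqAle gt g1max.
have defa' : a = top + low by rewrite defa (bigID (fun g => lev g == t)).
have top_h : span (fun g => lev g == t + lev h) (iota c * chi h * top).
  apply: (spanM chiP (X := pred1 h)) top_t => [g g' /= /eqP -> /eqP <-|].
    by rewrite levD addrC.
  by apply: span_chi; rewrite /= eqxx.
have : iota c * chi h * top = 0.
  apply: (chi_indep chiP _ top_h (Y := fun g => lev g < t + lev h)) => [g|].
    by move=> /eqP->; rewrite ltxx.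
  have -> : iota c * chi h * top = Delta * a - (rest * a + iota c * chi h * low).
    by rewrite defD defa'; ring.
  have le_t : span (fun g => lev g <= t) a.
    rewrite defa big_seq; apply: span_sum => g gS; apply: span_chi; exact: g1max.
  apply: spanB; first by apply: span_sub Da => g; rewrite !unfold_in; lia.
  apply: spanD.
    by apply: (spanM chiP _ rest_lt le_t) => g g'; rewrite levD; lia.
  apply: (spanM chiP (X := pred1 h) _ _ low_t) => [g g' /= /eqP ->|].
    by rewrite levD; lia.
  by apply: span_chi; rewrite /= eqxx.
move=> /eqP; rewrite !mulf_eq0 fmorph_eq0 (negPf c_neq0) (negPf (chi_neq0 chiP h)) /=.
move=> /eqP top0; have [_] := SY g1 g1S.
have : span (fun g => g != g1) (iota (f g1) * chi g1).
  move: top0; rewrite /top (perm_big _ (perm_to_rem g1S)) big_cons eqxx.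
  move=> /eqP; rewrite addr_eq0 => /eqP ->; apply: spanN.
  rewrite big_seq_cond; apply: span_sum => g; rewrite mem_rem_uniq // inE => /andP[/andP[+ _] _].
  exact: span_chi.
by move/(span_coef_eq0 chiP) => ->; rewrite ?eqxx.
Qed.

End Levels.

(** * Linear systems over Laurent polynomials *)

(** A square submatrix of full rank. The coefficients [X] are arbitrary elements of the field: they
    only carry linear identities from the rows [f a] to all rows. *)
Lemma maximal_minor (K : fieldType) (I J : finType) (A : J -> I -> K) :
  exists (rho : nat) (f : 'I_rho -> J) (g : 'I_rho -> I),
    [/\ (rho <= #|I|)%N, injective g,
        \det (\matrix_(a, b) A (f a) (g b)) != 0 &
        exists X : J -> 'I_rho -> K, forall j i, A j i = \sum_a X j a * A (f a) i].
Proof.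
pose M : 'M[K]_(#|J|, #|I|) := \matrix_(a, b) A (enum_val a) (enum_val b).
pose f0 := maxrankfun M; pose B := rowsub f0 M.
have freeB : row_free B by apply: maxrowsub_free.
have fullBT : row_full B^T by rewrite /row_full mxrank_tr.
pose g0 := fullrankfun fullBT.
have unitD : rowsub g0 B^T \in unitmx by apply: fullrowsub_unit.
exists (\rank M), (fun a => enum_val (f0 a)), (fun b => enum_val (g0 b)).
have -> : \matrix_(a, b) A (enum_val (f0 a)) (enum_val (g0 b)) = (rowsub g0 B^T)^T.
  by apply/matrixP => a b; rewrite !mxE.
split.
- by rewrite rank_leq_col.
- move=> a b /enum_val_inj; exact: fullrankfun_inj.
- by rewrite det_tr -unitfE -unitmxE.
have /submxP[X defM] : (M <= B)%MS by rewrite eq_maxrowsub.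
exists (fun j a => X (enum_rank j) a) => j i.
have := congr1 (fun N : 'M_(_, _) => N (enum_rank j) (enum_rank i)) defM.
rewrite !mxE !enum_rankK => ->; apply: eq_bigr => a _.
by rewrite !mxE enum_rankK.
Qed.

(** * Boxes of exponents and shears of Z^d *)

Section Boxes.

Variables (k K : fieldType) (iota : {rmorphism k -> K}) (d : nat).
Notation G := 'rV[int]_d.
Notation span := (span iota).
Implicit Types (g h : G).

(** Exponents of the Laurent polynomials in the first [j] variables. *)
Definition coord_space (j : nat) : pred G :=
  fun g => [forall i : 'I_d, (j <= i)%N ==> (g 0 i == 0)].

Definition box (j r : nat) : pred G :=
  fun g => coord_space j g && [forall i : 'I_d, (absz (g 0%R i) <= r)%N].

Lemma coord_spaceP j g :
  reflect (forall i : 'I_d, (j <= i)%N -> g 0 i = 0) (coord_space j g).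
Proof.
apply: (iffP forallP) => h i; first by move=> ji; apply/eqP; move: (h i); rewrite ji.
by apply/implyP => /h ->.
Qed.

Lemma boxP j r g :
  reflect (coord_space j g /\ forall i : 'I_d, (absz (g 0%R i) <= r)%N) (box j r g).
Proof. by apply: (iffP andP) => -[gj /forallP h]. Qed.

Lemma coord_spaceD j g h :
  coord_space j g -> coord_space j h -> coord_space j (g + h).
Proof.
move=> /coord_spaceP gj /coord_spaceP hj; apply/coord_spaceP => i ji.
by rewrite mxE gj ?hj ?addr0.
Qed.

Lemma boxD j r r' g h : box j r g -> box j r' h -> box j (r + r') (g + h).
Proof.
move=> /boxP[gj gr] /boxP[hj hr]; apply/boxP; split; first exact: coord_spaceD.
move=> i; rewrite mxE; have := gr i; have := hr i.
by move: (g 0 i) (h 0 i) => a b /=; rewrite -[(_ + _)%R]/(a + b); lia.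
Qed.

Lemma box_leq j r r' : (r <= r')%N -> {subset box j r <= box j r'}.
Proof.
move=> le_r g /boxP[gj gr]; apply/boxP; split=> // i; exact: leq_trans (gr i) le_r.
Qed.

Lemma box_coord_space j r g : box j r g -> coord_space j g.
Proof. by case/andP. Qed.

Lemma box0 j r : box j r 0.
Proof.
by apply/boxP; split=> [|i]; [apply/coord_spaceP => i _|]; rewrite mxE.
Qed.

(** The digits are signed. The equation makes [a 0] a multiple of [N] smaller than [N] in absolute
    value, hence zero; division by [N] leaves the same situation for the other digits. *)
Lemma digits_eq0 (N : nat) n (a : nat -> int) :
  (forall i, (i < n)%N -> (`|a i| < N)%N) ->
  \sum_(i < n) a i * N%:Z ^+ i = 0 -> forall i, (i < n)%N -> a i = 0.
Proof.
elim: n a => // n IH a aN; rewrite big_ord_recl /= expr0 mulr1.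
under eq_bigr do rewrite /bump /= add1n exprS mulrCA.
rewrite -mulr_sumr; set s := \sum_(i < n) _ => sum0.
have N_gt0 : (0 < N)%N by apply: leq_ltn_trans (aN 0%N isT).
have a0 : a 0%N = 0.
  have := aN 0%N isT; move: sum0; case: (s =P 0) => [->|]; first by lia.
  by nia.
have s0 : s = 0 by move: sum0; rewrite a0; nia.
case=> [//|i lt_i]; apply: (IH (fun i => a i.+1)) => // i' lt_i'; exact: aN.
Qed.

Variable jj : 'I_d.

(** The powers start at [N ^ 1], as [N ^ 0] belongs to coordinate [jj], to which the shear adds this
    form. Coordinate [jj] does not enter the form, so shearing with [- c] undoes shearing with
    [c]. *)
Definition shear_form (N : nat) (g : G) : int :=
  \sum_(i < jj) g 0 (widen_ord (ltnW (ltn_ord jj)) i) * N%:Z ^+ i.+1.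

Definition shear (N : nat) (c : int) (g : G) : G :=
  g + (c * shear_form N g) *: delta_mx 0 jj.

Lemma shear_coord N c g (i : 'I_d) :
  shear N c g 0 i = g 0 i + (c * shear_form N g) *+ (i == jj).
Proof. by rewrite !mxE /=; case: eqP; rewrite ?mulr1 ?mulr0. Qed.

Lemma shear_formD N g h : shear_form N (g + h) = shear_form N g + shear_form N h.
Proof.
by rewrite /shear_form -big_split; apply: eq_bigr => i _; rewrite mxE mulrDl.
Qed.

Lemma shearD N c g h : shear N c (g + h) = shear N c g + shear N c h.
Proof. by rewrite /shear shear_formD mulrDr scalerDl addrACA. Qed.

Lemma shear_form_shear N c g : shear_form N (shear N c g) = shear_form N g.
Proof.
apply: eq_bigr => i _; rewrite shear_coord.
have /negPf -> : widen_ord (ltnW (ltn_ord jj)) i != jj.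
  by rewrite -val_eqE /= neq_ltn ltn_ord.
by rewrite mulr0n addr0.
Qed.

Lemma shearK N c : cancel (shear N c) (shear N (- c)).
Proof.
move=> g; rewrite {1}/shear shear_form_shear /shear -addrA -scalerDl.
by rewrite mulNr subrr scale0r addr0.
Qed.

Lemma coord_space_shear N c g :
  coord_space jj.+1 g -> coord_space jj.+1 (shear N c g).
Proof.
move=> /coord_spaceP gj; apply/coord_spaceP => i ji; rewrite shear_coord gj //.
by have /negPf -> : i != jj; [rewrite -val_eqE /= neq_ltn ji orbT|rewrite addr0].
Qed.

Definition shear_factor (N : nat) : nat := (1 + d * N ^ d)%N.

Lemma abs_shear_form N r g : (0 < N)%N -> (forall i, (absz (g 0%R i) <= r)%N) ->
  (`|shear_form N g| <= r * (d * N ^ d))%N.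
Proof.
move=> N_gt0 gr; apply: (@leq_trans (\sum_(i < jj) r * N ^ d)%N); last first.
  by rewrite sum_nat_const card_ord mulnCA leq_mul2l leq_mul2r (ltnW (ltn_ord jj)) !orbT.
rewrite /shear_form; elim/big_ind2: _ => // [x m y n|i _]; first lia.
rewrite abszM abszX /=; apply: leq_mul; first exact: gr.
by rewrite leq_pexp2l // (leq_trans (ltn_ord i)) // ltnW.
Qed.

Lemma box_shear N r (c : int) g : (0 < N)%N -> (absz c <= 1)%N ->
  box jj.+1 r g -> box jj.+1 (r * shear_factor N)%N (shear N c g).
Proof.
move=> N_gt0 c1 /boxP[gj gr]; apply/boxP; split; first exact: coord_space_shear.
move=> i; rewrite shear_coord mulnDr muln1.
have gr' : (absz (c * shear_form N g)%R <= r * (d * N ^ d))%N.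
  rewrite abszM -[leqRHS]mul1n; apply: leq_mul c1 _; exact: abs_shear_form.
have := gr i; move: gr' (g 0 i) => + a.
move: (c * _) (r * (d * _))%N => b m.
case: (i == jj); rewrite ?mulr1n ?mulr0n => hb ha.
  by rewrite -[(_ + _)%R]/(a + b); lia.
by rewrite addr0 (leq_trans ha) ?leq_addr.
Qed.

Lemma level_shear N g : shear N 1 g 0 jj = g 0 jj + shear_form N g.
Proof. by rewrite shear_coord eqxx mul1r. Qed.

(* The coordinates of a difference of two points of the box are the digits in
   base [N] of the difference of their levels. *)
Lemma level_shear_inj N r : (2 * r < N)%N ->
  {in box jj.+1 r &, injective (fun g => shear N 1 g 0 jj)}.
Proof.
move=> lt_rN g h /boxP[gj gr] /boxP[hj hr]; rewrite !level_shear => eq_lev.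
pose a i := if i is i'.+1 then
  (if insub i' is Some i'' then (g 0 i'' - h 0 i'' : int) else 0) else g 0 jj - h 0 jj.
have a_lt i : (i < jj.+1)%N -> (absz (a i) < N)%N.
  have dist_lt i' : (absz (g 0 i' - h 0 i')%R < N)%N.
    have := gr i'; have := hr i'; move: (g 0 i') (h 0 i') => x y.
    by rewrite -[(_ - _)%R]/(x - y); lia.
  by case: i => [|i] //= _; case: insub => //=; lia.
have a_sum : \sum_(i < jj.+1) a i * N%:Z ^+ i = 0.
  rewrite big_ord_recl /= expr0 mulr1.
  transitivity (g 0 jj - h 0 jj + (shear_form N g - shear_form N h)); last first.
    move: eq_lev; move: (g 0 jj) (h 0 jj) => x y /=; rewrite -[(x - y)%R]/(x - y).
    by rewrite -[(x + _)%R]/(x + shear_form N g) -[(y + _)%R]/(y + shear_form N h); lia.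
  congr (_ + _); rewrite /shear_form -sumrB; apply: eq_bigr => i _.
  rewrite /bump /= add1n insubT; first by rewrite (leq_trans (ltn_ord i)) // ltnW.
  move=> lt_id /=; rewrite -mulrBl; congr (_ * _).
  by congr (g 0 _ - h 0 _); apply: val_inj.
apply/rowP => i; have [lt_ji|] := ltnP jj i.
  by move/coord_spaceP: gj => ->; move/coord_spaceP: hj => // ->.
rewrite leq_eqVlt => /predU1P[/val_inj ->|lt_ij].
  have /= := digits_eq0 a_lt a_sum (ltn0Sn jj); exact: subr0_eq.
have := digits_eq0 a_lt a_sum (i := i.+1) lt_ij.
rewrite /= insubT // => lt_id /subr0_eq; congr (g 0 _ = h 0 _); exact: val_inj.
Qed.

(** A change of variables is made on the character: [a] stays the same element of [K], and only the
    exponents of its expansion move. *)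
Lemma span_shear (chi : G -> K) N c (X Y : pred G) a : (forall g, X g -> Y (shear N c g)) ->
  span chi X a -> span (fun g => chi (shear N (- c) g)) Y a.
Proof.
move=> XY [s sX ->]; exists [seq (p.1, shear N c p.2) | p <- s].
  by move=> _ /mapP[p /sX/XY ? ->].
by rewrite big_map; apply: eq_bigr => p _; rewrite /= shearK.
Qed.

Lemma span_unshear (chi : G -> K) N c (Z : pred G) a :
  span (fun g => chi (shear N c g)) Z a ->
  span chi (fun g => Z (shear N (- c) g)) a.
Proof.
move=> [s sZ ->]; exists [seq (p.1, shear N c p.2) | p <- s].
  by move=> _ /mapP[p /sZ Zp ->]; rewrite /= shearK.
by rewrite big_map.
Qed.

Lemma independent_shear (chi : G -> K) N c : independent_character iota chi ->
  independent_character iota (fun g => chi (shear N c g)).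
Proof.
move=> chiP; split=> [g h||X Y a XY Xa Ya].
- by rewrite shearD (chiD chiP).
- rewrite -(chi0 chiP); congr chi; apply: (addrI (shear N c 0)).
  by rewrite -shearD !addr0.
by apply: (chi_indep chiP _ (span_unshear Xa) (span_unshear Ya)) => g; apply: XY.
Qed.

End Boxes.

(** * Reduction of the free unknowns to bounded degree in one variable *)

Section SlabReduction.

Variables (k K : fieldType) (iota : {rmorphism k -> K}) (d : nat).
Notation G := 'rV[int]_d.
Variable chi : G -> K.
Hypothesis chiP : independent_character iota chi.
Notation span := (span iota chi).
Implicit Types (g h : G).

Variables (jj : 'I_d) (r : nat).
Notation cs := (@coord_space d jj.+1).
Notation box := (@box d jj.+1).

(** The sign lets one argument serve both the top and the bottom of a support in the variable
    [jj]. *)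
Definition level (s : bool) (g : G) : int := (-1) ^+ s * (g 0 jj : int).

Definition slab (L : nat) : pred G := fun g => cs g && (absz (level false g) <= L)%N.

Lemma levelD s g h : level s (g + h) = level s g + level s h.
Proof. by rewrite /level mxE mulrDr. Qed.

Lemma levelN s g : level s (- g) = - level s g.
Proof. by rewrite /level mxE mulrN. Qed.

Lemma absz_level s g : absz (level s g) = absz (level false g).
Proof. by rewrite /level !abszM !abszX !exp1n. Qed.

Lemma level_box s g : box r g -> (absz (level s g) <= r)%N.
Proof. by move=> /boxP[_ /(_ jj)]; rewrite absz_level /level expr0 mul1r. Qed.

Lemma coord_spaceN g : cs g -> cs (- g).
Proof.
by move=> /coord_spaceP gj; apply/coord_spaceP => i /gj; rewrite mxE => ->; rewrite oppr0.
Qed.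

Variables (I J : finType) (A : J -> I -> K) (piv : pred I).

(** [z] is changed by a kernel element of [A] whose support avoids the box, after which the free
    unknowns have bounded degree in the variable [jj]. The pivot unknowns are bounded later, by
    Cramer's rule. *)
Definition reducible (z : I -> K) : Prop := exists z' : I -> K,
  [/\ forall a, \sum_i A a i * (z i - z' i) = 0,
      forall i, span (predD cs (box r)) (z i - z' i),
      forall i, span cs (z' i) &
      forall i, ~~ piv i -> span (slab (3 * r)) (z' i)].

Lemma reducible_slab z : (forall i, span cs (z i)) ->
  (forall i, ~~ piv i -> span (slab (3 * r)) (z i)) -> reducible z.
Proof.
move=> zcs zslab; exists z; split=> // [a|i]; last by rewrite subrr; apply: span0.
by rewrite big1 // => i _; rewrite subrr mulr0.
Qed.

Lemma reducible_add z u : reducible z -> reducible u ->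
  reducible (fun i => z i + u i).
Proof.
move=> [z' [z1 z2 z3 z4]] [u' [u1 u2 u3 u4]]; exists (fun i => z' i + u' i).
split=> [a|i|i|i pi].
- have := congr2 +%R (z1 a) (u1 a); rewrite addr0 -big_split /= => sum0.
  by rewrite -[RHS]sum0; apply: eq_bigr => i _; ring.
- by rewrite opprD addrACA; apply: spanD.
- exact: spanD.
- by apply: spanD; [apply: z4|apply: u4].
Qed.

Lemma reducible_scale z c : reducible z -> reducible (fun i => iota c * z i).
Proof.
move=> [z' [z1 z2 z3 z4]]; exists (fun i => iota c * z' i).
split=> [a|i|i|i pi].
- rewrite -[RHS](mulr0 (iota c)) -[in RHS](z1 a) mulr_sumr; apply: eq_bigr => i _; ring.
- by rewrite -mulrBr; apply: spanZ.
- exact: spanZ.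
- exact/spanZ/z4.
Qed.

Lemma reducible_trans z u : (forall a, \sum_i A a i * (z i - u i) = 0) ->
  (forall i, span (predD cs (box r)) (z i - u i)) -> reducible u -> reducible z.
Proof.
move=> zu1 zu2 [u' [u1 u2 u3 u4]]; exists u'; split=> // [a|i].
- have := congr2 +%R (zu1 a) (u1 a); rewrite addr0 -big_split /= => sum0.
  by rewrite -[RHS]sum0; apply: eq_bigr => i _; ring.
- by rewrite -(subrKA (u i)); apply: spanD.
Qed.

Lemma reducible_ext z u : z =1 u -> reducible u -> reducible z.
Proof.
move=> zu; apply: reducible_trans => [a|i]; last by rewrite zu subrr; apply: span0.
by rewrite big1 // => i _; rewrite zu subrr mulr0.
Qed.

Lemma reducible_sum (T : Type) (s : seq T) (F : T -> I -> K) :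
  (forall t, reducible (F t)) -> reducible (fun i => \sum_(t <- s) F t i).
Proof.
move=> redF; elim: s => [|t s IH].
  apply: reducible_slab => i; first by rewrite big_nil; apply: span0.
  by rewrite big_nil => _; apply: span0.
by apply: reducible_ext (reducible_add (redF t) IH) => i; rewrite big_cons.
Qed.

Variables (Delta : K) (ker : I -> I -> K).
Hypothesis ker_box : forall q i, span (box r) (ker q i).
Hypothesis kerA : forall q a, \sum_i A a i * ker q i = 0.
Hypothesis ker_npiv : forall q i, ~~ piv i -> ker q i = Delta *+ (i == q).

Definition leading (s : bool) : Prop := exists (c : k) (h : G) (rest : K),
  [/\ c != 0, box r h,
      span (fun g => box r g && (level s g < level s h)) rest &
      Delta = iota c * chi h + rest].

Hypothesis Delta_lead : forall s, leading s.

(** [ker q] is the kernel vector with [Delta] at the free unknown [q] and 0 at the other free ones.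
    A multiple of it cancels the monomial at [g] by the extreme term of [Delta]. The threshold 3r
    protects the box: the multiplier has level above 2r, the correction has level above r, so no
    coefficient in the box changes. *)
Lemma reduce_top s q g : ~~ piv q -> cs g -> 3 * r%:Z < level s g ->
  exists u : I -> K,
  [/\ forall a, \sum_i A a i * (chi g *+ (i == q) - u i) = 0,
      forall i, span (predD cs (box r)) (chi g *+ (i == q) - u i),
      forall i, span cs (u i),
      forall i, ~~ piv i -> i != q -> u i = 0 &
      span (fun g' => cs g' && (absz (level false g') < absz (level false g))%N) (u q)].
Proof.
move=> npq csg lt_g; have [c [h [rest [c_neq0 hbox rest_lt defD]]]] := Delta_lead s.
pose f := iota c^-1 * chi (g - h).
have csh : cs (g - h).
  by apply: coord_spaceD csg (coord_spaceN (box_coord_space hbox)).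
have f_span : span (pred1 (g - h)) f by apply: span_chi; rewrite /= eqxx.
have lev_gh : r%:Z + r%:Z < level s (g - h).
  by have := level_box s hbox; rewrite levelD levelN; lia.
have diffE i : chi g *+ (i == q) - (chi g *+ (i == q) - f * ker q i) = f * ker q i.
  by rewrite opprB addrC subrK.
have fker i : span (predD cs (box r)) (f * ker q i).
  apply: (spanM chiP _ f_span (ker_box q i)) => g1 g2 /= /eqP -> g2box.
  apply/andP; split; last by apply: coord_spaceD => //; apply: box_coord_space g2box.
  apply/negP => /(level_box s); have := level_box s g2box.
  by rewrite levelD; lia.
have fcs i : span cs (f * ker q i) by apply: span_sub (fker i) => g1 /andP[].
exists (fun i => chi g *+ (i == q) - f * ker q i); split=> [a|i|i|i npi iq|].
- under eq_bigr do rewrite diffE mulrCA.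
  by rewrite -mulr_sumr kerA mulr0.
- by rewrite diffE.
- apply: spanB => //; case: (i == q); last by rewrite mulr0n; apply: span0.
  by rewrite mulr1n -[chi g]mul1r -(rmorph1 iota); apply: span_chi.
- by rewrite ker_npiv // (negPf iq) !mulr0n mulr0 subrr.
rewrite ker_npiv // eqxx !mulr1n.
have -> : chi g - f * Delta = - (f * rest).
  rewrite defD mulrDr mulrACA -rmorphM mulVf // rmorph1 mul1r -(chiD chiP) subrK.
  by rewrite opprD addrA subrr sub0r.
(* Each new term has level below that of [g] but still above r, so the absolute value of the level
   drops. *)
apply: spanN; apply: (spanM chiP _ f_span rest_lt) => g1 g2 /= /eqP -> /andP[g2box].
move=> lt_g2; apply/andP; split; first by apply: coord_spaceD => //; apply: box_coord_space g2box.
rewrite -(absz_level s) -(absz_level s g).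
have := level_box s g2box; have := level_box s hbox.
by rewrite !levelD levelN; lia.
Qed.

Lemma reducible_monomial q g : ~~ piv q -> cs g ->
  reducible (fun i => chi g *+ (i == q)).
Proof.
move=> npq; have [t] := ubnP (absz (level false g)).
elim: t g => // t IH g lt_g csg.
have chics i : span cs (chi g *+ (i == q)).
  case: (i == q); last by rewrite mulr0n; apply: span0.
  by rewrite mulr1n -[chi g]mul1r -(rmorph1 iota); apply: span_chi.
have [le_g|] := leqP (absz (level false g)) (3 * r).
  apply: reducible_slab => // i _.
  case: (i == q); last by rewrite mulr0n; apply: span0.
  rewrite mulr1n -[chi g]mul1r -(rmorph1 iota); apply: span_chi.
  by rewrite /slab csg.
move=> gt_g; have [s lt_s] : exists s, 3 * r%:Z < level s g.
  move: gt_g; rewrite /level; case: (ltP 0 (g 0 jj : int)) => g0.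
    by exists false; move: gt_g; rewrite expr0 mul1r; lia.
  by exists true; move: gt_g; rewrite expr0 mul1r expr1 mulN1r; lia.
have [u [u1 u2 u3 u4 u5]] := reduce_top npq csg lt_s.
apply: (reducible_trans u1 u2).
have red_a a : span (fun g' => cs g' && (absz (level false g') < absz (level false g))%N) a ->
    reducible (fun i => a *+ (i == q)).
  move: a; apply: span_ind => [|c g' a /andP[csg' lt_g'] red_a].
    by apply: reducible_slab => i => [|_]; rewrite mul0rn; apply: span0.
  have red_g' : reducible (fun i => chi g' *+ (i == q)).
    apply: IH csg'; apply: leq_trans lt_g' _; by rewrite -ltnS.
  apply: reducible_ext (reducible_add (reducible_scale c red_g') red_a) => i /=.
  by rewrite mulrnDl mulrnAr.
(* Only the entry at [q] is reduced further: [u] vanishes at the other free unknowns, and at the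
   pivots no bound is asked. *)
apply: (@reducible_ext _ (fun i => (u q *+ (i == q)) + (if i == q then 0 else u i))).
  by move=> i; case: eqP => [->|_]; rewrite ?mulr1n ?mulr0n ?addr0 ?add0r.
apply: reducible_add; first exact: red_a.
apply: reducible_slab => i; first by case: ifP => // _; apply: span0.
by case: eqP => [_ _|/eqP iq npi]; [|rewrite u4 //]; apply: span0.
Qed.

Lemma reducible_all z : (forall i, span cs (z i)) -> reducible z.
Proof.
move=> zcs; apply: (@reducible_ext _ (fun i => \sum_q z q *+ (i == q))) => [i|].
  rewrite (bigD1 i) //= eqxx mulr1n big1 ?addr0 // => q /negPf.
  by rewrite eq_sym => ->.
apply: reducible_sum => q; have [pq|npq] := boolP (piv q).
  apply: reducible_slab => i; first by case: eqP => _; rewrite ?mulr1n ?mulr0n //; apply: span0.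
  by case: eqP => [->|_ _]; [rewrite pq|rewrite mulr0n; apply: span0].
move: (z q) (zcs q); apply: span_ind => [|c g a csg red_a].
  by apply: reducible_slab => i => [|_]; rewrite mul0rn; apply: span0.
apply: reducible_ext (reducible_add
  (reducible_scale c (reducible_monomial npq csg)) red_a) => i /=.
by rewrite mulrnDl mulrnAr.
Qed.

End SlabReduction.

Section Determinant.

Variables (k K : fieldType) (iota : {rmorphism k -> K}) (d : nat).
Notation G := 'rV[int]_d.
Variable chi : G -> K.
Hypothesis chiP : independent_character iota chi.
Notation span := (span iota chi).

Lemma span_prod j r (T : Type) (s : seq T) (F : T -> K) :
  (forall i, span (box j r) (F i)) ->
  span (box j (size s * r)) (\prod_(i <- s) F i).
Proof.
move=> Fr; elim: s => [|i s IH].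
  rewrite big_nil -(chi0 chiP) -[chi 0]mul1r -(rmorph1 iota).
  by apply: span_chi; apply: box0.
rewrite big_cons /= mulSn; apply: (spanM chiP _ (Fr i) IH).
by move=> g h; apply: boxD.
Qed.

Lemma span_det j r n (M : 'M[K]_n) : (forall a b, span (box j r) (M a b)) ->
  span (box j (n * r)) (\det M).
Proof.
move=> Mr; apply: span_sum => s _.
rewrite -(rmorph_sign iota).
apply: spanZ; have := span_prod (index_enum 'I_n) (fun i => Mr i (s i)).
by rewrite /index_enum -enumT size_enum_ord.
Qed.

Lemma span_adj j r n (M : 'M[K]_n) a b : (forall a b, span (box j r) (M a b)) ->
  span (box j (n * r)) ((\adj M) a b).
Proof.
move=> Mr; rewrite !mxE /cofactor.
rewrite -(rmorphN1 iota) -rmorphXn.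
apply: spanZ; apply: span_sub (span_det _) => [|a' b']; last by rewrite !mxE; apply: Mr.
by apply: box_leq; rewrite leq_mul2r leq_pred orbT.
Qed.

End Determinant.

Section SlabSolution.

Variables (k K : fieldType) (iota : {rmorphism k -> K}) (d : nat).
Notation G := 'rV[int]_d.
Variables (jj : 'I_d) (chi : G -> K).
Hypothesis chiP : independent_character iota chi.
Notation span := (span iota chi).
Notation cs := (@coord_space d jj.+1).
Notation box := (@box d jj.+1).

(** The radii add up. The free unknowns lie in the slab of radius 3r, the right-hand side that they
    leave for the pivots in 4r, its product with the adjugate in 5r. That product is [Delta] times
    the vector of pivot unknowns, and division by [Delta] costs at most r more, since its two
    extreme terms are monomials in the box. *)
Lemma slab_solution (I J : finType) (A : J -> I -> K) (w : J -> K) (y : I -> K)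
    (rho r : nat) (f : 'I_rho -> J) (g : 'I_rho -> I) (X : J -> 'I_rho -> K) :
  let D := \matrix_(a, b) A (f a) (g b) in
  injective g -> (forall j i, A j i = \sum_a X j a * A (f a) i) ->
  (forall j i, span (box r) (A j i)) ->
  (forall j, span (box r) (w j)) ->
  span (box r) (\det D) ->
  (forall a b, span (box r) ((\adj D) a b)) ->
  (forall b i, span (box r) (\sum_a (\adj D) b a * A (f a) i)) ->
  (forall s, leading iota chi jj r (\det D) s) ->
  (forall i, span cs (y i)) ->
  (forall j, \sum_i A j i * y i = w j) ->
  exists y' : I -> K,
    [/\ forall j, \sum_i A j i * y' i = w j,
        forall i, span (predD cs (box r)) (y i - y' i) &
        forall i, span (slab jj (6 * r)) (y' i)].
Proof.
move=> D g_inj AX A_box w_box D_box adj_box adjA_box lead ycs Ay.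
pose Delta := \det D; pose piv i := i \in codom g.
pose adjA b q := \sum_a (\adj D) b a * A (f a) q.
(* Cramer's rule with the value [Delta] prescribed at [q]. The rows [f a] annihilate this vector,
   and [X] carries this to all rows. *)
pose ker q i := Delta *+ (i == q) - \sum_b adjA b q *+ (i == g b).
have ker_box q i : span (box r) (ker q i).
  apply: spanB; first by case: (i == q); [|rewrite mulr0n; apply: span0].
  by apply: span_sum => b _; case: (i == g b); [apply: adjA_box|rewrite mulr0n; apply: span0].
have DadjA a q : \sum_b A (f a) (g b) * adjA b q = Delta * A (f a) q.
  pose col := \col_a' A (f a') q.
  have -> : \sum_b A (f a) (g b) * adjA b q = (D *m (\adj D *m col)) a 0.
    by rewrite mxE; apply: eq_bigr => b _; rewrite !mxE; congr (_ * _);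
       apply: eq_bigr => a' _; rewrite !mxE.
  by rewrite mulmxA mul_mx_adj mul_scalar_mx !mxE.
have kerA q j : \sum_i A j i * ker q i = 0.
  have kerAf a : \sum_i A (f a) i * ker q i = 0.
    under eq_bigr do rewrite mulrBr.
    rewrite sumrB (bigD1 q) //= eqxx mulr1n big1 ?addr0 => [|i /negPf->]; last first.
      by rewrite mulr0.
    under eq_bigr do rewrite mulr_sumr.
    rewrite exchange_big /=.
    under eq_bigr => b _.
      rewrite (bigD1 (g b)) //= eqxx mulr1n big1 ?addr0 => [|i /negPf->]; last first.
        by rewrite mulr0.
      over.
    by rewrite DadjA mulrC subrr.
  under eq_bigr do rewrite AX mulr_suml.
  rewrite exchange_big big1 //= => a _.
  under eq_bigr do rewrite -mulrA.
  by rewrite -mulr_sumr kerAf mulr0.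
have ker_npiv q i : ~~ piv i -> ker q i = Delta *+ (i == q).
  move=> npi; rewrite /ker big1 ?subr0 // => b _.
  by have /negPf-> : i != g b by apply: contraNneq npi => ->; apply: codom_f.
have [y' [y1 y2 y3 y4]] :=
  reducible_all chiP ker_box kerA ker_npiv lead ycs.
have Ay' j : \sum_i A j i * y' i = w j.
  rewrite -(Ay j); apply/esym/eqP; rewrite -subr_eq0 -sumrB; apply/eqP.
  by rewrite -[RHS](y1 j); apply: eq_bigr => i _; rewrite mulrBr.
exists y'; split=> // i; have [|npi] := boolP (piv i); last first.
  by apply: span_sub (y4 i npi) => h /andP[csh le_h]; rewrite unfold_in /slab csh; lia.
case/codomP => b ->.
pose rhs a := w (f a) - \sum_(i | ~~ piv i) A (f a) i * y' i.
have rhsE a : rhs a = \sum_b A (f a) (g b) * y' (g b).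
  apply/eqP; rewrite subr_eq -(Ay' (f a)) (bigID piv) /=; apply/eqP; congr (_ + _).
  have g_uniq : uniq (codom g) by rewrite map_inj_uniq ?enum_uniq.
  by rewrite -(big_uniq _ g_uniq) /= /codom /image_mem big_map big_enum.
have DeltaY : Delta * y' (g b) = \sum_a (\adj D) b a * rhs a.
  have := congr1 (fun M : 'cV_rho => M b 0)
    (mulmxA (\adj D) D (\col_b y' (g b))).
  rewrite mul_adj_mx mul_scalar_mx !mxE => <-; apply: eq_bigr => a _.
  by rewrite !mxE rhsE; congr (_ * _); apply: eq_bigr => c _; rewrite !mxE.
have rhs_slab a : span (slab jj (4 * r)) (rhs a).
  apply: spanB.
    apply: span_sub (w_box (f a)) => h hb; rewrite unfold_in /slab (box_coord_space hb).
    by have := level_box false hb; lia.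
  apply: span_sum => i' npi'; apply: (spanM chiP _ (A_box _ _) (y4 i' npi')).
  move=> h1 h2 h1b /andP[csh2 le_h2]; rewrite /slab coord_spaceD ?(box_coord_space h1b) //=.
  by have := level_box false h1b; rewrite levelD; lia.
have DY_slab : span (slab jj (5 * r)) (Delta * y' (g b)).
  rewrite DeltaY; apply: span_sum => a _; apply: (spanM chiP _ (adj_box b a) (rhs_slab a)).
  move=> h1 h2 h1b /andP[csh2 le_h2]; rewrite /slab coord_spaceD ?(box_coord_space h1b) //=.
  by have := level_box false h1b; rewrite levelD; lia.
have half s Y : span Y (y' (g b)) ->
    span (fun h => Y h && (level jj s h <= 6 * r%:Z)) (y' (g b)).
  move=> Yy; have [c [h [rest [c_neq0 hbox rest_lt defD]]]] := lead s.
  have rest_lt' : span (fun g => level jj s g < level jj s h) rest.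
    by apply: span_sub rest_lt => h' /andP[].
  have DY : span (fun g => level jj s g <= 5 * r%:Z) (Delta * y' (g b)).
    apply: span_sub DY_slab => h' /andP[_]; rewrite unfold_in -(absz_level _ s); lia.
  have := span_lev_le_div chiP (@levelD _ jj s) c_neq0 rest_lt' defD Yy DY.
  apply: span_sub => h' /andP[Yh' le_h']; rewrite unfold_in Yh' /=.
  by have := level_box s hbox; lia.
have := half true _ (half false _ (y3 (g b))); apply: span_sub => h.
rewrite !unfold_in /slab => /andP[/andP[-> le1] le2] /=.
by move: le1 le2; rewrite /level expr0 expr1 mul1r mulN1r; lia.
Qed.

End SlabSolution.

Definition centered (L : nat) (i : 'I_L.*2.+1) : int := i%:Z - L%:Z.

Lemma centered_inj L : injective (@centered L).
Proof. by move=> i j /addIr[] /val_inj. Qed.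

Lemma absz_centered L (i : 'I_L.*2.+1) : (absz (centered i) <= L)%N.
Proof. by rewrite /centered; have := ltn_ord i; lia. Qed.

Lemma centered_surj L t : (absz t <= L)%N -> exists i : 'I_L.*2.+1, centered i = t.
Proof.
move=> tL; have lt_t : (absz (t + L%:Z)%R < L.*2.+1)%N by lia.
by exists (Ordinal lt_t); rewrite /centered /=; lia.
Qed.

(** * Elimination of a variable by comparison of coefficients *)

Section LevelDecomposition.

Variables (k K : fieldType) (iota : {rmorphism k -> K}) (d : nat).
Notation G := 'rV[int]_d.
Variables (jj : 'I_d) (chi : G -> K).
Hypothesis chiP : independent_character iota chi.
Notation span := (span iota chi).

Definition unit_pow (t : int) : K := chi (t *: delta_mx 0 jj).

Lemma unit_powD s t : unit_pow (s + t) = unit_pow s * unit_pow t.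
Proof. by rewrite /unit_pow scalerDl (chiD chiP). Qed.

Lemma unit_pow_neq0 t : unit_pow t != 0.
Proof. exact: (chi_neq0 chiP). Qed.

Lemma level_decomp (X Z : pred G) L a :
  (forall g, X g -> (absz (g 0%R jj) <= L)%N /\ Z (g - (g 0 jj : int) *: delta_mx 0 jj)) ->
  span X a -> exists u : int -> K,
    [/\ forall t, span Z (u t), forall t, (L < absz t)%N -> u t = 0 &
        a = \sum_(i < L.*2.+1) unit_pow (centered i) * u (centered i)].
Proof.
move=> XZ; move: a; apply: span_ind => [|c g a Xg [u [uZ u0 ->]]].
  by exists (fun=> 0); split=> // [t|]; [apply: span0|rewrite big1 // => i _; rewrite mulr0].
have [gL Zg] := XZ g Xg; pose t0 := (g 0 jj : int).
pose g' := g - t0 *: delta_mx 0 jj.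
exists (fun t => iota c * chi g' *+ (t == t0) + u t); split=> [t|t lt_t|].
- apply: spanD => //; case: eqP => _; first exact: span_chi.
  by rewrite mulr0n; apply: span0.
- rewrite u0 // addr0; case: eqP => // tt0; move: lt_t gL.
  by rewrite tt0 /t0; lia.
under [RHS]eq_bigr do rewrite mulrDr.
rewrite big_split /=; congr (_ + _); have [i it] := centered_surj gL.
rewrite (bigD1 i) //= it eqxx mulr1n big1 ?addr0 => [|i' ni'].
  by rewrite mulrCA /unit_pow -(chiD chiP) addrC subrK.
have /negPf -> : centered i' != t0.
  by apply: contraNneq ni' => e; apply/eqP/(@centered_inj L); rewrite e.
by rewrite mulr0n mulr0.
Qed.

(** Multiplication by a Laurent polynomial in the variable [jj], as a Toeplitz matrix acting on
    coefficients. For [t] within [L], the range of radius [L + r] contains the whole shifted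
    support. *)
Lemma level_convolution L r (u : int -> K) t : (absz t <= L)%N ->
  (forall s, (r < absz s)%N -> u s = 0) ->
  \sum_(s < (L + r).*2.+1) unit_pow (centered s) * u (centered s - t)
  = unit_pow t * \sum_(i < r.*2.+1) unit_pow (centered i) * u (centered i).
Proof.
move=> tL u0; rewrite mulr_sumr.
have lt_h (i : 'I_r.*2.+1) : (absz (i%:Z + t + L%:Z)%R < (L + r).*2.+1)%N.
  by have := ltn_ord i; lia.
pose h i := Ordinal (lt_h i).
have hE i : centered (h i) = centered i + t by rewrite /centered /=; lia.
have h_inj : injective h.
  by move=> i i' /(congr1 (@centered _)); rewrite !hE => /addIr/centered_inj.
have h_uniq : uniq (codom h) by rewrite map_inj_uniq ?enum_uniq.
rewrite (bigID (mem (codom h))) /= [X in _ + X]big1 ?addr0 => [|s ns]; last first.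
  rewrite u0 ?mulr0 // ltnNge; apply: contra ns => le_s.
  have [i it] := centered_surj le_s; apply/codomP; exists i.
  by apply: centered_inj; rewrite hE it subrK.
rewrite -(big_uniq _ h_uniq) /= /codom /image_mem big_map big_enum /=.
apply: eq_bigr => i _; rewrite hE addrK mulrA -unit_powD addrC.
by [].
Qed.

End LevelDecomposition.

Section BoundedSolutions.

Variables (k K : fieldType) (iota : {rmorphism k -> K}) (d : nat).
Notation G := 'rV[int]_d.
Notation span := (span iota).

(* The solution [y'] has the same coefficients as [y] in [box j r]. *)
Definition bounded_solutions (j r B : nat) : Prop :=
  forall chi : G -> K, independent_character iota chi ->
  forall (I J : finType) (A : J -> I -> K) (w : J -> K) (y : I -> K),
  (#|I| <= r)%N ->
  (forall a i, span chi (box j r) (A a i)) ->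
  (forall a, span chi (box j r) (w a)) ->
  (forall i, span chi (coord_space j) (y i)) ->
  (forall a, \sum_i A a i * y i = w a) ->
  exists y' : I -> K,
    [/\ forall i, span chi (box j B) (y' i),
        forall a, \sum_i A a i * y' i = w a &
        forall i, span chi (predD (coord_space j) (box j r)) (y i - y' i)].

Lemma bounded_solutions0 r : bounded_solutions 0 r 0.
Proof.
move=> chi chiP I J A w y _ _ _ ycs Ay; exists y; split=> // i.
  apply: span_sub (ycs i) => g /coord_spaceP g0; apply/boxP; split.
    exact/coord_spaceP.
  by move=> i'; rewrite g0.
by rewrite subrr; apply: span0.
Qed.

Lemma coord_space_drop (jj : 'I_d) (g : G) : coord_space jj.+1 g ->
  coord_space jj (g - (g 0 jj : int) *: delta_mx 0 jj).
Proof.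
move=> /coord_spaceP gj; apply/coord_spaceP => i; rewrite !mxE /=.
rewrite leq_eqVlt => /predU1P[/val_inj <-|lt_i]; first by rewrite eqxx mulr1 subrr.
have /negPf -> : i != jj by rewrite -val_eqE /= neq_ltn lt_i orbT.
by rewrite mulr0 subr0 gj.
Qed.

Lemma box_drop (jj : 'I_d) r (g : G) : box jj.+1 r g ->
  box jj r (g - (g 0 jj : int) *: delta_mx 0 jj).
Proof.
move=> /boxP[gj gr]; apply/boxP; split; first exact: coord_space_drop.
move=> i; rewrite !mxE /=; have [->|_] := eqVneq i jj; first by rewrite mulr1 subrr.
by rewrite mulr0 subr0.
Qed.

(** The terms of a minor of size at most r lie in radius r squared; the further r is for the product
    of the adjugate with entries of [A]. *)
Definition minor_radius (r : nat) : nat := (r * r + r)%N.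
(** Exceeds the difference of any two coordinates of points in the box of radius [minor_radius r],
    as the uniqueness of signed digits requires. *)
Definition shear_base (r : nat) : nat := (minor_radius r).*2.+1.
Definition sheared_radius (r : nat) : nat :=
  (minor_radius r * shear_factor d (shear_base r))%N.
Definition slab_radius (r : nat) : nat := (6 * sheared_radius r)%N.
(** Comparing coefficients produces one unknown for each of the at most r unknowns and each level of
    the slab; the second summand covers the radius of the sheared data. *)
Definition level_radius (r : nat) : nat :=
  (r * (slab_radius r).*2.+1 + sheared_radius r)%N.

(** The unknowns become the coefficients of [y] at the levels of the slab, and the equations the
    coefficients of the product at the levels up to [L + r]. A change outside the smaller box stays
    outside the larger one after multiplication by a power of the variable [jj], so prescribed
    coefficients survive. *)
Lemma bounded_solutions_split (jj : 'I_d) (L r r' B : nat) (chi : G -> K)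
    (I J : finType) (A : J -> I -> K) (w : J -> K) (y : I -> K) :
  bounded_solutions jj r' B -> independent_character iota chi ->
  (#|I| * L.*2.+1 <= r')%N -> (r <= r')%N ->
  (forall a i, span chi (box jj.+1 r) (A a i)) ->
  (forall a, span chi (box jj.+1 r) (w a)) ->
  (forall i, span chi (slab jj L) (y i)) ->
  (forall a, \sum_i A a i * y i = w a) ->
  exists y' : I -> K,
    [/\ forall i, span chi (box jj.+1 (B + L)) (y' i),
        forall a, \sum_i A a i * y' i = w a &
        forall i, span chi (predD (coord_space jj.+1) (box jj.+1 r)) (y i - y' i)].
Proof.
move=> IH chiP le_r' le_rr' A_box w_box y_slab Ay.
pose e : G := delta_mx 0 jj; pose T := 'I_L.*2.+1; pose S := 'I_(L + r).*2.+1.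
pose up := unit_pow jj chi.
have box_dec g : box jj.+1 r g ->
    (absz (g 0%R jj) <= r)%N /\ box jj r (g - (g 0 jj : int) *: e).
  by move=> gb; split; [case/boxP: gb | apply: box_drop].
have box_dec' g : box jj.+1 r g ->
    (absz (g 0%R jj) <= L + r)%N /\ box jj r (g - (g 0 jj : int) *: e).
  by move=> /box_dec[h ?]; split=> //; apply: leq_trans h (leq_addl _ _).
have slab_dec g : slab jj L g ->
    (absz (g 0%R jj) <= L)%N /\ coord_space jj (g - (g 0 jj : int) *: e).
  move=> /andP[csg]; rewrite /level expr0 mul1r => gL; split=> //.
  exact: coord_space_drop.
have /fin_all_exists[Au AuP] : forall p : J * I, exists u : int -> K,
    [/\ forall t, span chi (box jj r) (u t), forall t, (r < absz t)%N -> u t = 0 &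
        A p.1 p.2 = \sum_(i < r.*2.+1) up (centered i) * u (centered i)].
  by move=> p; apply: level_decomp box_dec (A_box _ _).
have /fin_all_exists[wu wuP] : forall a : J, exists u : int -> K,
    [/\ forall t, span chi (box jj r) (u t), forall t, (L + r < absz t)%N -> u t = 0 &
        w a = \sum_(i < (L + r).*2.+1) up (centered i) * u (centered i)].
  by move=> a; apply: level_decomp box_dec' (w_box _).
have /fin_all_exists[yu yuP] : forall i : I, exists u : int -> K,
    [/\ forall t, span chi (coord_space jj) (u t), forall t, (L < absz t)%N -> u t = 0 &
        y i = \sum_(t < L.*2.+1) up (centered t) * u (centered t)].
  by move=> i; apply: level_decomp slab_dec (y_slab _).
pose A' (q : J * S) (p : I * T) := Au (q.1, p.1) (centered q.2 - centered p.2).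
pose asm (z : I * T -> K) i := \sum_(t : T) up (centered t) * z (i, t).
have asmE z a : \sum_i A a i * asm z i =
    \sum_(s : S) up (centered s) * \sum_p A' (a, s) p * z p.
  transitivity (\sum_p up (centered p.2) * A a p.1 * z (p.1, p.2)).
    rewrite -(pair_bigA _ (fun i t => up (centered t) * A a i * z (i, t))) /=.
    apply: eq_bigr => i _; rewrite mulr_sumr; apply: eq_bigr => t _.
    by rewrite mulrA [A a i * _]mulrC.
  under [RHS]eq_bigr do rewrite mulr_sumr.
  rewrite exchange_big; apply: eq_bigr => -[i t] _ /=.
  have [_ u0 /= ->] := AuP (a, i).
  rewrite -(level_convolution jj chiP (absz_centered t) u0) mulr_suml.
  by apply: eq_bigr => s _; rewrite mulrA.
have up_span t : span chi (pred1 (t *: e)) (up t).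
  rewrite -[up t]mul1r -(rmorph1 iota); apply: span_chi; by rewrite /= eqxx.
have e_coord (t : int) i : (t *: e) 0 i = t *+ (i == jj).
  by rewrite !mxE /=; case: eqP => _; rewrite ?mulr1 ?mulr0.
have e_coord' (t : int) i : i != jj -> (t *: e) 0 i = 0.
  by rewrite e_coord => /negPf ->.
have csS h : coord_space jj h -> coord_space jj.+1 h.
  by move=> /coord_spaceP hj; apply/coord_spaceP => i lt_i; apply/hj/ltnW.
have cs_e t : coord_space jj.+1 (t *: e).
  by apply/coord_spaceP => i lt_i; rewrite e_coord' // -val_eqE /= neq_ltn lt_i orbT.
have le_box g : box jj r g -> box jj r' g by apply: box_leq.
have card_IT : (#|{: I * T}| <= r')%N by rewrite card_prod card_ord.
have A'_box q p : span chi (box jj r') (A' q p).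
  by have [h _ _] := AuP (q.1, p.1); apply: span_sub (h _) => g; apply: le_box.
have w'_box (q : J * S) : span chi (box jj r') (wu q.1 (centered q.2)).
  by have [h _ _] := wuP q.1; apply: span_sub (h _) => g; apply: le_box.
have y'_cs (p : I * T) : span chi (coord_space jj) (yu p.1 (centered p.2)).
  by have [h _ _] := yuP p.1.
have A'y (q : J * S) : \sum_p A' q p * yu p.1 (centered p.2) = wu q.1 (centered q.2).
  (* [F t] is the component of level [t] in the difference of the two sides. The components sum to
     0, so each of them vanishes. *)
  case: q => a s /=; pose F t := up t * (\sum_(p : I * T)
    Au (a, p.1) (t - centered p.2) * yu p.1 (centered p.2) - wu a t).
  have F_level t : span chi (fun g => (g 0 jj : int) == t) (F t).
    have [wb _ _] := wuP a.
    apply: (spanM chiP (Y := coord_space jj) _ (up_span t)); last first.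
      apply: spanB; last by apply: span_sub (wb t) => g; apply: box_coord_space.
      apply: span_sum => p _; have [Ab _ _] := AuP (a, p.1).
      apply: (spanM chiP _ (Ab _) (y'_cs p)) => g h /box_coord_space; exact: coord_spaceD.
    move=> x h /eqP -> /coord_spaceP hj.
    by rewrite mxE e_coord eqxx hj // addr0.
  have F0 : \sum_(t <- [seq centered s | s : S]) F t = 0.
    rewrite big_map big_enum /=; under eq_bigr do rewrite /F mulrBr.
    have [_ _ wE] := wuP a; rewrite sumrB -wE.
    have := asmE (fun p => yu p.1 (centered p.2)) a.
    have -> : \sum_i A a i * asm (fun p => yu p.1 (centered p.2)) i = w a.
      by rewrite -(Ay a); apply: eq_bigr => i _; have [_ _ ->] := yuP i.
    by move=> ->; rewrite subrr.
  have : F (centered s) = 0.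
    apply: (span_levels_eq0 chiP _ F_level F0); last by apply: map_f; rewrite mem_enum.
    by rewrite map_inj_uniq ?enum_uniq //; apply: centered_inj.
  move/eqP; rewrite mulf_eq0 (negPf (unit_pow_neq0 _ chiP _)) subr_eq0.
  by move/eqP.
have [z [zB Az yz]] := IH chi chiP _ _ _ _ _ card_IT A'_box w'_box y'_cs A'y.
exists (asm z); split=> [i|a|i].
- apply: span_sum => t _; apply: (spanM chiP _ (up_span _) (zB (i, t))).
  move=> x h /eqP -> /boxP[hj hB]; apply/boxP; split.
    by apply: coord_spaceD => //; apply: csS.
  move=> i'; rewrite mxE; have [->|ni'] := eqVneq i' jj.
    move/coord_spaceP: hj => -> //; rewrite addr0 e_coord eqxx mulr1n.
    exact: leq_trans (absz_centered t) (leq_addl _ _).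
  by rewrite e_coord' // add0r (leq_trans (hB i')) ?leq_addr.
- rewrite asmE; have [_ _ ->] := wuP a; apply: eq_bigr => s _.
  by rewrite Az.
have [_ _ ->] := yuP i; rewrite -sumrB; apply: span_sum => t _.
rewrite -mulrBr; apply: (spanM chiP _ (up_span _) (yz (i, t))).
move=> x h /eqP -> /andP[h_nbox csh]; apply/andP; split; last first.
  by apply: coord_spaceD => //; apply: csS.
apply: contra h_nbox => /boxP[_ hr]; apply/boxP; split=> // i'.
have [->|ni'] := eqVneq i' jj; first by move/coord_spaceP: csh => ->.
by have := hr i'; rewrite mxE e_coord' // add0r => /leq_trans; apply.
Qed.

(* The shear separates the terms of the minor by their last coordinates, so that
   its top and bottom coefficients in that coordinate are units. *)
Lemma bounded_solutions_step (jj : 'I_d) r B :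
  bounded_solutions jj (level_radius r) B ->
  bounded_solutions jj.+1 r
    ((B + slab_radius r) * shear_factor d (shear_base r)).
Proof.
move=> IH chi chiP I J A w y le_I A_box w_box y_cs Ay.
have [rho [f [g [le_rho g_inj D_neq0 [X AX]]]]] := maximal_minor A.
pose N := shear_base r; pose R := minor_radius r; pose r1 := sheared_radius r.
pose D := \matrix_(a, b) A (f a) (g b).
have N_gt0 : (0 < N)%N by [].
have le_rho_r : (rho * r <= R)%N.
  by rewrite (leq_trans _ (leq_addr _ _)) // leq_mul2r (leq_trans le_rho) ?orbT.
have Dr a b : span chi (box jj.+1 r) (D a b) by rewrite mxE.
have box_R m : (m <= R)%N -> forall a, span chi (box jj.+1 m) a -> span chi (box jj.+1 R) a.
  by move=> le_m a; apply: span_sub => h; apply: box_leq.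
have D_box : span chi (box jj.+1 R) (\det D) by apply: box_R le_rho_r _ (span_det chiP Dr).
have adj_box a b : span chi (box jj.+1 (rho * r)) ((\adj D) a b) by apply: span_adj.
have adjA_box b i : span chi (box jj.+1 R) (\sum_a (\adj D) b a * A (f a) i).
  apply: span_sum => a _; apply: (@box_R (rho * r + r)%N).
    by rewrite leq_add2r leq_mul2r (leq_trans le_rho) ?orbT.
  by apply: (spanM chiP _ (adj_box b a) (A_box (f a) i)) => h1 h2; apply: boxD.
pose chi' h := chi (shear jj N (- 1) h).
have chi'P : independent_character iota chi' by apply: independent_shear.
have to_chi' a : span chi (box jj.+1 R) a -> span chi' (box jj.+1 r1) a.
  by apply: span_shear => h; apply: box_shear.
have le_rR : (r <= R)%N by apply: leq_addl.
have A_box' a i : span chi' (box jj.+1 r1) (A a i) by apply/to_chi'/(box_R r).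
have w_box' a : span chi' (box jj.+1 r1) (w a) by apply/to_chi'/(box_R r).
have y_cs' i : span chi' (coord_space jj.+1) (y i).
  by apply: span_shear (y_cs i) => h; apply: coord_space_shear.
have lead s : leading iota chi' jj r1 (\det D) s.
  have lev_inj : {in box jj.+1 R &, injective (fun h => level jj s (shear jj N 1 h))}.
    move=> h1 h2 h1R h2R; rewrite /level => eq_lev.
    apply: (@level_shear_inj _ jj N R) => //=; first by rewrite /N /shear_base mul2n.
    by apply: (mulfI _ eq_lev); rewrite signr_eq0.
  have [c [h [rest [c_neq0 hR rest_lt ->]]]] := span_lead lev_inj D_box D_neq0.
  exists c, (shear jj N 1 h), rest; split=> //; first exact: box_shear.
    apply: span_shear rest_lt => h' /andP[h'R lt_h']; apply/andP; split=> //.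
    exact: box_shear.
  by rewrite /chi' shearK.
have [y' [Ay' yy' y'_slab]] := slab_solution chi'P g_inj AX A_box' w_box'
  (to_chi' _ D_box) (fun a b => to_chi' _ (box_R _ le_rho_r _ (adj_box a b)))
  (fun b i => to_chi' _ (adjA_box b i)) lead y_cs' Ay.
have [y'' [y''B Ay'' yy'']] : exists y'' : I -> K,
    [/\ forall i, span chi' (box jj.+1 (B + slab_radius r)) (y'' i),
        forall a, \sum_i A a i * y'' i = w a &
        forall i, span chi' (predD (coord_space jj.+1) (box jj.+1 r1)) (y' i - y'' i)].
  apply: (bounded_solutions_split IH chi'P _ _ A_box' w_box' y'_slab Ay').
    by apply: leq_trans (leq_addr _ _); rewrite leq_mul2r le_I orbT.
  exact: leq_addl.
exists y''; split=> // i.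
  apply: span_sub (span_unshear (y''B i)) => h.
  by rewrite unfold_in opprK => /(box_shear (c := -1) N_gt0 isT); rewrite shearK.
(* Both corrections avoid the box of radius [r1] in the sheared exponents, which contains the shear
   of the box of radius [r]; so the coefficients in the original box are unchanged. *)
rewrite -(subrKA (y' i)).
apply: span_sub (span_unshear (spanD (yy' i) (yy'' i))) => h /andP[h_nbox h_cs].
apply/andP; split.
  apply: contra h_nbox => h_box; rewrite opprK.
  apply: box_leq (box_shear N_gt0 (c := 1) isT h_box).
  by rewrite leq_mul2r le_rR orbT.
by move: h_cs; rewrite opprK => /(coord_space_shear N (-1)); rewrite shearK.
Qed.

Fixpoint solution_bound (j r : nat) : nat :=
  if j is j'.+1 then
    ((solution_bound j' (level_radius r) + slab_radius r)
      * shear_factor d (shear_base r))%N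
  else 0%N.

Theorem bounded_solutionsP j r : (j <= d)%N ->
  bounded_solutions j r (solution_bound j r).
Proof.
elim: j r => [|j IH] r lt_jd; first exact: bounded_solutions0.
apply: (@bounded_solutions_step (Ordinal lt_jd)).
exact/IH/ltnW.
Qed.

End BoundedSolutions.

(** * Extension of partial solutions *)

Lemma fredholm (k : fieldType) (I J : finType) (A : J -> I -> k) (w : J -> k) :
  (forall a : J -> k, (forall i, \sum_j a j * A j i = 0) -> \sum_j a j * w j = 0) ->
  exists z : I -> k, forall j, \sum_i A j i * z i = w j.
Proof.
move=> hw; pose M : 'M[k]_(#|I|, #|J|) := \matrix_(i, j) A (enum_val j) (enum_val i).
pose wr : 'rV[k]_(#|J|) := \row_j w (enum_val j).
have /submxP[z defw] : (wr <= M)%MS.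
  rewrite submxE; apply/eqP/rowP => c.
  pose a j := cokermx M (enum_rank j) c.
  have reE (F : J -> k) : \sum_j F j = \sum_(j < #|J|) F (enum_val j).
    exact: (big_enum_val (A := predT)).
  have aw : \sum_j a j * w j = 0.
    apply: hw => i; have := congr1 (fun X : 'M_(_, _) => X (enum_rank i) c) (mulmx_coker M).
    rewrite mxE [RHS]mxE => cM; rewrite -[RHS]cM reE; apply: eq_bigr => j _.
    by rewrite mxE /a enum_valK enum_rankK mulrC.
  rewrite mxE [RHS]mxE -[RHS]aw reE; apply: eq_bigr => j _.
  by rewrite mxE /a enum_valK mulrC.
exists (fun i => z 0 (enum_rank i)) => j.
have := congr1 (fun X : 'M_(_, _) => X 0 (enum_rank j)) defw.
rewrite !mxE enum_rankK => ->; transitivity (\sum_(i in predT) A j i * z 0 (enum_rank i)).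
  by [].
rewrite big_enum_val; apply: eq_bigr => i _.
by rewrite !mxE enum_rankK enum_valK mulrC.
Qed.

(** Compactness. A prefix compatible with every [Q n] has a one-letter extension of the same kind:
    otherwise each letter fails at some level, and a configuration for the largest of these finitely
    many levels gives a contradiction. *)
Lemma konig (V : finType) (Q : nat -> (nat -> V) -> Prop) :
  (forall n, exists f, Q n f) ->
  (forall n f, Q n.+1 f -> Q n f) ->
  (forall n, exists m, forall f g, (forall i, (i < m)%N -> f i = g i) -> Q n f -> Q n g) ->
  exists f, forall n, Q n f.
Proof.
move=> exQ decQ locQ.
have monQ m n f : (n <= m)%N -> Q m f -> Q n f.
  by move/subnK <-; elim: (m - n)%N => //= i IH /decQ.
pose ext (s : seq V) := forall n, exists2 f, Q n f &
  forall i v, (i < size s)%N -> f i = nth v s i.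
have step s : ext s -> exists v, ext (rcons s v).
  move=> exts; apply: NNPP => noext.
  have /fin_all_exists[bad badP] : forall v, exists n, ~ exists2 f, Q n f &
      forall i u, (i < (size s).+1)%N -> f i = nth u (rcons s v) i.
    move=> v; apply: NNPP => nbad; apply: noext; exists v => n.
    apply: NNPP => nf; apply: nbad; exists n => -[f Qf fs]; apply: nf.
    by exists f => // i u; rewrite size_rcons; apply: fs.
  have [f Qf fs] := exts (\max_v bad v)%N.
  apply: (badP (f (size s))); exists f.
    by apply: monQ Qf; apply: (leq_bigmax (f (size s))).
  move=> i u; rewrite nth_rcons ltnS leq_eqVlt => /predU1P[->|lt_i].
    by rewrite ltnn eqxx.
  by rewrite lt_i; apply: fs.
have ext0 : ext [::] by move=> n; have [f Qf] := exQ n; exists f.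
pose next (s : {s | ext s}) : {s | ext s} :=
  let: exist v vP := constructive_indefinite_description _ (step _ (proj2_sig s)) in
  exist _ (rcons (proj1_sig s) v) vP.
pose pre n := proj1_sig (iter n next (exist _ [::] ext0)).
have preS n : exists v, pre n.+1 = rcons (pre n) v.
  rewrite /pre /= /next; case: constructive_indefinite_description => v _ /=.
  by exists v.
have size_pre n : size (pre n) = n.
  by elim: n => // n IH; have [v ->] := preS n; rewrite size_rcons IH.
have [f0 _] := exQ 0%N.
have nth_pre m n i : (m <= n)%N -> (i < m)%N -> nth (f0 0%N) (pre n) i = nth (f0 0%N) (pre m) i.
  move=> le_mn lt_im; elim: n le_mn => [|n IH]; first by rewrite leqn0 => /eqP->.
  rewrite leq_eqVlt => /predU1P[->//|le_mn]; have [v ->] := preS n.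
  by rewrite nth_rcons size_pre (leq_trans lt_im le_mn) IH.
exists (fun i => nth (f0 0%N) (pre i.+1) i) => n; have [m mP] := locQ n.
have [f Qf fs] := proj2_sig (iter m next (exist _ [::] ext0)) n.
apply: mP Qf => i lt_im; rewrite (fs i (f0 0%N)) ?size_pre //.
by rewrite -[LHS]/(nth _ (pre m) i) (nth_pre i.+1 m).
Qed.

(** The members of a free family are distinct, so its length is at most the number of vectors and
    the extension of free families stops. This bound on the dimension later enters the explicit
    radii. *)
Lemma finite_basis (k : fieldType) (V : finLmodType k) :
  exists (N : nat) (e : 'I_N -> V) (co : V -> 'I_N -> k),
  [/\ (N <= #|{: V}|)%N, forall v, v = \sum_l co v l *: e l &
      forall c l, co (\sum_l c l *: e l) l = c l].
Proof.
pose free N (e : 'I_N -> V) := forall c, \sum_l c l *: e l = 0 -> forall l, c l = 0.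
have free_le N (e : 'I_N -> V) : free N e -> (N <= #|{: V}|)%N.
  move=> freee; rewrite -[N]card_ord -(card_codom (f := e)) ?max_card // => i j eij.
  have [//|nij] := eqVneq i j; pose c l : k := (l == i)%:R - (l == j)%:R.
  suff /freee/(_ i) : \sum_l c l *: e l = 0.
    by rewrite /c eqxx (negPf nij) subr0 => /eqP; rewrite oner_eq0.
  have sum1 m : \sum_l (l == m)%:R *: e l = e m.
    rewrite (bigD1 m) //= eqxx scale1r big1 ?addr0 // => l /negPf->.
    by rewrite scale0r.
  under eq_bigr do rewrite scalerBl.
  by rewrite sumrB !sum1 eij subrr.
pose spans N (e : 'I_N -> V) := forall v, exists c, v = \sum_l c l *: e l.
have extend N (e : 'I_N -> V) : free N e -> ~ spans N e ->
    exists e' : 'I_N.+1 -> V, free N.+1 e'.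
  move=> freee nspan; have [v nv] := not_all_ex_not _ _ nspan.
  exists (fun i => oapp e v (unlift ord_max i)) => c.
  rewrite big_ord_recr /= unlift_none /=.
  under eq_bigr => i _.
    have -> : widen_ord (leqnSn N) i = lift ord_max i.
      by apply/val_inj; rewrite /= /bump leqNgt ltn_ord.
    rewrite liftK /=; over.
  move=> sum0; have cmax : c ord_max = 0.
    have [//|c_neq0] := eqVneq (c ord_max) 0; case: nv.
    exists (fun i => - (c ord_max)^-1 * c (lift ord_max i)).
    under eq_bigr do rewrite -scalerA; rewrite -scaler_sumr.
    move/eqP: sum0; rewrite addr_eq0 => /eqP ->.
    by rewrite scalerN scaleNr opprK scalerA mulVf // scale1r.
  move=> l; case: (unliftP ord_max l) => [l' ->|-> //].
  apply: (freee (fun i => c (lift ord_max i))).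
  by move: sum0; rewrite cmax scale0r addr0.
have [N [e [freee spane]]] : exists N (e : 'I_N -> V), free N e /\ spans N e.
  suff h m : forall N (e : 'I_N -> V), free N e -> (#|{: V}| <= N + m)%N ->
      exists N (e : 'I_N -> V), free N e /\ spans N e.
    by apply: (h #|{: V}| 0%N (fun _ => 0)) => // c _ [].
  elim: m => [|m IH] N e freee leN; have [spane|nspan] := classic (spans N e).
  - by exists N, e.
  - have [e' /free_le] := extend N e freee nspan.
    by rewrite ltnNge -[N]addn0 leN.
  - by exists N, e.
  - have [e' freee'] := extend N e freee nspan.
    by apply: (IH _ e') => //; rewrite addSnnS.
have /fin_all_exists[co coE] := spane.
exists N, e, co; split=> [|//|c l]; first exact: free_le freee.
apply/eqP; rewrite -subr_eq0; apply/eqP.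
apply: (freee (fun l => co (\sum_l c l *: e l) l - c l)).
by under eq_bigr do rewrite scalerBl; rewrite sumrB -coE subrr.
Qed.

Lemma sum_pair (R : nmodType) (T1 T2 : finType) (F : T1 * T2 -> R) :
  \sum_p F p = \sum_i \sum_j F (i, j).
Proof. by rewrite pair_bigA; apply: eq_bigr => -[]. Qed.

Section BoxEnum.

Variable d : nat.
Notation G := 'rV[int]_d.

Definition box_enum (b : nat) : seq G :=
  [seq \row_i centered (f i) | f : {ffun 'I_d -> 'I_b.*2.+1}].

Lemma coord_space_full (g : G) : coord_space d g.
Proof. by apply/coord_spaceP => i; rewrite leqNgt ltn_ord. Qed.

Lemma mem_box_enum b g : (g \in box_enum b) = box d b g.
Proof.
apply/imageP/boxP => [[f _ ->]|[_ gb]].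
  split; first by apply/coord_spaceP => i; rewrite leqNgt ltn_ord.
  by move=> i; rewrite mxE absz_centered.
have /fin_all_exists[f fP] i : exists a : 'I_b.*2.+1, centered a = g 0 i.
  by apply: centered_surj (gb i).
by exists (finfun f) => //; apply/rowP => i; rewrite mxE ffunE fP.
Qed.

End BoxEnum.

(** * Pairing of Laurent polynomials with configurations *)

Section Pairing.

Variables (k K : fieldType) (iota : {rmorphism k -> K}) (d : nat).
Notation G := 'rV[int]_d.
Variable chi : G -> K.
Hypothesis chiP : independent_character iota chi.
Notation span := (span iota chi).

Lemma span_inter (X Y : pred G) a : span X a -> span Y a -> span (predI X Y) a.
Proof.
move=> Xa Ya; have [b [c [defa Yb Yc]]] := span_split Y Xa.
rewrite defa; suff -> : c = 0 by rewrite addr0.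
apply: (chi_indep chiP _ Yc (Y := Y)) => [g /andP[]//|].
have -> : c = a - b by rewrite defa addrAC subrr add0r.
by apply: spanB => //; apply: span_sub Yb => g /andP[].
Qed.

(** A relation between monomials holds coefficient by coefficient, so the monomials may be replaced
    by the values of any configuration. *)
Lemma pairing_eq0 (T : eqType) (s : seq T) (c : T -> k) (u : T -> G) (x : G -> k) :
  \sum_(t <- s) iota (c t) * chi (u t) = 0 -> \sum_(t <- s) c t * x (u t) = 0.
Proof.
move=> sum0; pose U := undup [seq u t | t <- s].
have split_sum (R : nmodType) (F : T -> R) :
    \sum_(t <- s) F t = \sum_(g <- U) \sum_(t <- s | u t == g) F t.
  rewrite (exchange_big_dep xpredT) //=; apply: eq_big_seq => t ts.
  rewrite big_mkcond (bigD1_seq (u t)) ?undup_uniq //=; last by rewrite mem_undup map_f.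
  by rewrite eqxx big1 ?addr0 // => g /negPf; rewrite eq_sym => ->.
rewrite split_sum big_seq big1 // => g gU.
pose v g := \sum_(t <- s | u t == g) iota (c t) * chi (u t).
have v_lev g' : span (fun h => h == g') (v g').
  by apply: span_sum => t ut; apply: span_chi.
have /eqP : v g = 0.
  apply: (span_levels_eq0 (lev := id) chiP _ v_lev _ gU); first exact: undup_uniq.
  by rewrite -split_sum.
have -> : v g = iota (\sum_(t <- s | u t == g) c t) * chi g.
  by rewrite rmorph_sum mulr_suml; apply: eq_bigr => t /eqP->.
rewrite mulf_eq0 (negPf (chi_neq0 chiP g)) orbF fmorph_eq0 => /eqP c0.
under eq_bigr => t /eqP-> do over.
by rewrite -mulr_suml c0 mul0r.
Qed.

Lemma span_box_repr b (Y : pred G) a : span (predI (box d b) Y) a ->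
  exists c : G -> k, (forall g, ~~ Y g -> c g = 0) /\
    a = \sum_(g : seq_sub (box_enum d b)) iota (c (val g)) * chi (val g).
Proof.
move: a; apply: span_ind => [|c0 g0 a /andP[g0b Yg0] [c [cY ->]]].
  by exists (fun=> 0); split=> //; rewrite big1 // => g _; rewrite rmorph0 mul0r.
exists (fun g => c0 *+ (g == g0) + c g); split=> [g nYg|].
  rewrite cY // addr0; case: eqP => [gg0|//].
  by rewrite gg0 (Yg0 : Y g0) in nYg.
under [RHS]eq_bigr do rewrite rmorphD mulrDl.
have g0e : g0 \in box_enum d b by rewrite mem_box_enum.
rewrite big_split /=; congr (_ + _).
rewrite (bigD1 (SeqSub g0e)) //= eqxx mulr1n big1 ?addr0 // => g ng.
have /negPf -> : ssval g != g0 by apply: contraNneq ng => gg0; apply/eqP/val_inj.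
by rewrite mulr0n rmorph0 mul0r.
Qed.

End Pairing.

Section Extension.

Variables (k K : fieldType) (iota : {rmorphism k -> K}) (d : nat).
Notation G := 'rV[int]_d.
Variable chi : G -> K.
Hypothesis chiP : independent_character iota chi.
Notation span := (span iota chi).

Variables (V : finLmodType k) (M : {fset G}) (c : {linear {ffun M -> V} -> V}).

Definition linear_ca (x : G -> V) (g : G) : V := c [ffun m : M => x (g + val m)].

Variables (N : nat) (e : 'I_N -> V) (co : V -> 'I_N -> k).
Hypothesis coE : forall v, v = \sum_l co v l *: e l.
Hypothesis eK : forall a l, co (\sum_l a l *: e l) l = a l.

Lemma co_linear a u v l : co (a *: u + v) l = a * co u l + co v l.
Proof.
rewrite [u in LHS]coE [v in LHS]coE scaler_sumr -big_split /=.
under eq_bigr do rewrite scalerA -scalerDl.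
by rewrite eK.
Qed.

Definition coef_ca (m : M) (i l : 'I_N) : k :=
  co (c [ffun m' => if m' == m then e l else 0]) i.

Lemma co0 i : co 0 i = 0.
Proof.
have := co_linear 1 0 0 i; rewrite scaler0 addr0 mul1r => /eqP.
by rewrite -subr_eq subrr => /eqP.
Qed.

Lemma co_sum (T : finType) (F : T -> k) (v : T -> V) i :
  co (\sum_t F t *: v t) i = \sum_t F t * co (v t) i.
Proof.
elim/big_rec2: _ => [|t a u _ <-]; [exact: co0 | exact: co_linear].
Qed.

Lemma co_linear_ca x g i :
  co (linear_ca x g) i = \sum_m \sum_l coef_ca m i l * co (x (g + val m)) l.
Proof.
rewrite /linear_ca.
have -> : [ffun m : M => x (g + val m)] = \sum_(p : M * 'I_N)
    co (x (g + val p.1)) p.2 *: [ffun m' => if m' == p.1 then e p.2 else 0].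
  apply/ffunP => m; rewrite ffunE sum_ffunE.
  rewrite -(pair_bigA _ (fun m1 l => (co (x (g + val m1)) l *:
    [ffun m' => if m' == m1 then e l else 0] : {ffun M -> V}) m)) /=.
  rewrite (bigD1 m) //= [X in _ = _ + X]big1 ?addr0 => [|m1 nm]; last first.
    apply: big1 => l _; rewrite !ffunE eq_sym (negPf nm) scaler0 //.
  rewrite [LHS]coE; apply: eq_bigr => l _; by rewrite !ffunE eqxx.
rewrite linear_sum; under eq_bigr do rewrite linearZ.
rewrite co_sum pair_big /=; apply: eq_bigr => -[m l] _; exact: mulrC.
Qed.

Variables (E : pred G) (r : nat).
Hypothesis N_le : (N <= r)%N.
Hypothesis M_box : forall m : M, box d r (val m).
Hypothesis E_box : forall g, E g -> box d r g.

Let B := solution_bound d d r.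

(** Fredholm's alternative. An obstruction is a multiplier [y] supported in the box of radius [b]
    off [E], for which the combined equations involve only cells of the prescribed pattern. A
    multiplier in the box of radius [B] with the same right-hand side imposes the same condition on
    the pattern, and this one holds because [z] satisfies the equations there. So [B] is independent
    of [b]. *)
Lemma window_extension (z : G -> V) (b : nat) :
  (forall g, box d B g -> ~~ E g -> linear_ca z g = 0) ->
  exists z' : G -> V,
    (forall g, box d b g -> ~~ E g -> linear_ca z' g = 0) /\
    (forall g, box d r g -> z' g = z g).
Proof.
move=> Tz.
pose U := seq_sub (box_enum d (b + r)); pose W := seq_sub (box_enum d b).
pose F := seq_sub (box_enum d r).
have inU g : box d (b + r) g -> exists u : U, val u = g.
  by rewrite -mem_box_enum => h; exists (SeqSub h).
have inW g : box d b g -> exists u : W, val u = g.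
  by rewrite -mem_box_enum => h; exists (SeqSub h).
have inF g : box d r g -> exists u : F, val u = g.
  by rewrite -mem_box_enum => h; exists (SeqSub h).
have Wbox (u : W) : box d b (val u) by rewrite -mem_box_enum; exact: valP.
have Fbox (u : F) : box d r (val u) by rewrite -mem_box_enum; exact: valP.
have sumU (R : nmodType) (H : G -> R) g : box d (b + r) g ->
    \sum_(u : U | g == val u) H (val u) = H g.
  by move=> /inU[u <-]; rewrite (big_pred1 u).
pose A (j : W * 'I_N + F * 'I_N) (p : U * 'I_N) : k :=
  match j with
  | inl q => if E (val q.1) then 0 else
     \sum_(m : M | val q.1 + val m == val p.1) coef_ca m q.2 p.2
  | inr q => ((val q.1 == val p.1) && (q.2 == p.2))%:R
  end.
pose w (j : W * 'I_N + F * 'I_N) : k :=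
  match j with inl _ => 0 | inr q => co (z (val q.1)) q.2 end.
have [zz zzE] : exists zz, forall j, \sum_p A j p * zz p = w j.
  apply: fredholm => a aA; rewrite big_sumType /=.
  rewrite big1 ?add0r => [|q _]; last by rewrite mulr0.
  (* The rows of cells in [E] are zero, so their multipliers are replaced by 0. *)
  pose alpha (q : W * 'I_N) := if E (val q.1) then 0 else a (inl q).
  pose AK l i := \sum_(m : M) iota (coef_ca m i l) * chi (val m).
  pose y i := \sum_(g : W) iota (alpha (g, i)) * chi (val g).
  pose wK l := - \sum_(f : F) iota (a (inr (f, l))) * chi (val f).
  have AKy l : \sum_i AK l i * y i = wK l.
    apply/eqP; rewrite -addr_eq0; apply/eqP.
    transitivity (\sum_(u : U) iota (\sum_j a j * A j (u, l)) * chi (val u)); last first.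
      by rewrite big1 // => u _; rewrite aA rmorph0 mul0r.
    under [RHS]eq_bigr do rewrite rmorph_sum mulr_suml big_sumType /=.
    rewrite big_split /=; congr (_ + _); rewrite exchange_big /=.
      rewrite sum_pair exchange_big.
      apply: eq_bigr => i _; rewrite mulr_sumr; apply: eq_bigr => g _.
      rewrite mulr_suml /alpha /=; case: ifP => Eg.
        rewrite big1 => [|m _]; last by rewrite rmorph0 mul0r mulr0.
        by rewrite big1 // => u _; rewrite mulr0 rmorph0 mul0r.
      transitivity (\sum_(u : U) \sum_(m : M | val g + val m == val u)
          iota (a (inl (g, i)) * coef_ca m i l) * chi (val u)); last first.
        by apply: eq_bigr => u _; rewrite mulr_sumr rmorph_sum mulr_suml.
      rewrite (exchange_big_dep xpredT) //=; apply: eq_bigr => m _.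
      rewrite (sumU _ (fun h => iota (a (inl (g, i)) * coef_ca m i l) * chi h)); last exact: boxD (Wbox g) (M_box m).
      by rewrite (chiD chiP) rmorphM mulrACA [RHS]mulrACA; ring.
    rewrite sum_pair; apply: eq_bigr => f _; rewrite (bigD1 l) //= [X in _ = _ + X]big1 ?addr0 => [|l' nl].
      rewrite -(sumU _ (fun h => iota (a (inr (f, l))) * chi h)); last first.
        by apply: box_leq (Fbox f); apply: leq_addl.
      rewrite [LHS]big_mkcond; apply: eq_bigr => u _; rewrite eqxx andbT.
      by case: eqP; rewrite ?mulr1 // mulr0 rmorph0 mul0r.
    by rewrite big1 // => u _; rewrite (negPf nl) andbF mulr0 rmorph0 mul0r.
  have [|l i|l|i|y' [y'B AKy' yy']] :=
      @bounded_solutionsP k K iota d d r (leqnn d) chi chiP 'I_N 'I_N AK wK y _ _ _ _ AKy.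
  - by rewrite card_ord.
  - by apply: span_sum => m _; apply: span_chi; apply: M_box.
  - by apply: spanN; apply: span_sum => f _; apply: span_chi.
  - by apply: span_sum => g _; apply: span_chi; apply: coord_space_full.
  (* [y] has no coefficient on [E], and [y'] agrees with it in a box that contains [E]. *)
  have y'nE i : span (predI (box d B) (predC E)) (y' i).
    apply: span_inter => //; rewrite -[y' i](subKr (y i)); apply: spanB.
      apply: span_sum => g _; rewrite /alpha /=; case: ifP => Eg.
        by rewrite rmorph0 mul0r; apply: span0.
      by apply: span_chi; rewrite /= Eg.
    apply: span_sub (yy' i) => g /andP[ngr _]; apply: contra ngr; exact: E_box.
  have /fin_all_exists[al alP] i := span_box_repr (y'nE i).
  (* The relation [AKy' l] evaluated on the configuration [z]. *)
  have pairl l : \sum_i \sum_m \sum_(g : seq_sub (box_enum d B))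
        coef_ca m i l * al i (val g) * co (z (val g + val m)) l
      + \sum_(f : F) a (inr (f, l)) * co (z (val f)) l = 0.
    pose T := ('I_N * (M * seq_sub (box_enum d B)) + F)%type.
    pose ct (t : T) := match t with
      | inl (i, (m, g)) => coef_ca m i l * al i (val g)
      | inr f => a (inr (f, l)) end.
    pose ut (t : T) := match t with inl (i, (m, g)) => val g + val m | inr f => val f end.
    have sum3 (R : nmodType) (H : 'I_N -> M -> seq_sub (box_enum d B) -> R) :
        \sum_i \sum_m \sum_g H i m g = \sum_p H p.1 p.2.1 p.2.2.
      by rewrite -(pair_bigA _ (fun i q => H i q.1 q.2)); apply: eq_bigr => i _;
         rewrite -(pair_bigA _ (fun m g => H i m g)).
    have := pairing_eq0 chiP (s := index_enum T) (c := ct) (u := ut)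
      (fun g => co (z g) l).
    rewrite !big_sumType /= sum3 => pair0; rewrite -[RHS]pair0.
      by congr (_ + _); apply: eq_bigr => -[i [m g]].
    have := AKy' l; move/eqP; rewrite -addr_eq0 => /eqP AK0; rewrite -[RHS]AK0.
    congr (_ + _); transitivity (\sum_i \sum_m \sum_(g : seq_sub (box_enum d B))
        iota (coef_ca m i l * al i (val g)) * chi (val g + val m)).
      by rewrite sum3; apply: eq_bigr => -[i [m g]].
    apply: eq_bigr => i _; rewrite mulr_suml; apply: eq_bigr => m _.
    have [_ ->] := alP i; rewrite mulr_sumr; apply: eq_bigr => g _.
    by rewrite (chiD chiP) rmorphM; ring.
  rewrite sum_pair exchange_big /=.
  transitivity (- \sum_l \sum_i \sum_m \sum_(g : seq_sub (box_enum d B))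
      coef_ca m i l * al i (val g) * co (z (val g + val m)) l).
    rewrite -sumrN; apply: eq_bigr => l _; apply/eqP.
    by rewrite -addr_eq0 addrC pairl.
  rewrite exchange_big big1 ?oppr0 //= => i _.
  (* Grouped by cells, the multipliers meet the values of [linear_ca z], which vanish on the box off
     [E]; on [E] the multipliers vanish. *)
  transitivity (\sum_(g : seq_sub (box_enum d B)) al i (val g) * co (linear_ca z (val g)) i).
    under [RHS]eq_bigr do rewrite co_linear_ca mulr_sumr.
    rewrite [RHS]exchange_big /= [LHS]exchange_big; apply: eq_bigr => m _ /=.
    rewrite exchange_big; apply: eq_bigr => g _ /=.
    by rewrite mulr_sumr; apply: eq_bigr => l _; ring.
  apply: big1 => g _; have [alE _] := alP i.
  have [Eg|nEg] := boolP (E (val g)); first by rewrite alE ?mul0r //= Eg.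
  rewrite Tz //; last by rewrite -mem_box_enum; apply: valP.
  by rewrite co0 mulr0.
pose z' g := if insub g is Some u then \sum_l zz (u, l) *: e l else 0.
have z'E (u : U) l : co (z' (val u)) l = zz (u, l) by rewrite /z' valK eK.
exists z'; split=> g gb.
  move=> nEg; rewrite [LHS]coE big1 // => i _.
  suff -> : co (linear_ca z' g) i = 0 by rewrite scale0r.
  have [u ug] := inW g gb; rewrite -[RHS](zzE (inl (u, i))) /= ug (negPf nEg).
  rewrite co_linear_ca sum_pair exchange_big [RHS]exchange_big; apply: eq_bigr => l _ /=.
  under [RHS]eq_bigr do rewrite mulr_suml.
  rewrite (exchange_big_dep xpredT) //=; apply: eq_bigr => m _.
  under eq_bigr do rewrite -z'E.
  by rewrite (sumU _ (fun h => coef_ca m i l * co (z' h) l)) ?ug //; apply: boxD gb (M_box m).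
have [f fg] := inF g gb; rewrite [RHS]coE [LHS]coE; apply: eq_bigr => l _.
congr (_ *: _); have := zzE (inr (f, l)); rewrite /= fg => <-.
rewrite sum_pair exchange_big (bigD1 l) //= [X in _ = _ + X]big1 ?addr0 => [|l' nl].
  rewrite -(sumU _ (fun h => co (z' h) l)); last by apply: box_leq gb; apply: leq_addl.
  rewrite [LHS]big_mkcond; apply: eq_bigr => u _; rewrite eqxx andbT z'E.
  by case: eqP; rewrite ?mul1r ?mul0r.
by rewrite big1 // => u _; rewrite [l == _]eq_sym (negPf nl) andbF mul0r.
Qed.

(** The extensions to all finite windows are combined by compactness; [pickle] turns configurations
    into sequences. *)
Theorem configuration_extension (z : G -> V) :
  (forall g, box d B g -> ~~ E g -> linear_ca z g = 0) ->
  exists z' : G -> V,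
    (forall g, ~~ E g -> linear_ca z' g = 0) /\
    (forall g, box d r g -> z' g = z g).
Proof.
move=> /window_extension ext.
pose Q n (f : nat -> V) :=
  (forall g, box d n g -> ~~ E g -> linear_ca (fun g => f (choice.pickle g)) g = 0) /\
  (forall g, box d r g -> f (choice.pickle g) = z g).
have [f fP] : exists f, forall n, Q n f.
  apply: konig => [n|n f [f1 f2]|n].
  - have [z' [z1 z2]] := ext n; exists (fun i => oapp z' 0 (choice.unpickle i)).
    have unp : (fun g : G => oapp z' 0 (choice.unpickle (choice.pickle g))) =1 z'.
      by move=> g; rewrite choice.pickleK.
    split=> [g gn nEg|g gr]; last by rewrite choice.pickleK /= z2.
    rewrite -[RHS](z1 g) // /linear_ca; congr (c _).
    by apply/ffunP => m; rewrite !ffunE unp.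
  - by split=> // g gn; apply: f1; apply: box_leq gn.
  pose s := [seq g + val m | g <- box_enum d n, m <- enum {: M}] ++ box_enum d r.
  exists (\max_(g <- s) (choice.pickle g).+1)%N => f g fg [f1 f2].
  have fgs h : h \in s -> f (choice.pickle h) = g (choice.pickle h).
    move=> hs; apply: fg.
    exact: (@leq_bigmax_seq _ _ xpredT (fun g => (choice.pickle g).+1)).
  split=> h hb.
    move=> nEh; rewrite -[RHS](f1 h) // /linear_ca; congr (c _).
    apply/ffunP => m; rewrite !ffunE -fgs // mem_cat.
    by apply/orP; left; apply/allpairsPdep; exists h, m; rewrite mem_box_enum mem_enum.
  by rewrite -fgs ?f2 // mem_cat mem_box_enum hb orbT.
exists (fun g => f (choice.pickle g)); split=> g; last by case: (fP 0%N) => _; apply.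
have [n gn] : exists n, box d n g.
  exists (\max_i absz (g 0%R i))%N; apply/boxP; split.
    by apply/coord_spaceP => i; rewrite leqNgt ltn_ord.
  by move=> i; apply: (leq_bigmax i).
by case: (fP n) => + _; apply.
Qed.

End Extension.

(** * A field of Laurent polynomials *)

Section LaurentMonomials.

Import mpoly.
Variables (k : fieldType) (d : nat).
Notation G := 'rV[int]_d.
Notation P := {mpoly k[d]}.
Implicit Types g h : G.
Notation K := {fraction P}.

Definition laurent_const (c : k) : K := tofrac (mpolyC d c).

Lemma laurent_const_additive : zmod_morphism laurent_const.
Proof. by move=> a b; rewrite /laurent_const mpolyCB tofracB. Qed.

Lemma laurent_const_multiplicative : monoid_morphism laurent_const.
Proof. by split=> [|a b]; rewrite /laurent_const ?mpolyC1 ?tofrac1 // mpolyCM tofracM. Qed.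

HB.instance Definition _ := GRing.isZmodMorphism.Build k K laurent_const laurent_const_additive.
HB.instance Definition _ := GRing.isMonoidMorphism.Build k K laurent_const laurent_const_multiplicative.

Definition shifted_exponent (b : nat) (g : G) : 'X_{1..d} :=
  [multinom absz (g 0%R i + b%:Z)%R | i < d].

Definition exponent_bound (g : G) : nat := \max_i absz (g 0%R i).

(** Exponents are made nonnegative by a shift of numerator and denominator; any larger shift gives
    the same fraction. *)
Definition laurent_monomial (g : G) : K :=
  tofrac 'X_[k, shifted_exponent (exponent_bound g) g]
  / tofrac 'X_[k, shifted_exponent (exponent_bound g) 0].

Lemma mpolyX_frac_neq0 (m : 'X_{1..d}) : tofrac 'X_[k, m] != 0 :> K.
Proof.
rewrite tofrac_eq0; apply/eqP => /(congr1 (mcoeff m)) /eqP.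
by rewrite mcoeffX eqxx mcoeff0 oner_eq0.
Qed.

Lemma exponent_boundP g i : (absz (g 0%R i) <= exponent_bound g)%N.
Proof. exact: (leq_bigmax i). Qed.

Lemma laurent_monomialE b g : (exponent_bound g <= b)%N ->
  laurent_monomial g =
    tofrac 'X_[k, shifted_exponent b g] / tofrac 'X_[k, shifted_exponent b 0].
Proof.
move=> le_b; apply/eqP; rewrite eqr_div ?mpolyX_frac_neq0 // -!tofracM -!mpolyXD.
apply/eqP; congr (tofrac 'X_[_]); apply/mnmP => i; rewrite !mnmDE !mnmE mxE.
by have := exponent_boundP g i; lia.
Qed.

(** Every large [b] clears the denominators, so one [b] serves for two elements. They are then
    compared as polynomials, where monomials are independent by construction. *)
Lemma span_clear_denominators (X : pred G) a :
  span laurent_const laurent_monomial X a -> exists b0 : nat,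
  forall b, (b0 <= b)%N -> exists2 p : P,
    tofrac p = tofrac 'X_[k, shifted_exponent b 0] * a &
    forall m, p@_m != 0 -> exists2 g, X g &
      (exponent_bound g <= b)%N /\ m = shifted_exponent b g.
Proof.
move: a; apply: span_ind => [|c g a Xg [b0 hb0]].
  exists 0%N => b _; exists 0; first by rewrite tofrac0 mulr0.
  by move=> m; rewrite mcoeff0 eqxx.
exists (maxn b0 (exponent_bound g)) => b; rewrite geq_max => /andP[/hb0[p pE pX] le_b].
exists (c *: 'X_[shifted_exponent b g] + p).
  rewrite tofracD pE mulrDr; congr (_ + _).
  rewrite (laurent_monomialE le_b) -mul_mpolyC tofracM -[tofrac c%:MP]/(laurent_const c).
  by rewrite mulrCA [X in _ = _ * X]mulrC divfK ?mpolyX_frac_neq0.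
move=> m; rewrite mcoeffD mcoeffZ mcoeffX.
have [<- _|_] := eqVneq (shifted_exponent b g) m; first by exists g.
by rewrite mulr0 add0r; apply: pX.
Qed.

Lemma shifted_exponent_inj b g h : (exponent_bound g <= b)%N ->
  (exponent_bound h <= b)%N -> shifted_exponent b g = shifted_exponent b h -> g = h.
Proof.
move=> gb hb /mnmP gh; apply/rowP => i; have := gh i; rewrite !mnmE.
have := exponent_boundP g i; have := exponent_boundP h i; lia.
Qed.

Lemma independent_laurent_monomial :
  independent_character laurent_const laurent_monomial.
Proof.
split=> [g h||X Y a XY /span_clear_denominators[b1 h1] /span_clear_denominators[b2 h2]].
- pose b := (exponent_bound g + exponent_bound h + exponent_bound (g + h)%R)%N.
  rewrite !(@laurent_monomialE b) /b; try lia.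
  rewrite mulf_div -!tofracM -!mpolyXD; apply/eqP.
  rewrite eqr_div ?mpolyX_frac_neq0 // -!tofracM -!mpolyXD.
  apply/eqP; congr (tofrac 'X_[_]); apply/mnmP => i; rewrite !mnmDE !mnmE !mxE.
  have := exponent_boundP g i; have := exponent_boundP h i.
  have := exponent_boundP (g + h) i; rewrite mxE.
  move: (g 0 i) (h 0 i) (exponent_bound (g + h)%R) => x y m.
  by rewrite -[(_ + _)%R]/(x + y); lia.
- by rewrite /laurent_monomial divff ?mpolyX_frac_neq0.
have [p pE pX] := h1 _ (leq_maxl b1 b2); have [q qE qY] := h2 _ (leq_maxr b1 b2).
have pq : p = q by apply/eqP; rewrite -tofrac_eq pE qE.
suff p0 : p = 0.
  move/esym/eqP: pE; rewrite p0 tofrac0 mulf_eq0 (negPf (mpolyX_frac_neq0 _)).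
  by move/eqP.
apply/mpolyP => m; rewrite mcoeff0; apply/eqP/negPn/negP => pm.
have [g Xg [gb mg]] := pX m pm; rewrite pq in pm; have [h Yh [hb mh]] := qY m pm.
have gh : g = h by apply: (shifted_exponent_inj gb hb); rewrite -mg.
by have := XY g Xg; rewrite gh Yh.
Qed.

End LaurentMonomials.

Lemma independent_character_exists (k : fieldType) (d : nat) :
  exists (K : fieldType) (iota : {rmorphism k -> K}) (chi : 'rV[int]_d -> K),
    independent_character iota chi.
Proof.
exists _, (@laurent_const k d : {rmorphism k -> _}), (@laurent_monomial k d).
exact: independent_laurent_monomial.
Qed.

(** * Linear cellular automata with finitely many powers *)

Section Frobenius.

Variables (K : fieldType) (p : nat).
Hypothesis pK : p \in [pchar K].

Lemma coef_exp_pchar (f : {poly K}) i : (f ^+ p)`_(i * p) = f`_i ^+ p.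
Proof.
have pP : p \in [pchar {poly K}] by rewrite pchar_poly.
have p_gt0 : (0 < p)%N by apply/prime_gt0/(pcharf_prime pK).
rewrite -{1}[f]coefK poly_def -(pFrobenius_autE pP) rmorph_sum /= coef_sum.
have term (j : 'I_(size f)) : (pFrobenius_aut pP (f`_j *: 'X^j))`_(i * p)
    = f`_j ^+ p *+ (i == j).
  rewrite pFrobenius_autE exprZn -exprM coefZ coefXn eqn_pmul2r // mulr_natr.
  by [].
under eq_bigr do rewrite term.
have [lt_i|le_i] := ltnP i (size f).
  rewrite (bigD1 (Ordinal lt_i)) //= eqxx big1 ?addr0 // => j.
  by rewrite -val_eqE eq_sym => /negPf /= ->.
rewrite nth_default // expr0n (gtn_eqF p_gt0) big1 // => j _.
by rewrite gtn_eqF // (leq_trans (ltn_ord j)).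
Qed.

(** Since X is central, Frobenius gives (X - A)^p = X^p - A^p. On determinants, the p-th power of
    the characteristic polynomial of A is that of A^p evaluated at X^p. *)
Lemma char_poly_exp_pchar n (A : 'M[K]_n.+1) i :
  (char_poly (A ^+ p))`_i = (char_poly A)`_i ^+ p.
Proof.
have p_gt0 : (0 < p)%N by apply/prime_gt0/(pcharf_prime pK).
have pM : p \in [pchar 'M[{poly K}]_n.+1].
  rewrite inE (pcharf_prime pK) /=.
  by rewrite -(rmorph_nat (@scalar_mx _ n.+1)) -(rmorph_nat (@polyC _)) (pcharf0 pK) !rmorph0.
rewrite -coef_exp_pchar /char_poly.
have detX (M : 'M[{poly K}]_n.+1) m : \det (M ^+ m) = \det M ^+ m.
  elim: m => [|m IH]; first by rewrite !expr0 det1.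
  by rewrite !exprS -IH -det_mulmx.
have -> : \det (char_poly_mx A) ^+ p = \det (char_poly_mx (A ^+ p)) \Po 'X^p.
  rewrite -detX -[RHS]/(comp_poly 'X^p _) -det_map_mx; congr (\det _).
  rewrite /char_poly_mx -(pFrobenius_autE pM) pFrobenius_autB_comm; last first.
    exact/esym/scalar_mxC.
  rewrite !pFrobenius_autE -rmorphXn /= map_mxB map_scalar_mx /= comp_polyX.
  congr (_ - _); rewrite -rmorphXn /=; apply/matrixP => a b.
  by rewrite !mxE /= comp_polyC.
by rewrite coef_comp_poly_Xn // dvdn_mull // mulnK.
Qed.

Lemma char_poly_exp_pchar_iter n (A : 'M[K]_n.+1) r i :
  (char_poly (A ^+ (p ^ r)))`_i = (char_poly A)`_i ^+ (p ^ r).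
Proof.
elim: r => [|r IH]; first by rewrite !expr1.
by rewrite expnSr !exprM char_poly_exp_pchar IH.
Qed.

Lemma exp_pchar_inj r (x y : K) : x ^+ (p ^ r) = y ^+ (p ^ r) -> x = y.
Proof.
elim: r => [|r IH]; first by rewrite !expr1.
by rewrite expnSr !exprM -!(pFrobenius_autE pK) => /fmorph_inj/IH.
Qed.

Lemma bounded_powers (R : pzSemiRingType) (A : R) (m n i : nat) : (0 < n)%N ->
  A ^+ (m + n) = A ^+ m -> exists2 j, (j < m + n)%N & A ^+ i = A ^+ j.
Proof.
move=> n_gt0 Amn; elim: i => [|i [j lt_j Aij]].
  by exists 0%N; rewrite // addn_gt0 n_gt0 orbT.
have [eq_j|ne_j] := eqVneq j.+1 (m + n)%N.
  exists m; first by rewrite -addn1 leq_add2l.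
  by rewrite exprS Aij -exprS eq_j.
by exists j.+1; [rewrite ltn_neqAle ne_j | rewrite exprS Aij -exprS].
Qed.

(** The repetition is sought among the exponents p^i because the characteristic polynomials of these
    powers are given by [char_poly_exp_pchar_iter]. *)
Lemma repeated_pchar_power (R : pzSemiRingType) (A : R) (m n : nat) : (0 < n)%N ->
  A ^+ (m + n) = A ^+ m ->
  exists r s, (r < s)%N /\ A ^+ (p ^ r) = A ^+ (p ^ s).
Proof.
move=> n_gt0 Amn.
have /fin_all_exists[f fP] (i : 'I_(m + n).+1) :
    exists j : 'I_(m + n), A ^+ (p ^ i) = A ^+ j.
  by have [j lt_j ->] := bounded_powers (p ^ i) n_gt0 Amn; exists (Ordinal lt_j).
have /injectivePn[i [j nij fij]] : ~~ injectiveb f.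
  by apply/negP => /injectiveP/leq_card; rewrite !card_ord ltnn.
have : A ^+ (p ^ i) = A ^+ (p ^ j) by rewrite !fP fij.
by have := neq_ltn i j; rewrite nij => /esym/orP[lt|lt] E; [exists i, j|exists j, i].
Qed.

End Frobenius.

Section ConstantCoefficients.

Variables (k K : fieldType) (iota : {rmorphism k -> K}) (d : nat).
Notation G := 'rV[int]_d.
Variable chi : G -> K.
Hypothesis chiP : independent_character iota chi.
Notation spanT := (span iota chi predT).
Variable p : nat.
Hypothesis pK : p \in [pchar K].

Lemma chiMn g n : chi (g *+ n) = chi g ^+ n.
Proof.
elim: n => [|n IH]; first by rewrite mulr0n expr0 (chi0 chiP).
by rewrite mulrS exprS (chiD chiP) IH.
Qed.

Lemma exp_span m (S : seq G) (c : G -> k) :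
  (\sum_(g <- S) iota (c g) * chi g) ^+ (p ^ m) =
  \sum_(g <- S) iota (c g ^+ (p ^ m)) * chi (g *+ (p ^ m)).
Proof.
elim: m => [|m IH].
  by rewrite expr1; apply: eq_bigr => g _; rewrite expr1 mulr1n.
rewrite expnSr exprM IH -(pFrobenius_autE pK) rmorph_sum; apply: eq_bigr => g _.
by rewrite /= pFrobenius_autE exprMn -rmorphXn -exprM -chiMn -mulrnA.
Qed.

(* Multiplication by [p ^ m] strictly increases the norm of a nonzero exponent,
   so the support of a solution of [a ^+ (p ^ m) = a] is trivial. *)
Lemma span_exp_fixed a m : (0 < m)%N -> spanT a -> a ^+ (p ^ m) = a ->
  exists c, a = iota c.
Proof.
move=> m_gt0 /span_repr[S [c [uS Sc ->]]]; rewrite exp_span => fixed_a.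
have Q_gt1 : (1 < p ^ m)%N by rewrite -(exp1n m) ltn_exp2r // prime_gt1 ?(pcharf_prime pK).
pose norm g := \max_i absz ((g : G) 0%R i).
have normMn g n : norm (g *+ n) = (n * norm g)%N.
  rewrite /norm (big_morph (muln n) (fun a b => maxnMr n a b) (muln0 n)).
  by apply: eq_bigr => i _; rewrite mulmxnE -mulr_natr natz abszM mulnC.
have norm0 g : norm g = 0%N -> g = 0.
  move=> g0; apply/rowP => i; rewrite mxE; apply/eqP; rewrite -absz_eq0 -leqn0.
  by apply: leq_trans (_ : norm g <= 0)%N; [apply: (leq_bigmax i)|rewrite g0].
have [/allP S0|/allPn[g gS ng0]] := boolP (all (fun g => g == 0) S).
  exists (\sum_(g <- S) c g); rewrite rmorph_sum; apply: eq_big_seq => g /S0/eqP ->.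
  by rewrite (chi0 chiP) mulr1.
have /(lev_max (fun g => (norm g)%:Z))[h hS hmax] : S != [::] by case: (S) gS.
have norm_h : (0 < norm h)%N.
  apply: leq_trans (_ : norm g <= _)%N; last by have := hmax g gS; lia.
  by rewrite lt0n; apply: contraNneq ng0 => /norm0 ->.
have [_ /negP[]] := Sc h hS; apply/eqP.
have Qh_nS : (h *+ (p ^ m)) \notin S.
  by apply/negP => /hmax; rewrite normMn; nia.
have : span iota chi (fun g => g != h *+ (p ^ m)) (iota (c h ^+ (p ^ m)) * chi (h *+ (p ^ m))).
  move: fixed_a; rewrite (perm_big _ (perm_to_rem hS)) big_cons => /esym/eqP.
  rewrite -subr_eq => /eqP <-; apply: spanB.
    rewrite big_seq; apply: span_sum => g' g'S; apply: span_chi.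
    by apply: contraNneq Qh_nS => <-.
  rewrite big_seq; apply: span_sum => g'; rewrite mem_rem_uniq // inE => /andP[g'h _].
  apply: span_chi; apply: contraNneq g'h => eqQ.
  have : (g' - h) *+ (p ^ m) = 0 by rewrite mulrnBl eqQ subrr.
  have normz0 : norm 0 = 0%N by rewrite -[0 in LHS](mulr0n 0) normMn mul0n.
  move/(congr1 norm); rewrite normMn normz0 => /eqP.
  rewrite muln_eq0 -leqn0 leqNgt (ltn_trans _ Q_gt1) //= => /eqP/norm0/subr0_eq.
  by move=> ->.
move/(span_coef_eq0 chiP); rewrite eqxx => /(_ isT)/eqP.
by rewrite expf_eq0 => /andP[_ /eqP].
Qed.

End ConstantCoefficients.

Section EventuallyPeriodicMatrix.

Variables (k K : fieldType) (iota : {rmorphism k -> K}) (d : nat).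
Notation G := 'rV[int]_d.
Variable chi : G -> K.
Hypothesis chiP : independent_character iota chi.
Notation span := (span iota chi predT).
Variable p : nat.
Hypothesis pK : p \in [pchar K].

Lemma span_natr n : span n%:R.
Proof.
rewrite -(rmorph_nat iota) -[iota _]mulr1 -(chi0 chiP).
exact: span_chi.
Qed.

Lemma span_char_poly n (A : 'M[K]_n) i :
  (forall a b, span (A a b)) -> span (char_poly A)`_i.
Proof.
move=> As; pose coefs_span (f : {poly K}) := forall i, span f`_i.
suff : coefs_span (char_poly A) by apply.
have coefsD f g : coefs_span f -> coefs_span g -> coefs_span (f + g).
  by move=> fs gs j; rewrite coefD; apply: spanD.
have coefsM f g : coefs_span f -> coefs_span g -> coefs_span (f * g).
  move=> fs gs j; rewrite coefM; apply: span_sum => l _.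
  exact: (spanM chiP (X := predT) (Y := predT)).
have coefsN f : coefs_span f -> coefs_span (- f).
  by move=> fs j; rewrite coefN; apply: spanN.
have coefs_nat (f : {poly K}) m : coefs_span f -> coefs_span (f *+ m).
  move=> fs j; rewrite coefMn -mulr_natr.
  exact: (spanM chiP (X := predT) (Y := predT) _ (fs j) (span_natr m)).
have coefs1 : coefs_span 1 by move=> j; rewrite coef1; apply: span_natr.
have coefs_sign m : coefs_span ((- 1) ^+ m).
  elim: m => [|m IH]; rewrite ?expr0 // exprS.
  by apply: coefsM => //; apply: coefsN.
apply: (big_ind coefs_span) => [j|x y xs ys|s _]; [|exact: coefsD|].
  by rewrite coef0; apply: span0.
apply: (coefsM).
  exact: coefs_sign.
apply: (big_ind coefs_span) => [|x y xs ys|a _]; [done|exact: coefsM|rewrite !mxE; apply: coefsD].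
  by apply: coefs_nat => j; rewrite coefX; apply: span_natr.
apply: coefsN => j; rewrite coefC; case: eqP => _ //; exact: span0.
Qed.

Lemma eventually_periodic_mx n (A : 'M[K]_n.+1) (l m : nat) :
  (forall a b, span (A a b)) -> (0 < m)%N -> A ^+ (l + m) = A ^+ l ->
  exists c : 'I_n.+1 -> k, A ^+ n.+1 = \sum_i iota (c i) *: A ^+ i.
Proof.
move=> As m_gt0 Alm.
have [r [s [lt_rs Ars]]] := repeated_pchar_power p m_gt0 Alm.
have /fin_all_exists[c cP] (i : 'I_n.+1) : exists c, (char_poly A)`_i = iota c.
  apply: (span_exp_fixed (p := p) chiP pK (m := (s - r)%N)).
  - by rewrite subn_gt0.
  - exact: span_char_poly.
  (* Equal powers of the matrix have equal characteristic polynomials; injectivity of Frobenius then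
     cancels the common exponent p^r. *)
  apply: (exp_pchar_inj pK (r := r)); rewrite -exprM -expnD subnK; last exact: ltnW.
  by rewrite -!(char_poly_exp_pchar_iter pK) Ars.
exists (fun i => - c i).
have := Cayley_Hamilton A; rewrite -[char_poly A]coefK poly_def linear_sum /=.
rewrite size_char_poly big_ord_recr /=.
have -> : (char_poly A)`_n.+1 = 1.
  by rewrite -(monicP (char_poly_monic A)) lead_coefE size_char_poly.
under eq_bigr do rewrite linearZ rmorphXn /= horner_mx_X cP.
rewrite linearZ rmorphXn /= horner_mx_X scale1r addrC => /eqP.
rewrite addr_eq0 => /eqP ->; rewrite -sumrN; apply: eq_bigr => i _.
by rewrite rmorphN scaleNr.
Qed.

Lemma mx_pow_span n (A : 'M[K]_n.+1) (c : 'I_n.+1 -> k) :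
  A ^+ n.+1 = \sum_i iota (c i) *: A ^+ i ->
  forall i, exists c' : 'I_n.+1 -> k, A ^+ i = \sum_l iota (c' l) *: A ^+ l.
Proof.
move=> defA; elim=> [|i [c' IH]].
  exists (fun l => (l == ord0)%:R); rewrite big_ord_recl /= rmorph1 scale1r.
  by rewrite big1 ?addr0 // => l _; rewrite rmorph0 scale0r.
pose c1 (l : 'I_n.+1) := (if unlift ord0 l is Some l' then c' (widen_ord (leqnSn n) l') else 0)
   + c' ord_max * c l.
exists c1; rewrite exprS IH mulr_sumr big_ord_recr /=.
under eq_bigr do rewrite -scalerAr -exprS.
rewrite -scalerAr -exprS defA scaler_sumr.
have -> : \sum_l iota (c1 l) *: A ^+ l = \sum_(l < n.+1)
    iota (if unlift ord0 l is Some l' then c' (widen_ord (leqnSn n) l') else 0) *: A ^+ l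
  + \sum_l iota (c' ord_max) *: (iota (c l) *: A ^+ l).
  rewrite -big_split; apply: eq_bigr => l _ /=.
  by rewrite /c1 rmorphD scalerDl rmorphM scalerA.
congr (_ + _); rewrite [RHS]big_ord_recl unlift_none rmorph0 scale0r add0r.
by apply: eq_bigr => l _; rewrite liftK.
Qed.

End EventuallyPeriodicMatrix.

(** * Faithful representation of linear automata by matrices *)

Section Representation.

Variables (k K : fieldType) (iota : {rmorphism k -> K}) (d : nat).
Notation G := 'rV[int]_d.
Variable chi : G -> K.
Hypothesis chiP : independent_character iota chi.

Variables (V : finLmodType k) (n : nat).
Notation N := n.+1.
Variables (e : 'I_N -> V) (co : V -> 'I_N -> k).
Hypothesis coE : forall v, v = \sum_l co v l *: e l.
Hypothesis eK : forall a l, co (\sum_l a l *: e l) l = a l.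

(* The operator [O] is the convolution by the matrix [B] of Laurent polynomials. *)
Definition represented (O : (G -> V) -> G -> V) (B : 'M[K]_N) : Prop :=
  exists s : seq (G * 'M[k]_N),
    (forall x g i, co (O x g) i =
       \sum_(p <- s) \sum_l p.2 i l * co (x (g + p.1)) l) /\
    (forall i l, B i l = \sum_(p <- s) iota (p.2 i l) * chi p.1).

Lemma co_inj v w : (forall i, co v i = co w i) -> v = w.
Proof. by move=> vw; rewrite [v]coE [w]coE; apply: eq_bigr => i _; rewrite vw. Qed.

Lemma represented_id : represented id 1.
Proof.
exists [:: (0, 1)]; split=> [x g i|i l]; rewrite big_seq1 /=.
  rewrite addr0 (bigD1 i) //= big1 ?addr0 => [|l /negPf nl].
    by rewrite mxE eqxx mul1r.
  by rewrite mxE eq_sym nl mul0r.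
by rewrite (chi0 chiP) mulr1 !mxE rmorph_nat.
Qed.

Lemma represented_comp O1 O2 B1 B2 : represented O1 B1 -> represented O2 B2 ->
  represented (fun x => O1 (O2 x)) (B1 * B2).
Proof.
move=> [s1 [O1E B1E]] [s2 [O2E B2E]].
exists [seq (p.1 + q.1, p.2 *m q.2) | p <- s1, q <- s2]; split=> [x g i|i l].
  rewrite O1E big_allpairs_dep /=; apply: eq_bigr => p _.
  under eq_bigr do rewrite O2E mulr_sumr.
  rewrite exchange_big /=; apply: eq_bigr => q _.
  under [RHS]eq_bigr do rewrite mxE mulr_suml.
  under eq_bigr do rewrite mulr_sumr.
  rewrite exchange_big /=; apply: eq_bigr => l _; apply: eq_bigr => h _.
  by rewrite mulrA addrA.
rewrite mxE big_allpairs_dep /=.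
under eq_bigr do rewrite B1E mulr_suml.
rewrite exchange_big /=; apply: eq_bigr => p _.
under eq_bigr do rewrite B2E mulr_sumr.
rewrite exchange_big /=; apply: eq_bigr => q _.
rewrite mxE rmorph_sum mulr_suml (chiD chiP); apply: eq_bigr => h _.
by rewrite rmorphM; ring.
Qed.

Lemma represented_iter O B i : represented O B -> represented (iter i O) (B ^+ i).
Proof.
move=> OB; elim: i => [|i IH]; first exact: represented_id.
rewrite exprS; exact: represented_comp OB IH.
Qed.

(** The entries of the matrix are read off from configurations supported in one cell; conversely,
    [pairing_eq0] evaluates an equality of Laurent polynomials on a configuration. *)
Lemma represented_eq O1 O2 B1 B2 : represented O1 B1 -> represented O2 B2 ->
  (forall x g, O1 x g = O2 x g) <-> B1 = B2.
Proof.
move=> [s1 [O1E B1E]] [s2 [O2E B2E]]; split=> [O12|B12 x g].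
  apply/matrixP => i l; rewrite B1E B2E.
  pose U := undup ([seq p.1 | p <- s1] ++ [seq p.1 | p <- s2]).
  have group (s : seq (G * 'M[k]_N)) : {subset [seq p.1 | p <- s] <= U} ->
      \sum_(p <- s) iota (p.2 i l) * chi p.1 =
      \sum_(u <- U) iota (\sum_(p <- s | p.1 == u) p.2 i l) * chi u.
    move=> sU; under [RHS]eq_bigr do rewrite rmorph_sum mulr_suml.
    rewrite (exchange_big_dep xpredT) //=; apply: eq_big_seq => p ps.
    rewrite big_mkcond (bigD1_seq p.1) ?undup_uniq //=; last by apply/sU/map_f.
    by rewrite eqxx big1 ?addr0 // => g /negPf; rewrite eq_sym => ->.
  rewrite !group; try by move=> u us; rewrite mem_undup mem_cat us ?orbT.
  apply: eq_bigr => u _; congr (iota _ * _).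
  pose x g := if g == u then e l else 0.
  have test (s : seq (G * 'M[k]_N)) : \sum_(p <- s | p.1 == u) p.2 i l =
      \sum_(p <- s) \sum_l' p.2 i l' * co (x (0 + p.1)) l'.
    rewrite big_mkcond; apply: eq_bigr => p _; rewrite add0r /x.
    have co_e l' : co (e l) l' = (l' == l)%:R.
      rewrite -(eK (fun m => (m == l)%:R) l'); congr (co _ _).
      rewrite (bigD1 l) //= eqxx scale1r big1 ?addr0 // => m /negPf ->.
      by rewrite scale0r.
    case: ifP => _.
      rewrite (bigD1 l) //= co_e eqxx mulr1 big1 ?addr0 // => l' /negPf nl.
      by rewrite co_e nl mulr0.
    by rewrite big1 // => l' _; rewrite (co0 coE eK) mulr0.
  by rewrite !test -O1E -O2E O12.
apply: co_inj => i; rewrite O1E O2E exchange_big [RHS]exchange_big.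
apply: eq_bigr => l _ /=.
have pair0 : \sum_(p <- [seq ((p : G * 'M[k]_N).2 i l, p.1) | p <- s1] ++
      [seq (- (p : G * 'M[k]_N).2 i l, p.1) | p <- s2])
    iota p.1 * chi p.2 = 0.
  rewrite big_cat !big_map /=; under [X in _ + X]eq_bigr do rewrite rmorphN mulNr.
  by rewrite sumrN -B1E -B2E B12 subrr.
have := pairing_eq0 chiP (c := fst) (u := snd) (fun u => co (x (g + u)) l) pair0.
rewrite big_cat !big_map /=; under [X in _ + X]eq_bigr do rewrite mulNr.
by rewrite sumrN => /eqP; rewrite subr_eq0 => /eqP.
Qed.

End Representation.

Section Repetition.

Variables (k : fieldType) (V : finLmodType k) (d : nat).
Notation G := 'rV[int]_d.

(** Among the natural multiples of [v0] two coincide, so a positive integer is zero in [k]. *)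
Lemma finite_lmod_pchar (v0 : V) : v0 != 0 -> exists p, p \in [pchar k].
Proof.
move=> v0_neq0; pose f (i : 'I_(#|{: V}|).+1) : V := i%:R *: v0.
have /injectivePn[i [j nij fij]] : ~~ injectiveb f.
  by apply/negP => /injectiveP/leq_card; rewrite card_ord ltnn.
have wlog_lt (a b : nat) : (a < b)%N -> a%:R *: v0 = b%:R *: v0 ->
    exists p, p \in [pchar k].
  move=> lt_ab /eqP; rewrite -subr_eq0 -scalerBl scaler_eq0 (negPf v0_neq0) orbF.
  rewrite -opprB oppr_eq0 -natrB ?(ltnW lt_ab) //.
  by apply: natf0_pchar; rewrite subn_gt0.
by have := neq_ltn i j; rewrite nij => /esym/orP[/wlog_lt|/wlog_lt]; apply.
Qed.

Variables (M : {fset G}) (c : {linear {ffun M -> V} -> V}).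
Notation T := (linear_ca c).

Theorem linear_ca_repetition (v0 : V) (l m : nat) : v0 != 0 -> (0 < m)%N ->
  (forall x, iter (l + m) T x = iter l T x) ->
  exists i j, [/\ (i < j)%N, (j <= #|{: V}|)%N & forall x, iter i T x = iter j T x].
Proof.
move=> v0_neq0 m_gt0 Tlm; have [p pk] := finite_lmod_pchar v0_neq0.
have [[|n] [e [co [leN coE eK]]]] := finite_basis V.
  by case/eqP: v0_neq0; rewrite [v0]coE big_ord0.
have [K [iota [chi chiP]]] := independent_character_exists k d.
pose A : 'M[K]_n.+1 := \matrix_(i, l) \sum_(m : M) iota (coef_ca c e co m i l) * chi (val m).
have TA : represented iota chi co T A.
  exists [seq (val m, \matrix_(i, l) coef_ca c e co m i l) | m <- enum {: M}].
  split=> [x g i|i l'].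
    rewrite (co_linear_ca c coE eK) big_map big_enum; apply: eq_bigr => m' _.
    by apply: eq_bigr => l' _; rewrite mxE.
  by rewrite mxE big_map big_enum; apply: eq_bigr => m' _; rewrite mxE.
have TAi i := represented_iter chiP i TA.
have TA_eq i j : (forall x, iter i T x = iter j T x) <-> A ^+ i = A ^+ j.
  rewrite -(represented_eq chiP coE eK (TAi i) (TAi j)); split=> h x; first by rewrite h.
  by apply: functional_extensionality => g.
have As a b : span iota chi predT (A a b).
  by rewrite mxE; apply: span_sum => m' _; apply: span_chi.
have pK : p \in [pchar K] by rewrite (fmorph_pchar iota).
have [c0 c0P] := eventually_periodic_mx chiP pK As m_gt0 ((TA_eq _ _).1 Tlm).
(* Each power is a constant combination of the first n + 1 ones. Its coefficients are the
   coordinates of a vector of [V], so two of |V| + 1 powers have the same. *)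
have /fin_all_exists[f fP] (i : 'I_(#|{: V}|).+1) :
    exists v : V, A ^+ i = \sum_l iota (co v l) *: A ^+ l.
  have [c' ->] := mx_pow_span c0P i; exists (\sum_l c' l *: e l).
  by apply: eq_bigr => l' _; rewrite eK.
have /injectivePn[i [j nij fij]] : ~~ injectiveb f.
  by apply/negP => /injectiveP/leq_card; rewrite card_ord ltnn.
have Aij : A ^+ i = A ^+ j by rewrite !fP fij.
have := neq_ltn i j; rewrite nij => /esym/orP[lt|lt].
  by exists i, j; split; [|rewrite -ltnS|apply/TA_eq].
by exists j, i; split; [|rewrite -ltnS|apply/TA_eq].
Qed.

End Repetition.

(** * Iterates of a non-uniform cellular automaton *)

Lemma iter_repeat (T : Type) (f : T -> T) x a b q :
  iter a f x = iter b f x -> (a <= q)%N -> iter (q + b - a) f x = iter q f x.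
Proof.
move=> fab le_aq; have -> : (q + b - a = (q - a) + b)%N by lia.
by rewrite iterD -fab -iterD subnK.
Qed.

(* With [b - a] dividing [q] and [a <= q], the point [iter q f x] is on the
   cycle and [q] is a multiple of its length. *)
Lemma iter_idempotent (T : Type) (f : T -> T) x a b q :
  (a < b)%N -> iter a f x = iter b f x -> (a <= q)%N -> (b - a %| q)%N ->
  iter (q + q) f x = iter q f x.
Proof.
move=> lt_ab fab le_aq /dvdnP[c qE].
suff h m : iter (q + m * (b - a)) f x = iter q f x by rewrite {2}qE h.
elim: m => [|m IH]; first by rewrite addn0.
have le_aq' : (a <= q + m * (b - a))%N by rewrite (leq_trans le_aq) ?leq_addr.
have := iter_repeat fab le_aq'; rewrite IH => <-.
by congr iter; rewrite mulSn; lia.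
Qed.

(** Some preperiod and some period are at most [B]; the factorial is at least the former and a
    multiple of the latter, whatever they are. *)
Lemma iter_fact_idempotent (T : Type) (X : finType) (f : T -> T) (st : nat -> X) x B :
  (#|X| <= B)%N -> (forall a b, st a = st b -> iter a f x = iter b f x) ->
  iter (B`! + B`!) f x = iter B`! f x.
Proof.
move=> leB stP; have /injectivePn[i [j nij sij]] : ~~ injectiveb (fun i : 'I_B.+1 => st i).
  apply/negP => /injectiveP/leq_card; rewrite card_ord => /leq_trans/(_ leB).
  by rewrite ltnn.
wlog lt_ij : i j nij sij / (i < j)%N.
  move=> wl; have := neq_ltn i j; rewrite nij => /esym/orP[|] lt; first exact: (wl i j).
  by apply: (wl j i) => //; rewrite eq_sym.
have leq_fact m : (0 < m)%N -> (m <= m`!)%N.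
  by case: m => // m _; rewrite factS leq_pmulr ?fact_gt0.
have B_gt0 : (0 < B)%N by have := ltn_ord j; lia.
apply: (iter_idempotent lt_ij (stP _ _ sij)).
  by apply: leq_trans (leq_fact B B_gt0); have := ltn_ord j; lia.
by apply: dvdn_fact; have := ltn_ord j; lia.
Qed.

(** * Annihilating polynomials and eventual periodicity *)

Section CayleyHamilton.

Variables (G : zmodType) (k : fieldType) (V : finLmodType k) (v0 : V).
Hypothesis v0_neq0 : v0 != 0.
Variable tau : (G -> V) -> G -> V.

(** [tau] can be nonlinear, so it cannot be applied to the relation. Instead the relation, valid for
    all configurations, is applied to [tau x]. *)
Lemma cayley_hamilton_reduce (P : {poly k}) : P != 0 ->
  (forall x g, \sum_(i < size P) P`_i *: iter i tau x g = 0) ->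
  forall i, exists c : 'I_(size P).-1 -> k,
    forall x g, iter i tau x g = \sum_l c l *: iter l tau x g.
Proof.
move=> P_neq0 Ptau.
have [s sE] : exists s, size P = s.+1 by exists (size P).-1; rewrite prednK ?size_poly_gt0.
rewrite sE /= in Ptau *.
have lead : P`_s != 0 by move: P_neq0; rewrite -lead_coef_eq0 lead_coefE sE.
have top : exists c : 'I_s -> k, forall x g, iter s tau x g = \sum_l c l *: iter l tau x g.
  exists (fun l => - (P`_s)^-1 * P`_l) => x g.
  have := Ptau x g; rewrite big_ord_recr /= => /eqP; rewrite addrC addr_eq0 => /eqP.
  move/(congr1 (fun v => (P`_s)^-1 *: v)); rewrite scalerA mulVf // scale1r => ->.
  rewrite scalerN -scaleNr scaler_sumr; apply: eq_bigr => l _.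
  by rewrite scalerA.
elim=> [|i [c cP]].
  case: s {sE Ptau lead} top => [|s] top.
    by have [c cP] := top; exists c => x g; rewrite cP.
  exists (fun l => (l == ord0)%:R) => x g; rewrite big_ord_recl eqxx scale1r.
  by rewrite big1 ?addr0 // => l _; rewrite scale0r.
have [t tP] := top.
have shift_c (l : 'I_s) : exists c' : 'I_s -> k,
    forall x g, iter l.+1 tau x g = \sum_l' c' l' *: iter l' tau x g.
  have [lt_l|] := ltnP l.+1 s; last first.
    by move=> le_s; have -> : l.+1 = s by have := ltn_ord l; lia.
  exists (fun l' => (l' == Ordinal lt_l)%:R) => x g.
  rewrite (bigD1 (Ordinal lt_l)) //= eqxx scale1r big1 ?addr0 // => l' /negPf ->.
  by rewrite scale0r.
have [c' c'P] := fin_all_exists shift_c.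
exists (fun l' => \sum_l c l * c' l l') => x g.
rewrite iterSr cP; under eq_bigr do rewrite -iterSr c'P scaler_sumr.
rewrite exchange_big; apply: eq_bigr => l' _ /=; rewrite scaler_suml.
by apply: eq_bigr => l _; rewrite scalerA.
Qed.

Lemma cayley_hamilton_eventually_periodic :
  cayley_hamilton tau <-> eventually_periodic tau.
Proof.
split=> [[P P_neq0 Ptau]|[m [n [m_gt0 n_gt0 tmn]]]]; last first.
  exists ('X^(n + m) - 'X^m).
    apply/eqP => /(congr1 (fun q : {poly k} => q`_(n + m))) /eqP.
    have /negPf nm : (n + m != m)%N by lia.
    by rewrite coefB !coefXn eqxx nm coef0 subr0 oner_eq0.
  move=> x g; pose Q : {poly k} := 'X^(n + m) - 'X^m.
  have sQ : (size Q <= (n + m).+1)%N.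
    rewrite (leq_trans (size_polyD _ _)) // size_polyN !size_polyXn geq_max leqnn /=.
    by rewrite ltnS leq_addl.
  transitivity (\sum_(i < (n + m).+1) Q`_i *: iter i tau x g).
    rewrite (big_ord_widen _ (fun i => Q`_i *: iter i tau x g) sQ) big_mkcond.
    apply: eq_bigr => i _; case: ltnP => // le_i.
    by rewrite nth_default // scale0r.
  have lt_m : (m < (n + m).+1)%N by rewrite ltnS leq_addl.
  under eq_bigr do rewrite coefB !coefXn scalerBl.
  rewrite sumrB (bigD1 ord_max) //= eqxx scale1r big1 ?addr0 => [|i]; last first.
    by rewrite -val_eqE /= => /negPf ->; rewrite scale0r.
  rewrite (bigD1 (Ordinal lt_m)) //= eqxx scale1r big1 ?addr0 => [|i]; last first.
    by rewrite -val_eqE /= => /negPf ->; rewrite scale0r.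
  by rewrite tmn subrr.
have red := cayley_hamilton_reduce P_neq0 Ptau; set s := (size P).-1 in red.
pose B := #|{ffun 'I_s -> V}|.
have /fin_all_exists[c cP] : forall i : 'I_B.+1, exists c : 'I_s -> k,
    forall x g, iter i tau x g = \sum_l c l *: iter l tau x g by move=> i; apply: red.
(* A scalar is recorded by its multiple of [v0], an element of the finite set [V], which makes the
   pigeonhole principle available. *)
have /injectivePn[i [j nij cij]] :
    ~~ injectiveb (fun i : 'I_B.+1 => [ffun l => c i l *: v0]).
  by apply/negP => /injectiveP/leq_card; rewrite card_ord ltnn.
have {}cij l : c i l = c j l.
  have := congr1 (fun f : {ffun _} => f l) cij; rewrite !ffunE => /eqP.
  by rewrite -subr_eq0 -scalerBl scaler_eq0 (negPf v0_neq0) orbF subr_eq0 => /eqP.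
have tij x : iter i tau x = iter j tau x.
  by apply: functional_extensionality => g; rewrite !cP; under eq_bigr do rewrite cij.
wlog lt_ij : i j nij cij tij / (i < j)%N.
  move=> wl; have := neq_ltn i j; rewrite nij => /esym/orP[|] lt; first exact: (wl i j).
  by apply: (wl j i) => //; rewrite eq_sym.
(* [i] may be 0, while [eventually_periodic] asks for a preperiod of at least 1. *)
exists i.+1, (j - i)%N; split; rewrite ?subn_gt0 // => x.
have -> : (j - i + i.+1 = j.+1)%N by have := lt_ij; lia.
by rewrite !iterSr tij.
Qed.

End CayleyHamilton.

(** * Comparison of the automaton with its limit *)

Section Presented.

Variables (d : nat) (k : fieldType) (V : finLmodType k).
Hypothesis d_ge1 : (1 <= d)%N.
Notation G := 'rV[int]_d.
Notation box := (@box d d).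
Variables (D : presentation d V) (n : nat).
Hypothesis memory_box : forall g, g \in memory D -> box n g.
Hypothesis exceptions_box : forall g, g \in exceptions D -> box n g.
Notation tau := (presented_nuca D).
Notation T := (linear_ca (limit_rule D)).
Implicit Types (x : G -> V) (g u : G).

Lemma presented_nucaE x g :
  tau x g = rule (p := D) g [ffun m : memory D => x (g + val m)].
Proof.
rewrite /presented_nuca /nuca; congr (rule _ _); apply/ffunP => m.
by rewrite !ffunE /shift opprK.
Qed.

Lemma presented_nuca_out x g : g \notin exceptions D -> tau x g = T x g.
Proof. by move=> gE; rewrite presented_nucaE (ruleP gE). Qed.

Lemma boxB_l r r' g u : box r u -> ~~ box (r + r') g -> ~~ box r' (g + u).
Proof.
move=> ur; apply: contra => gr; have := boxD (r := r) (r' := r') (g := - u) _ gr.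
rewrite addrCA [- u + _]addrC subrr addr0; apply.
move: ur => /boxP[_ ur]; apply/boxP; split; first exact: coord_space_full.
by move=> i; rewrite mxE abszN.
Qed.

Lemma memory_val_box (m : memory D) : box n (val m).
Proof. exact/memory_box/valP. Qed.

Lemma presented_nuca_local x y g :
  (forall h, box n (h - g) -> x h = y h) -> tau x g = tau y g.
Proof.
move=> xy; rewrite !presented_nucaE; congr (rule _ _); apply/ffunP => m.
by rewrite !ffunE xy // addrAC subrr add0r; apply: memory_val_box.
Qed.

Lemma linear_ca_local x y g :
  (forall h, box n (h - g) -> x h = y h) -> T x g = T y g.
Proof.
move=> xy; rewrite /linear_ca; congr (limit_rule D _); apply/ffunP => m.
by rewrite !ffunE xy // addrAC subrr add0r; apply: memory_val_box.
Qed.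

(** The difference between [tau] and [T] arises in the box of radius n and spreads by at most n at
    each step. *)
Lemma iter_presented_far l x g : ~~ box (l * n) g -> iter l tau x g = iter l T x g.
Proof.
elim: l g => // l IH g; rewrite mulSn => gfar.
have gE : g \notin exceptions D.
  by apply: contra gfar => /exceptions_box; apply: box_leq; apply: leq_addr.
rewrite /= presented_nuca_out //; apply: linear_ca_local => h hg.
by apply: IH; rewrite -(subrK g h) addrC; apply: boxB_l hg gfar.
Qed.

Lemma linear_ca_translate x u g : T (fun h => x (h + u)) g = T x (g + u).
Proof. by rewrite /linear_ca; congr (limit_rule D _); apply/ffunP => m; rewrite !ffunE addrAC. Qed.

Lemma iter_linear_ca_translate l x u g :
  iter l T (fun h => x (h + u)) g = iter l T x (g + u).
Proof.
elim: l g => // l IH g /=; rewrite -linear_ca_translate.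
by congr (T _ g); apply: functional_extensionality.
Qed.

Lemma far_translate r g : exists u, ~~ box r (g + u).
Proof.
pose i0 := Ordinal d_ge1; exists (((absz (g 0%R i0) + r).+1)%:Z *: delta_mx 0 i0).
apply/negP => /boxP[_ /(_ i0)]; rewrite !mxE !eqxx mulr1.
by move: (g 0 i0) => a; rewrite -[(_ + _)%R]/(a + _); lia.
Qed.

Lemma iter_presented_linear i j :
  (forall x, iter i tau x = iter j tau x) -> forall x, iter i T x = iter j T x.
Proof.
move=> tij x; apply: functional_extensionality => g.
(* [T] commutes with translations, so the cell may be moved beyond the reach of the exceptional
   cells for both iterates. *)
have [u far] := far_translate (maxn (i * n) (j * n)) g.
pose y h := x (h - u).
have xy l : iter l T x g = iter l T y (g + u).
  rewrite -iter_linear_ca_translate; congr (iter l T _ g).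
  by apply: functional_extensionality => h; rewrite /y addrK.
rewrite !xy -!iter_presented_far ?tij //.
  by apply: contra far; apply: box_leq; apply: leq_maxr.
by apply: contra far; apply: box_leq; apply: leq_maxl.
Qed.

Lemma linear_caD x y g : T (fun h => x h + y h) g = T x g + T y g.
Proof.
rewrite /linear_ca -linearD; congr (limit_rule D _).
by apply/ffunP => m; rewrite !ffunE.
Qed.

Lemma linear_caN x g : T (fun h => - x h) g = - T x g.
Proof.
rewrite /linear_ca -linearN; congr (limit_rule D _).
by apply/ffunP => m; rewrite !ffunE.
Qed.

Lemma linear_ca0 g : T (fun=> 0) g = 0.
Proof.
by rewrite /linear_ca (_ : [ffun _ => _] = 0) ?linear0.
Qed.

Lemma iter_linear_caD l x y g :
  iter l T (fun h => x h + y h) g = iter l T x g + iter l T y g.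
Proof.
elim: l g => // l IH g /=; rewrite -linear_caD; congr (T _ g).
exact: functional_extensionality.
Qed.

Lemma iter_linear_ca0 l g : iter l T (fun=> 0) g = 0.
Proof.
elim: l g => // l IH g /=; rewrite -[RHS](linear_ca0 g); congr (T _ g).
exact: functional_extensionality.
Qed.

Lemma linear_ca_support r z : (forall g, ~~ box r g -> z g = 0) ->
  forall g, ~~ box (n + r) g -> T z g = 0.
Proof.
move=> zr g gfar; rewrite -[RHS](linear_ca0 g); apply: linear_ca_local => h hg.
by apply: zr; rewrite -(subrK g h) addrC; apply: boxB_l hg gfar.
Qed.

Lemma iter_linear_ca_support l z : (forall g, ~~ box n g -> z g = 0) ->
  forall g, ~~ box (l.+1 * n) g -> iter l T z g = 0.
Proof.
move=> zn; elim: l => [|l IH]; first by rewrite mul1n.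
by move=> g; rewrite mulSn => /(linear_ca_support IH).
Qed.

Section PeriodicLimit.

Variables (i j : nat).
Hypothesis lt_ij : (i < j)%N.
Hypothesis Tij : forall x, iter i T x = iter j T x.

Lemma iter_linear_ca_bounded l : exists2 l', (l' < j)%N & forall x, iter l T x = iter l' T x.
Proof.
elim: l => [|l [l' lt_l' IH]]; first by exists 0%N; rewrite // (leq_trans _ lt_ij).
have [eq_l'|ne_l'] := eqVneq l'.+1 j; last first.
  by exists l'.+1 => [|x]; [rewrite ltn_neqAle ne_l'|rewrite /= IH].
by exists i => // x; rewrite Tij -eq_l' /= IH.
Qed.

(** At each step the difference of the two iterates is transformed by [T] and receives an error
    supported in the box of radius n. It is a sum of images of such errors under powers of [T]; each
    power equals one of exponent below [j], which spreads an error to radius at most jn. Hence a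
    bound uniform in [l]. *)
Lemma presented_nuca_near l x g : ~~ box (j * n) g -> iter l tau x g = iter l T x g.
Proof.
pose stays z := forall a g, ~~ box (j * n) g -> iter a T z g = 0.
suff h : stays (fun g => iter l tau x g - iter l T x g).
  by move=> gfar; have /eqP := h 0%N g gfar; rewrite subr_eq0 => /eqP.
have staysD y z : stays y -> stays z -> stays (fun g => y g + z g).
  by move=> ys zs a h hfar; rewrite iter_linear_caD ys ?zs ?addr0.
have staysT y : stays y -> stays (T y).
  by move=> ys a h hfar; rewrite -iterSr ys.
have stays_local y : (forall g, ~~ box n g -> y g = 0) -> stays y.
  move=> yn a h hfar; have [a' lt_a' ->] := iter_linear_ca_bounded a.
  apply: (iter_linear_ca_support yn); apply: contra hfar; apply: box_leq.
  by rewrite leq_mul2r lt_a' orbT.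
elim: l => [|l IH] a h hfar.
  by rewrite -[RHS](iter_linear_ca0 a h); congr (iter a T _ h);
     apply: functional_extensionality => h'; rewrite subrr.
pose err g := tau (iter l tau x) g - T (iter l tau x) g.
have err_box g' : ~~ box n g' -> err g' = 0.
  move=> g'far; rewrite /err presented_nuca_out ?subrr //.
  by apply: contra g'far; apply: exceptions_box.
have -> : (fun g => iter l.+1 tau x g - iter l.+1 T x g) =
    (fun g => err g + T (fun g => iter l tau x g - iter l T x g) g).
  apply: functional_extensionality => g' /=.
  by rewrite linear_caD linear_caN /err addrA subrK.
exact: (staysD _ _ (stays_local _ err_box) (staysT _ IH)).
Qed.

Lemma size_box_enum b : size (box_enum d b) = (b.*2.+1 ^ d)%N.
Proof. by rewrite size_image card_ffun !card_ord. Qed.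

Lemma box_enum_uniq b : uniq (box_enum d b).
Proof.
rewrite map_inj_uniq ?enum_uniq // => f g /rowP fg; apply/ffunP => a.
by apply: centered_inj; have := fg a; rewrite !mxE.
Qed.

(** The number of patterns on the box of radius [r], times a bound on the number of distinct powers
    of [T]. *)
Definition state_bound (v r : nat) : nat := (v ^ (r.*2.+1 ^ d) * v)%N.

(** An iterate is determined by its pattern in the box and by the exponent below [j] of the power of
    [T] that it follows outside. The number of these states does not depend on [x]. *)
Lemma presented_nuca_idempotent (r : nat) x : (j * n <= r)%N -> (j <= #|{: V}|)%N ->
  let B := (state_bound #|{: V}| r)`! in iter (B + B) tau x = iter B tau x.
Proof.
move=> le_r le_j.
have ph l : exists l' : 'I_j, forall x, iter l T x = iter l' T x.
  by have [l' lt_l' h] := iter_linear_ca_bounded l; exists (Ordinal lt_l').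
pose box_t := seq_sub (box_enum d r).
have box_r g : box r g -> exists b : box_t, val b = g.
  by rewrite -mem_box_enum => h; exists (SeqSub h).
have [phase phaseP] := functional_choice _ ph.
pose st l : {ffun box_t -> V} * 'I_j := ([ffun b : box_t => iter l tau x (val b)], phase l).
apply: (iter_fact_idempotent (st := st)) => [|a b [/ffunP stab ph_ab]].
  rewrite card_prod card_ffun card_ord; apply: leq_mul => //.
  rewrite leq_pexp2l //; first by apply: leq_trans le_j; apply: leq_ltn_trans lt_ij.
  by rewrite card_seq_sub ?box_enum_uniq // size_box_enum.
apply: functional_extensionality => g; have [gr|ngr] := boolP (box r g).
  by have [c <-] := box_r g gr; have := stab c; rewrite !ffunE.
have gfar : ~~ box (j * n) g by apply: contra ngr; apply: box_leq.
by rewrite !presented_nuca_near // phaseP ph_ab -phaseP.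
Qed.

End PeriodicLimit.

Theorem eventually_periodic_linear (v0 : V) : v0 != 0 ->
  eventually_periodic tau <->
  exists2 l, (1 <= l <= #|{: V}| ^ 2)%N & forall x, iter (l + l) T x = iter l T x.
Proof.
move=> v0_neq0; split=> [[m [q [m_gt0 q_gt0 tauE]]]|[l /andP[l_gt0 _] Tl]].
  have TE : forall x, iter (m + q) T x = iter m T x.
    by apply: iter_presented_linear => x; rewrite addnC.
  have [i [j [lt_ij le_j Tij]]] := linear_ca_repetition v0_neq0 q_gt0 TE.
  (* A multiple of the period j - i that is at least the preperiod i. *)
  exists ((j - i) * j)%N.
    rewrite muln_gt0 subn_gt0 lt_ij /= (leq_ltn_trans _ lt_ij) //=.
    by rewrite expnS expn1 leq_mul // (leq_trans _ le_j) // leq_subr.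
  move=> x; apply: (iter_idempotent lt_ij (Tij x)).
    by apply: leq_trans (ltnW lt_ij) _; rewrite leq_pmull // subn_gt0.
  exact: dvdn_mulr.
have [i [j [lt_ij le_j Tij]]] := linear_ca_repetition v0_neq0 l_gt0 Tl.
pose b := (state_bound #|{: V}| (j * n))`!; have b_gt0 : (0 < b)%N by apply: fact_gt0.
exists b, b; split=> // x.
exact: (presented_nuca_idempotent lt_ij Tij x (leqnn _) le_j).
Qed.

(** With |V| in place of [j] the exponent is computable from [n], for fixed d and |V|. *)
Definition idempotent_power : nat := (state_bound #|{: V}| (#|{: V}| * n))`!.

Lemma eventually_periodic_idempotent (v0 : V) : v0 != 0 -> eventually_periodic tau ->
  forall x, iter (idempotent_power + idempotent_power) tau x = iter idempotent_power tau x.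
Proof.
move=> v0_neq0 /(eventually_periodic_linear v0_neq0)[l /andP[l_gt0 _] Tl] x.
have [i [j [lt_ij le_j Tij]]] := linear_ca_repetition v0_neq0 l_gt0 Tl.
by apply: (presented_nuca_idempotent lt_ij Tij x _ le_j); rewrite leq_mul2r le_j orbT.
Qed.

Lemma iter_idempotent_mul (b q : nat) x :
  (forall x, iter (b + b) tau x = iter b tau x) -> (0 < q)%N ->
  iter (q * b) tau x = iter b tau x.
Proof.
move=> tb; case: q => // q _; elim: q => [|q IH]; first by rewrite mul1n.
by rewrite mulSn iterD IH -iterD tb.
Qed.

Theorem periodic_idempotent (v0 : V) : v0 != 0 ->
  periodic tau <-> eventually_periodic tau /\ forall x, iter idempotent_power tau x = x.
Proof.
move=> v0_neq0; split=> [[q [q_gt0 tq]]|[_ tb]]; last first.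
  by exists idempotent_power; split=> //; apply: fact_gt0.
have ep : eventually_periodic tau.
  by exists 1%N, q; split=> // x; rewrite addn1 iterSr tq.
split=> // x; have tb := eventually_periodic_idempotent v0_neq0 ep.
(* The idempotent power is unchanged when its exponent is multiplied by [q], and then it is an
   iterate of the identity. *)
rewrite -(iter_idempotent_mul x tb q_gt0) mulnC.
by elim: (idempotent_power) => // b IH; rewrite mulSn iterD IH tq.
Qed.

Theorem nilpotent_idempotent (v0 : V) : v0 != 0 ->
  nilpotent tau <-> eventually_periodic tau /\
    forall x, iter idempotent_power tau x = fun=> 0.
Proof.
move=> v0_neq0; split=> [[a [q [q_gt0 tq]]]|[_ tb]]; last first.
  by exists 0, idempotent_power; split=> //; apply: fact_gt0.
(* Far from the exceptional cells the null configuration stays null, which determines the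
   constant. *)
have a0 : a = 0.
  have [u far] := far_translate (q * n) 0.
  have := congr1 (fun f => f (0 + u)) (tq (fun=> 0)).
  by rewrite iter_presented_far // iter_linear_ca0.
have ep : eventually_periodic tau.
  by exists q, q; split=> // x; rewrite iterD !tq.
split=> // x; have tb := eventually_periodic_idempotent v0_neq0 ep.
rewrite -(iter_idempotent_mul x tb q_gt0) mulnC.
have : (0 < idempotent_power)%N by apply: fact_gt0.
case: (idempotent_power) => // b _; rewrite mulSn iterD tq a0 //.
Qed.

End Presented.

(** * Injectivity *)

Section Injectivity.

Variables (d : nat) (k : fieldType) (V : finLmodType k).
Notation G := 'rV[int]_d.
Notation box := (@box d d).
Variables (D : presentation d V) (n : nat).
Hypothesis memory_box : forall g, g \in memory D -> box n g.
Hypothesis exceptions_box : forall g, g \in exceptions D -> box n g.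
Notation tau := (presented_nuca D).
Notation T := (linear_ca (limit_rule D)).
Implicit Types (x y z : G -> V) (g u : G).

(** 2n + 1 covers the cells that the exceptional rules read and one more layer; |V| bounds the
    number of scalar unknowns, the dimension of [V]. *)
Definition core_radius : nat := (n.*2.+1 + #|{: V}|)%N.
Definition window_radius : nat := (solution_bound d d core_radius + n)%N.

Lemma box_sub_add r r' g h : box r g -> box r' (h - g) -> box (r + r') h.
Proof. by move=> gr hr; rewrite -(subrK g h) addrC; apply: boxD. Qed.

Lemma tau_eq_core x y g : g \in exceptions D ->
  (forall h, box n.*2 h -> x h = y h) -> tau x g = tau y g.
Proof.
move=> gE xy; apply: (presented_nuca_local memory_box) => h hg; apply: xy.
by rewrite -addnn; apply: box_sub_add (exceptions_box gE) hg.
Qed.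

(** The difference [z] solves the linear equations off the exceptional cells in the window, so it
    extends to a global [z'] with the same pattern near the origin. Then [y + z'] has the image of
    [y]: elsewhere by linearity, at the exceptional cells because it looks like [x] there.
    Injectivity gives [z' = 0]. *)
Lemma injective_window x y : injective tau ->
  (forall g, box window_radius g -> tau x g = tau y g) ->
  forall g, box n.*2.+1 g -> x g = y g.
Proof.
move=> inj txy g gr.
have [N [e [co [leN coE eK]]]] := finite_basis V.
have [K [iota [chi chiP]]] := independent_character_exists k d.
pose z h := x h - y h.
have TD x' y' h : T (fun h => x' h - y' h) h = T x' h - T y' h.
  by rewrite (linear_caD D x' (fun h => - y' h)) linear_caN.
have memory_core (m : memory D) : box core_radius (val m).
  by apply: box_leq (memory_val_box memory_box m); rewrite /core_radius; lia.
have exceptions_core h : h \in exceptions D -> box core_radius h.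
  by move=> /exceptions_box; apply: box_leq; rewrite /core_radius; lia.
have [|h hB hE|z' [z'E z'z]] := configuration_extension chiP coE eK
    (c := limit_rule D) (r := core_radius) (E := fun g => g \in exceptions D)
    _ memory_core exceptions_core (z := z).
- by rewrite /core_radius; lia.
- rewrite TD -!presented_nuca_out // txy ?subrr //.
  by apply: box_leq hB; apply: leq_addr.
have txy' : tau (fun h => y h + z' h) = tau y.
  apply: functional_extensionality => h; have [hE|hE] := boolP (h \in exceptions D).
    rewrite -txy; last first.
      by apply: box_leq (exceptions_box hE); apply: leq_addl.
    apply: tau_eq_core => // h' h'r; rewrite z'z /z; last first.
      by apply: box_leq h'r; rewrite /core_radius; lia.
    by rewrite addrC subrK.
  by rewrite !presented_nuca_out // linear_caD z'E // addr0.
have /(congr1 (fun f => f g)) /= := inj _ _ txy'.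
rewrite z'z; last by apply: box_leq gr; rewrite /core_radius; lia.
by rewrite /z addrC subrK.
Qed.

Lemma clamp_box r l g : box (r + l) g -> exists2 u, box l u & box r (g - u).
Proof.
move=> /boxP[_ gr]; pose clamp (a : int) : int :=
  if a <= - l%:Z then - l%:Z else if l%:Z <= a then l%:Z else a.
have clampP a : (absz a <= r + l)%N -> (absz (a - clamp a)%R <= r)%N.
  by rewrite /clamp; case: ifP; [|case: ifP]; lia.
exists (\row_i clamp (g 0 i)); apply/boxP; split; try exact: coord_space_full.
  by move=> i; rewrite mxE /clamp; case: ifP; [|case: ifP]; lia.
by move=> i; have /clampP := gr i; rewrite !mxE.
Qed.

(* Once a kernel element vanishing on a box vanishes on the next larger box, its
   translates propagate this to the whole group. *)
Lemma window_injective :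
  (forall x y, (forall g, box window_radius g -> tau x g = tau y g) ->
     forall g, box n.*2.+1 g -> x g = y g) ->
  injective tau.
Proof.
move=> win x y txy; apply: functional_extensionality => g; apply/eqP.
rewrite -subr_eq0; apply/eqP; pose z h := x h - y h; rewrite -/(z g).
have TD h : T z h = T x h - T y h.
  by rewrite (linear_caD D x (fun h => - y h)) linear_caN.
have z_core h : box n.*2.+1 h -> z h = 0.
  by move=> hr; rewrite /z (win x y) ?subrr // => h' _; rewrite txy.
(* At an exceptional cell the equality of images says nothing on [T]; there [T] only reads cells
   where [z] vanishes. *)
have Tz h : T z h = 0.
  have [hE|hE] := boolP (h \in exceptions D); last first.
    by rewrite TD -!presented_nuca_out // txy subrr.
  rewrite -[RHS](linear_ca0 D h); apply: (linear_ca_local memory_box) => h' hh'.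
  by apply: z_core; apply: box_leq (box_sub_add (exceptions_box hE) hh'); lia.
(* Such a [z'] has the image of the null configuration: an exceptional rule sees the null pattern in
   both. *)
have grow z' : (forall h, T z' h = 0) -> (forall h, box n.*2 h -> z' h = 0) ->
    forall h, box n.*2.+1 h -> z' h = 0.
  move=> Tz' z'0; apply: (win z' (fun=> 0)) => h _.
  have [hE|hE] := boolP (h \in exceptions D); first exact: tau_eq_core.
  by rewrite !presented_nuca_out // Tz' linear_ca0.
have zero l : forall h, box (n.*2 + l)%N h -> z h = 0.
  elim: l => [|l IH] h; first by rewrite addn0 => hr; apply/z_core/(box_leq (leqnSn _)).
  rewrite addnS -addSn => /clamp_box[u ul hu].
  rewrite -(subrK u h); apply: (grow (fun h' => z (h' + u)) _ _ _ hu) => h'.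
    by rewrite linear_ca_translate Tz.
  by move=> h'r; apply: IH; apply: boxD.
apply: (zero (\max_i absz (g 0%R i))%N); apply/boxP; split; first exact: coord_space_full.
by move=> i; apply: leq_trans (leq_addl _ _); apply: (leq_bigmax i).
Qed.

End Injectivity.

(** * Codes of presentations *)

Local Open Scope nat_scope.

Definition digit (B c q : nat) : nat := (c %/ B ^ q) %% B.

Lemma sum_digits_lt B l (a : nat -> nat) : (forall i, a i < B) ->
  \sum_(i < l) a i * B ^ i < B ^ l.
Proof.
move=> aB; elim: l => [|l IH]; first by rewrite big_ord0.
have := leq_mul (aB l) (leqnn (B ^ l)); rewrite big_ord_recr expnS /= mulSn.
by move=> /(leq_trans _); apply; rewrite ltn_add2r.
Qed.

Lemma digit_sum B l (a : nat -> nat) q : (forall i, a i < B) -> q < l ->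
  digit B (\sum_(i < l) a i * B ^ i) q = a q.
Proof.
move=> aB; elim: l a q aB => // l IH a q aB lt_q.
have B_gt0 : 0 < B by apply: leq_ltn_trans (aB 0).
rewrite big_ord_recl muln1 /=; under eq_bigr do rewrite /bump add1n expnS mulnCA.
rewrite -big_distrr /=; set s := \sum_(i < l) _.
case: q lt_q => [|q] lt_q; first by rewrite /digit expn0 divn1 addnC mulnC modnMDl modn_small.
rewrite /digit expnS divnMA [B * s]mulnC addnC divnMDl // (divn_small (aB 0)) addn0.
by rewrite -[LHS]/(digit B s q) /s (IH (fun i => a i.+1)).
Qed.

Lemma sum_digits B l c : c < B ^ l -> \sum_(i < l) digit B c i * B ^ i = c.
Proof.
elim: l c => [|l IH] c lt_c; first by rewrite big_ord0; move: lt_c; case: c.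
have B_gt0 : 0 < B by move: lt_c; rewrite expnS; case: (posnP B) => [->|//]; rewrite mul0n.
rewrite big_ord_recl muln1 /=.
under eq_bigr => i _.
  have -> : digit B c (bump 0 i) * B ^ bump 0 i = B * (digit B (c %/ B) i * B ^ i).
    by rewrite /bump add1n /digit expnS divnMA mulnCA.
  over.
rewrite -big_distrr /= IH; last by rewrite ltn_divLR // mulnC -expnS.
by rewrite /digit expn0 divn1 addnC mulnC -divn_eq.
Qed.

Lemma ltn_digit B c q : 0 < B -> digit B c q < B.
Proof. exact: ltn_pmod. Qed.

(** * Numbering of the cells of a box *)

Section Positions.

Variables (d : nat).
Notation G := 'rV[int]_d.
Notation box := (@box d d).
Implicit Types (g h : G).

Definition width (b : nat) : nat := b.*2.+1.

Definition position (b : nat) (g : G) : nat :=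
  \sum_(i < d) absz (g 0%R i + b%:Z)%R * width b ^ i.

Lemma box_coord b g i : box b g -> absz (g 0%R i + b%:Z)%R < width b.
Proof. by move=> /boxP[_ /(_ i)]; rewrite /width; lia. Qed.

Let coord_nat b g (i : nat) : nat :=
  if insub i is Some i' then absz (g 0%R i' + b%:Z)%R else 0.

Let coord_natE b g (i : 'I_d) : coord_nat b g i = absz (g 0%R i + b%:Z)%R.
Proof. by rewrite /coord_nat valK. Qed.

Let positionE b g : position b g = \sum_(i < d) coord_nat b g i * width b ^ i.
Proof. by apply: eq_bigr => i _; rewrite coord_natE. Qed.

Let coord_nat_lt b g i : box b g -> coord_nat b g i < width b.
Proof. by move=> gb; rewrite /coord_nat; case: insub => // i'; apply: box_coord. Qed.

Lemma position_lt b g : box b g -> position b g < width b ^ d.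
Proof.
by move=> gb; rewrite positionE; apply: sum_digits_lt => i; apply: coord_nat_lt.
Qed.

Lemma digit_position b g (i : 'I_d) : box b g ->
  digit (width b) (position b g) i = absz (g 0%R i + b%:Z)%R.
Proof.
move=> gb; rewrite positionE digit_sum ?coord_natE // => i'; exact: coord_nat_lt.
Qed.

Lemma position_inj b g h : box b g -> box b h -> position b g = position b h -> g = h.
Proof.
move=> gb hb gh; apply/rowP => i.
have := digit_position i gb; rewrite gh digit_position //.
move: gb hb => /boxP[_ /(_ i) +] /boxP[_ /(_ i)]; lia.
Qed.

Lemma position_surj b p : p < width b ^ d -> exists2 g, box b g & position b g = p.
Proof.
move=> lt_p; pose g : G := (\row_i ((digit (width b) p i)%:Z - b%:Z))%R.
have gE i : absz (g 0%R i + b%:Z)%R = digit (width b) p i.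
  by rewrite mxE subrK.
exists g; last by rewrite /position; under eq_bigr do rewrite gE; apply: sum_digits.
apply/boxP; split; first exact: coord_space_full.
move=> i; have := ltn_digit p i (ltn0Sn b.*2 : 0 < width b).
rewrite /g mxE /width; lia.
Qed.

(** Positive and negative parts of the integer coded by [c], so that displacements are computed
    within the naturals. *)
Definition code_plus (c : nat) : nat := if odd c then 0 else c./2.
Definition code_minus (c : nat) : nat := if odd c then c./2.+1 else 0.

Lemma int_codeE (z : int) :
  z = ((code_plus (int_code z))%:Z - (code_minus (int_code z))%:Z)%R.
Proof.
case: z => m; rewrite /code_plus /code_minus /= odd_double /=.
  by rewrite doubleK subr0.
by rewrite uphalf_double NegzE sub0r.
Qed.

Lemma absz_int_code z : absz z <= int_code z.
Proof. by case: z => m /=; rewrite -addnn; lia. Qed.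

Definition nth_code (n i : nat) : nat := car (iter i cdr n).

(** Inside the box, a displacement changes the position by a constant, the difference of
    [offset_plus] and [offset_minus]. *)
Definition offset_plus (b pc : nat) : nat :=
  \sum_(i < d) code_plus (nth_code pc i) * width b ^ i.
Definition offset_minus (b pc : nat) : nat :=
  \sum_(i < d) code_minus (nth_code pc i) * width b ^ i.
Definition origin (b : nat) : nat := \sum_(i < d) b * width b ^ i.

Lemma iter_cdr_code i s : iter i cdr (CodeSeq.code s) = CodeSeq.code (drop i s).
Proof.
elim: i s => [|i IH] s; first by rewrite drop0.
rewrite iterSr; case: s => [|a s]; last by rewrite code_cons cdr_pair IH.
by rewrite -[cdr _]/(CodeSeq.code [::]) IH.
Qed.

Lemma nth_code_code s i : nth_code (CodeSeq.code s) i = nth 0 s i.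
Proof.
rewrite /nth_code iter_cdr_code -[i in RHS]addn0 -nth_drop.
by case: (drop i s) => [|a t] //; rewrite code_cons car_pair.
Qed.

Lemma iter_cdr_code_neq0 s i : (iter i cdr (CodeSeq.code s) != 0) = (i < size s).
Proof.
rewrite iter_cdr_code -subn_gt0 -size_drop.
by case: (drop i s) => [|a t] //; rewrite code_cons -lt0n pair_code_gt0.
Qed.

Lemma nth_point_code g (i : 'I_d) : nth_code (point_code g) i = int_code (g 0%R i).
Proof.
rewrite nth_code_code (nth_map i) ?size_enum_ord // nth_ord_enum.
by congr (int_code (g _ _)); apply: val_inj.
Qed.

Lemma offset_position b g h : box b g -> box b (g + h)%R ->
  position b (g + h)%R + offset_minus b (point_code h) =
  position b g + offset_plus b (point_code h).
Proof.
move=> gb ghb; rewrite -!big_split; apply: eq_bigr => i _ /=.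
rewrite -!mulnDl nth_point_code; congr (_ * _).
move: gb ghb => /boxP[_ /(_ i) gi] /boxP[_ /(_ i)]; rewrite mxE.
have := int_codeE (h 0%R i); move: (g 0%R i) (h 0%R i) gi => x y.
by rewrite -[(x + y)%R]/(x + y)%R; lia.
Qed.

Lemma origin_position b h : box b h ->
  position b h + offset_minus b (point_code h) = origin b + offset_plus b (point_code h).
Proof.
move=> hb; have := offset_position (box0 d d b) (h := h); rewrite add0r => /(_ hb) ->.
by congr (_ + _); apply: eq_bigr => i _; rewrite mxE add0r.
Qed.

End Positions.

Definition bounded_ex (N : nat) (P : nat -> bool) : bool := [exists i : 'I_N, P i].
Definition bounded_all (N : nat) (P : nat -> bool) : bool := [forall i : 'I_N, P i].

Lemma bounded_exP N (P : nat -> bool) : reflect (exists2 i, i < N & P i) (bounded_ex N P).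
Proof.
apply: (iffP existsP) => [[i Pi]|[i lt_i Pi]]; first by exists i.
by exists (Ordinal lt_i).
Qed.

Lemma bounded_allP N (P : nat -> bool) : reflect (forall i, i < N -> P i) (bounded_all N P).
Proof.
apply: (iffP forallP) => [h i lt_i|h i]; first exact: (h (Ordinal lt_i)).
exact: h.
Qed.

Lemma cdr_leq_pred n : cdr n <= n.-1.
Proof.
case: (posnP n) => [->//|n_gt0]; rewrite -{2}(pair_codeK n_gt0) /pair_code.
by have := expn_gt0 2 (car n); nia.
Qed.

Lemma car_leq n : car n <= n.
Proof.
case: (posnP n) => [->//|n_gt0]; rewrite -{2}(pair_codeK n_gt0) /pair_code.
apply: leq_trans (ltnW (ltn_expl _ (isT : 1 < 2))) _; exact: leq_pmulr.
Qed.

Lemma iter_cdr_leq n i : iter i cdr n <= n - i.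
Proof.
elim: i => [|i IH]; first by rewrite subn0.
by rewrite /= (leq_trans (cdr_leq_pred _)) //; lia.
Qed.

(** An index into a coded list is smaller than the code, which bounds the search over list entries
    by the input. *)
Lemma iter_cdr_neq0 n i : iter i cdr n != 0 -> i < n.
Proof. by have := iter_cdr_leq n i; lia. Qed.

Lemma nth_code_leq n i : nth_code n i <= n.
Proof. by apply: leq_trans (car_leq _) _; have := iter_cdr_leq n i; lia. Qed.

(** * Evaluation of a coded local rule *)

Section Rows.

Variables (d v : nat).

(* [t] is a table of values of a local map with memory coded in [n]; [p] is the
   position of a cell in the box of radius [b], whose pattern is coded by the
   digits of [c] from position [o] on. *)
Definition has_row (n b c o p w t : nat) : bool :=
  bounded_ex n (fun r =>
    [&& iter r cdr t != 0, nth_code (nth_code t r) 0 == w &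
        bounded_all n (fun l => (iter l cdr (nth_code n 0) != 0) ==>
          (nth_code (nth_code t r) l.+1 ==
           digit v c (o + (p + offset_plus d b (nth_code (nth_code n 0) l)
                             - offset_minus d b (nth_code (nth_code n 0) l)))))]).

Definition is_exception (n b p i : nat) : bool :=
  (iter i cdr (nth_code n 1) != 0) &&
  (p + offset_minus d b (nth_code (nth_code (nth_code n 1) i) 0) ==
   origin d b + offset_plus d b (nth_code (nth_code (nth_code n 1) i) 0)).

(** A relation rather than a function: [w] is checked by a search for a row of the table that has
    the observed pattern. *)
Definition rule_relation (n b c o p w : nat) : bool :=
  if bounded_ex n (is_exception n b p) then
    bounded_ex n (fun i => is_exception n b p i &&
      has_row n b c o p w (nth_code (nth_code (nth_code n 1) i) 1))
  else has_row n b c o p w (nth_code n 2).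

End Rows.

Section Correctness.

Variables (d : nat) (k : fieldType) (V : finLmodType k).
Notation G := 'rV[int]_d.
Notation box := (@box d d).
Notation v := #|{: V}|.
Variable D : presentation d V.
Notation n := (presentation_code D).
Notation tau := (presented_nuca D).

Lemma nth_memory_code i : nth_code (nth_code n 0) i =
  nth 0 [seq point_code (val m) | m <- enum {: memory D}] i.
Proof. by rewrite !nth_code_code. Qed.

Lemma int_code_point_code (g : G) i : int_code (g 0%R i) <= point_code g.
Proof. by rewrite -nth_point_code nth_code_leq. Qed.

Lemma point_code_box (g : G) m : point_code g <= m -> box m g.
Proof.
move=> le_m; apply/boxP; split; first exact: coord_space_full.
move=> i; apply: leq_trans (absz_int_code _) _.
exact: leq_trans (int_code_point_code g i) le_m.
Qed.

(** A code is at least as large as the numbers in it, so the code of [D] itself serves as a radius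
    for the memory, and likewise for the exceptional cells. *)
Lemma memory_code_box g : g \in memory D -> box n g.
Proof.
move=> gM; apply: point_code_box; pose m : memory D := FSetSub gM.
have -> : point_code g = nth_code (nth_code n 0) (index m (enum {: memory D})).
  rewrite nth_memory_code (nth_map m) ?index_mem ?mem_enum //.
  by rewrite nth_index ?mem_enum.
exact: leq_trans (nth_code_leq _ _) (nth_code_leq _ _).
Qed.

Lemma nth_exception_code i (g0 : exceptions D) : i < size (enum {: exceptions D}) ->
  nth_code (nth_code n 1) i =
  CodeSeq.code [:: point_code (val (nth g0 (enum {: exceptions D}) i));
     local_map_code (@rule _ _ _ D (val (nth g0 (enum {: exceptions D}) i)))].
Proof. by move=> lt_i; rewrite !nth_code_code /= (nth_map g0). Qed.

Lemma exceptions_code_box g : g \in exceptions D -> box n g.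
Proof.
move=> gE; apply: point_code_box; pose e : exceptions D := FSetSub gE.
have -> : point_code g =
    nth_code (nth_code (nth_code n 1) (index e (enum {: exceptions D}))) 0.
  rewrite (nth_exception_code e) ?index_mem ?mem_enum // nth_code_code /=.
  by rewrite nth_index ?mem_enum.
apply: leq_trans (nth_code_leq _ _) _.
exact: leq_trans (nth_code_leq _ _) (nth_code_leq _ _).
Qed.

Variables (b c o : nat) (g : G) (x : G -> V).
Hypothesis n_le_b : n <= b.
Hypothesis gb : box (b - n) g.
Hypothesis xc : forall h, box n (h - g)%R ->
  digit v c (o + position b h) = vector_code (x h).

Lemma box_window h : box n h -> box b (g + h)%R.
Proof. by move=> hn; rewrite -(subnK n_le_b); apply: boxD. Qed.

Lemma has_rowP (f : {ffun memory D -> V} -> V) w : local_map_code f <= n ->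
  has_row d v n b c o (position b g) w (local_map_code f) <->
  w = vector_code (f [ffun m : memory D => x (g + val m)%R]).
Proof.
move=> le_f; set q : {ffun memory D -> V} := [ffun m => _].
have cell l (m : memory D) : l < size (enum {: memory D}) ->
    digit v c (o + (position b g + offset_plus d b (nth_code (nth_code n 0) l)
       - offset_minus d b (nth_code (nth_code n 0) l)))
    = vector_code (q (nth m (enum {: memory D}) l)).
  move=> lt_l; rewrite nth_memory_code (nth_map m) //; set m' := nth _ _ l.
  have mn : box n (val m') by apply/memory_code_box/valP.
  have g0b : box b g by apply: box_leq gb; apply: leq_subr.
  rewrite -(offset_position g0b (box_window mn)) addnK xc ?ffunE //.
  by rewrite addrC addKr.
have sizeM l : (iter l cdr (nth_code n 0) != 0) = (l < size (enum {: memory D})).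
  by rewrite nth_code_code iter_cdr_code_neq0 size_map.
have row r (p0 : {ffun memory D -> V}) : r < size (enum {: {ffun memory D -> V}}) ->
    nth_code (local_map_code f) r =
    CodeSeq.code (vector_code (f (nth p0 (enum {: {ffun memory D -> V}}) r)) ::
      [seq vector_code ((nth p0 (enum {: {ffun memory D -> V}}) r) m)
         | m <- enum {: memory D}]).
  by move=> lt_r; rewrite nth_code_code (nth_map p0).
have sizeF r : (iter r cdr (local_map_code f) != 0)
     = (r < size (enum {: {ffun memory D -> V}})).
  by rewrite iter_cdr_code_neq0 size_map.
split=> [/bounded_exP[r lt_r /and3P[]]|->].
  rewrite sizeF => lt_r'; rewrite (row r q lt_r') nth_code_code /= => /eqP <-.
  move=> /bounded_allP h; congr (vector_code (f _)); apply/ffunP => m.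
  have lt_m : index m (enum {: memory D}) < size (enum {: memory D}).
    by rewrite index_mem mem_enum.
  have := h (index m (enum {: memory D})); rewrite sizeM lt_m [nth_code (CodeSeq.code (_ :: _)) _]nth_code_code /=.
  rewrite (nth_map m) // nth_index ?mem_enum // (cell _ m lt_m) nth_index ?mem_enum //.
  have lt_n : index m (enum {: memory D}) < n.
    by apply: leq_trans (iter_cdr_neq0 _) (nth_code_leq n 0); rewrite sizeM.
  by move=> /(_ lt_n)/eqP hm; apply: enum_rank_inj; apply: val_inj.
pose r := index q (enum {: {ffun memory D -> V}}).
have lt_r : r < size (enum {: {ffun memory D -> V}}) by rewrite index_mem mem_enum.
apply/bounded_exP; exists r.
  by apply: leq_trans (iter_cdr_neq0 _) le_f; rewrite sizeF.
rewrite sizeF lt_r (row r q lt_r) nth_code_code /= nth_index ?mem_enum // eqxx /=.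
apply/bounded_allP => l _; apply/implyP; rewrite sizeM => lt_l.
have [m0 _] : exists m : memory D, true.
  by move: lt_l; case: (enum _) => [|m0 s] // _; exists m0.
by rewrite [nth_code (CodeSeq.code (_ :: _)) _]nth_code_code /= (nth_map m0) // (cell _ m0 lt_l).
Qed.

Lemma is_exceptionP i (g0 : exceptions D) : i < size (enum {: exceptions D}) ->
  is_exception d n b (position b g) i = (g == val (nth g0 (enum {: exceptions D}) i)).
Proof.
move=> lt_i; set e := nth _ _ i.
have eb : box b (val e).
  by apply: (box_leq n_le_b); apply: exceptions_code_box (valP e).
have g0b : box b g by apply: box_leq gb; apply: leq_subr.
rewrite /is_exception (nth_exception_code g0 lt_i) nth_code_code /= -/e.
rewrite -(origin_position eb) eqn_add2r nth_code_code iter_cdr_code_neq0 size_map lt_i.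
by apply/eqP/eqP => [/(position_inj g0b eb)|->].
Qed.

Theorem rule_relationP w :
  rule_relation d v n b c o (position b g) w <-> w = vector_code (tau x g).
Proof.
have sizeE i : (iter i cdr (nth_code n 1) != 0) = (i < size (enum {: exceptions D})).
  by rewrite nth_code_code iter_cdr_code_neq0 size_map.
have lt_n i : i < size (enum {: exceptions D}) -> i < n.
  by rewrite -sizeE => /iter_cdr_neq0 lt_i; apply: leq_trans lt_i (nth_code_leq _ _).
rewrite /rule_relation; have [gE|gE] := boolP (g \in exceptions D).
  pose e : exceptions D := FSetSub gE; pose i := index e (enum {: exceptions D}).
  have lt_i : i < size (enum {: exceptions D}) by rewrite index_mem mem_enum.
  have exi : is_exception d n b (position b g) i.
    by rewrite (is_exceptionP e lt_i) nth_index ?mem_enum.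
  have -> : bounded_ex n (is_exception d n b (position b g)).
    by apply/bounded_exP; exists i; rewrite ?lt_n.
  have tableE i' : is_exception d n b (position b g) i' ->
      nth_code (nth_code (nth_code n 1) i') 1 = local_map_code (rule (p := D) g).
    move=> exi'; have lt_i' : i' < size (enum {: exceptions D}).
      by case/andP: exi'; rewrite sizeE.
    move: exi'; rewrite (is_exceptionP e lt_i') (nth_exception_code e lt_i').
    by rewrite nth_code_code /= => /eqP <-.
  have le_n : local_map_code (rule (p := D) g) <= n.
    rewrite -(tableE i exi); apply: leq_trans (nth_code_leq _ _) _.
    exact: leq_trans (nth_code_leq _ _) (nth_code_leq _ _).
  rewrite presented_nucaE -(has_rowP w le_n) /=; split.
    by move=> /bounded_exP[i' _ /andP[exi']]; rewrite (tableE i' exi').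
  by move=> h; apply/bounded_exP; exists i; rewrite ?lt_n // exi (tableE i exi).
have -> : bounded_ex n (is_exception d n b (position b g)) = false.
  apply/negbTE/negP => /bounded_exP[i _ exi]; have lt_i : i < size (enum {: exceptions D}).
    by case/andP: exi; rewrite sizeE.
  have [e _] : exists e : exceptions D, true.
    by move: lt_i; case: (enum _) => [|e s] // _; exists e.
  move: exi; rewrite (is_exceptionP e lt_i) => /eqP gE'.
  by move: gE; rewrite gE' (valP (nth e _ _)).
have lim : nth_code n 2 = local_map_code (limit_rule D) by rewrite nth_code_code.
have le_n : local_map_code (limit_rule D) <= n by rewrite -lim nth_code_leq.
by rewrite lim presented_nuca_out // /linear_ca -(has_rowP w le_n).
Qed.

End Correctness.

(** * Decision procedures *)

Section Tests.

Variables (d v : nat).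

Definition cells (b : nat) : nat := width b ^ d.

Definition in_box (b r p : nat) : bool :=
  bounded_all d (fun i => (b <= digit (width b) p i + r) &&
                          (digit (width b) p i <= b + r)).

(* The digits of [c] form a space-time diagram of height [L]. *)
Definition diagram (n b L c : nat) : bool :=
  bounded_all L (fun t => bounded_all (cells b) (fun p =>
    in_box b (b - n) p ==>
    rule_relation d v n b c (t * cells b) p (digit v c (t.+1 * cells b + p)))).

(** One more than the reach of the exceptional cells in [L] steps, so that the box contains a cell
    where the iterates are those of the limit. *)
Definition final_radius (n L : nat) : nat := (L * n).+1.
(** Room for the cone of dependence: after [L] steps the diagram is still determined on the final
    box. *)
Definition initial_radius (n L : nat) : nat := final_radius n L + L * n.

(* Compares the iterates of order [i] and [j'] if [j = j'.+1], and tests that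
   the iterate of order [i] vanishes if [j = 0]. *)
Definition iterate_test (z0 n L i j : nat) : bool :=
  bounded_all (v ^ (L.+1 * cells (initial_radius n L))) (fun c =>
    diagram n (initial_radius n L) L c ==>
    bounded_all (cells (initial_radius n L)) (fun p =>
      in_box (initial_radius n L) (final_radius n L) p ==>
      (digit v c (i * cells (initial_radius n L) + p) ==
       if j == 0 then z0 else digit v c (j.-1 * cells (initial_radius n L) + p)))).

(* [w1] is the radius where images are compared and [w2] where patterns are. *)
Definition injectivity_test (n w1 w2 : nat) : bool :=
  bounded_all (v ^ cells (w1 + n + w2)) (fun c1 => bounded_all (v ^ cells (w1 + n + w2)) (fun c2 =>
    bounded_all (cells (w1 + n + w2)) (fun p => in_box (w1 + n + w2) w1 p ==>
      bounded_ex v (fun w => rule_relation d v n (w1 + n + w2) c1 0 p w &&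
                             rule_relation d v n (w1 + n + w2) c2 0 p w)) ==>
    bounded_all (cells (w1 + n + w2)) (fun p => in_box (w1 + n + w2) w2 p ==>
      (digit v c1 p == digit v c2 p)))).

End Tests.

Section TestCorrectness.

Variables (d : nat) (k : fieldType) (V : finLmodType k).
Hypothesis d_ge1 : 1 <= d.
Notation G := 'rV[int]_d.
Notation box := (@box d d).
Notation v := #|{: V}|.
Variable D : presentation d V.
Notation n := (presentation_code D).
Notation tau := (presented_nuca D).
Notation T := (linear_ca (limit_rule D)).

Lemma in_boxP b r g : box b g -> in_box d b r (position b g) = box r g.
Proof.
move=> gb; apply/bounded_allP/boxP => [h|[_ gr] i lt_i].
  split; first exact: coord_space_full.
  move=> i; have := h i (ltn_ord i); rewrite digit_position //.
  by move: gb => /boxP[_ /(_ i)]; lia.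
rewrite (digit_position (Ordinal lt_i)) //.
by move: gb (gr (Ordinal lt_i)) => /boxP[_ /(_ (Ordinal lt_i))]; lia.
Qed.

Lemma vector_code_lt (u : V) : vector_code u < v.
Proof. exact: ltn_ord. Qed.

Lemma vector_code_inj : injective (@vector_code k V).
Proof. by move=> u w /val_inj/enum_rank_inj. Qed.

Lemma vector_code_surj w : w < v -> exists u : V, vector_code u = w.
Proof. by move=> lt_w; exists (enum_val (Ordinal lt_w)); rewrite /vector_code enum_valK. Qed.

Lemma v_gt0 : 0 < v.
Proof. exact: leq_ltn_trans (vector_code_lt 0%R). Qed.

Lemma diagram_code b m (X : nat -> G -> V) : exists2 c, c < v ^ (m * cells d b) &
  forall t g, t < m -> box b g ->
    digit v c (t * cells d b + position b g) = vector_code (X t g).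
Proof.
have S_gt0 : 0 < cells d b by rewrite expn_gt0.
have [inv invP] : exists inv : nat -> G, forall g, box b g -> inv (position b g) = g.
  have /functional_choice[inv invP] : forall p, exists g, p < cells d b ->
      box b g /\ position b g = p.
    move=> p; have [/position_surj[g gb gp]|_] := boolP (p < cells d b); first by exists g.
    by exists 0%R.
  exists inv => g gb; have [gb' /position_inj] := invP _ (position_lt gb).
  by apply.
pose a q := vector_code (X (q %/ cells d b) (inv (q %% cells d b))).
have a_lt q : a q < v by apply: vector_code_lt.
exists (\sum_(q < m * cells d b) a q * v ^ q); first exact: sum_digits_lt.
move=> t g lt_t gb; have lt_p := position_lt gb; rewrite digit_sum //.
  by rewrite /a divnMDl // divn_small // addn0 modnMDl modn_small // invP.
by apply: leq_trans (_ : t.+1 * cells d b <= _); rewrite ?leq_mul2r ?lt_t ?orbT // mulSn addnC ltn_add2r.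
Qed.

Lemma decode_configuration b o c : exists x : G -> V,
  forall g, box b g -> digit v c (o + position b g) = vector_code (x g).
Proof.
have /fin_all_exists[f fP] : forall g : seq_sub (box_enum d b), exists u : V,
    vector_code u = digit v c (o + position b (val g)).
  by move=> g; apply/vector_code_surj/ltn_digit/v_gt0.
exists (fun g => if insub g is Some u then f u else 0%R) => g.
by rewrite -mem_box_enum => gb; rewrite insubT fP.
Qed.

(** The border of each row is unconstrained, so a diagram follows [tau] on a box that shrinks by n
    at each step. *)
Lemma diagram_iter b L c x : L * n <= b ->
  diagram d v n b L c ->
  (forall g, box b g -> digit v c (position b g) = vector_code (x g)) ->
  forall t g, t <= L -> box (b - t * n) g ->
    digit v c (t * cells d b + position b g) = vector_code (iter t tau x g).
Proof.
move=> le_b /bounded_allP dia xc; elim=> [|t IH] g.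
  by rewrite mul0n subn0 => _; apply: xc.
move=> lt_t gb.
have le_t : t.+1 * n <= b by apply: leq_trans le_b; rewrite leq_mul2r lt_t orbT.
have gb1 : box (b - n) g by apply: box_leq gb; rewrite mulSn; lia.
have gb0 : box b g by apply: box_leq gb; apply: leq_subr.
apply/(@rule_relationP d k V D b c (t * cells d b) g (iter t tau x)) => //.
- by apply: leq_trans le_t; apply: leq_addr.
- move=> h hg; apply: IH; first exact: ltnW.
  by apply: box_leq (box_sub_add gb hg); rewrite mulSn in le_t *; lia.
have /bounded_allP/(_ _ (position_lt gb0)) := dia t lt_t.
by rewrite in_boxP // gb1.
Qed.

Lemma diagram_iterates b L x : L * n <= b ->
  exists2 c, c < v ^ (L.+1 * cells d b) & diagram d v n b L c /\
    forall t g, t <= L -> box b g ->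
      digit v c (t * cells d b + position b g) = vector_code (iter t tau x g).
Proof.
move=> le_b; have [c lt_c cP] := diagram_code b L.+1 (fun t => iter t tau x).
exists c => //; split; last by move=> t g le_t; apply: cP.
apply/bounded_allP => t lt_t; have le_n : n <= b.
  by apply: leq_trans le_b; apply: leq_pmull; apply: leq_ltn_trans lt_t.
 apply/bounded_allP => p /position_surj[g gb <-].
rewrite in_boxP //; apply/implyP => gb1.
apply/(@rule_relationP d k V D b c (t * cells d b) g (iter t tau x)) => //.
  move=> h hg; apply: cP; first exact: leqW.
  by apply: box_leq (box_sub_add gb1 hg); rewrite subnK.
by rewrite cP.
Qed.

Definition other_iterate (j : nat) (x : G -> V) : G -> V :=
  if j is j'.+1 then iter j' tau x else fun=> 0%R.

(** Beyond the reach of the exceptional cells the iterates are those of [T], which commute with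
    translations; the one cell [g0] of the final box stands for all cells outside it. *)
Lemma iterates_eq_near L i j : i <= L -> j.-1 <= L ->
  (forall x g, box (final_radius n L) g -> iter i tau x g = other_iterate j x g) ->
  forall x, iter i tau x = other_iterate j x.
Proof.
move=> iL jL near x; apply: functional_extensionality => g.
have [gb|far] := boolP (box (final_radius n L) g); first exact: near.
pose g0 : G := ((final_radius n L)%:Z *: delta_mx 0 (Ordinal d_ge1))%R.
have g0E (i0 : 'I_d) : g0 0%R i0 = ((final_radius n L)%:Z *+ (i0 == Ordinal d_ge1))%R.
  by rewrite !mxE eqxx /= mulr_natr.
have g0b : box (final_radius n L) g0.
  apply/boxP; split; first exact: coord_space_full.
  by move=> i0; rewrite g0E; case: eqP.
have g0far l : l <= L -> ~~ box (l * n) g0.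
  move=> lL; apply/negP => /boxP[_ /(_ (Ordinal d_ge1))]; rewrite g0E eqxx mulr1n absz_nat.
  by rewrite leqNgt ltnS leq_mul2r lL orbT.
have gfar l : l <= L -> ~~ box (l * n) g.
  move=> lL; apply: contra far; apply: box_leq; apply: leqW.
  by rewrite leq_mul2r lL orbT.
pose x' h := x (h + (g - g0))%R.
have xx' l : l <= L -> iter l tau x g = iter l tau x' g0.
  have mb := memory_code_box (D := D); have eb := exceptions_code_box (D := D).
  move=> lL; rewrite !(iter_presented_far mb eb) ?gfar ?g0far //.
  by rewrite iter_linear_ca_translate addrC subrK.
rewrite xx' // near //; case: j jL {near} => [|j] jL //=.
by rewrite -xx'.
Qed.

Theorem iterate_testP L i j : i <= L -> j.-1 <= L ->
  iterate_test d v (@vector_code k V 0%R) n L i j <->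
  forall x, iter i tau x = other_iterate j x.
Proof.
move=> iL jL; rewrite /iterate_test; set b := initial_radius n L.
have bE : b = final_radius n L + L * n by [].
have le_b : L * n <= b by rewrite bE leq_addl.
have le_tb t : t <= L -> final_radius n L <= b - t * n.
  by move=> tL; have : t * n <= L * n; [rewrite leq_mul2r tL orbT|rewrite bE; lia].
split=> [/bounded_allP test|eq_iter].
  apply: (iterates_eq_near iL jL) => x g gR.
  have [c lt_c [dia cP]] := diagram_iterates x le_b.
  have gb : box b g by apply: box_leq gR; rewrite bE leq_addr.
  have /implyP/(_ dia)/bounded_allP/(_ _ (position_lt gb)) := test c lt_c.
  rewrite in_boxP // gR /= cP // => /eqP; case: j jL test => [|j] jL _ /=.
    exact: vector_code_inj.
  by rewrite cP //; apply: vector_code_inj.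
apply/bounded_allP => c lt_c; apply/implyP => dia; apply/bounded_allP => p.
move=> /position_surj[g gb <-]; rewrite in_boxP //; apply/implyP => gR.
have [x xc] := decode_configuration b 0 c.
have cE := diagram_iter le_b dia xc.
rewrite (cE i g iL (box_leq (le_tb _ iL) gR)) eq_iter.
by case: j jL {eq_iter} => [|j] jL //=; rewrite (cE j g jL (box_leq (le_tb _ jL) gR)).
Qed.

Theorem injectivity_testP (w1 w2 : nat) :
  injectivity_test d v n w1 w2 <->
  forall x y, (forall g, box w1 g -> tau x g = tau y g) ->
    forall g, box w2 g -> x g = y g.
Proof.
rewrite /injectivity_test; set b := w1 + n + w2.
have le_n : n <= b by rewrite /b; lia.
have le_w1 : w1 <= b - n by rewrite /b; lia.
have w1b g : box w1 g -> box b g by apply: box_leq; rewrite /b; lia.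
have w2b g : box w2 g -> box b g by apply: box_leq; rewrite /b; lia.
have rel c x g w : (forall h, box b h -> digit v c (0 + position b h) = vector_code (x h)) ->
    box w1 g -> rule_relation d v n b c 0 (position b g) w <-> w = vector_code (tau x g).
  move=> xc gw; apply: rule_relationP => //; first exact: box_leq gw.
  move=> h hg; apply: xc; apply: box_leq (box_sub_add gw hg).
  by rewrite /b; lia.
split=> [/bounded_allP test x y txy g gw|win].
  have [c1 lt_c1 c1P] := diagram_code b 1 (fun=> x).
  have [c2 lt_c2 c2P] := diagram_code b 1 (fun=> y).
  rewrite mul1n in lt_c1 lt_c2.
  have {}c1P h : box b h -> digit v c1 (0 + position b h) = vector_code (x h).
    exact: (c1P 0).
  have {}c2P h : box b h -> digit v c2 (0 + position b h) = vector_code (y h).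
    exact: (c2P 0).
  have /bounded_allP/(_ c2 lt_c2)/implyP := test c1 lt_c1.
  have imgs : bounded_all (cells d b) (fun p => in_box d b w1 p ==>
      bounded_ex v (fun w => rule_relation d v n b c1 0 p w && rule_relation d v n b c2 0 p w)).
    apply/bounded_allP => p /position_surj[h hb <-]; rewrite in_boxP //.
    apply/implyP => hw; apply/bounded_exP; exists (vector_code (tau x h)).
      exact: vector_code_lt.
    by apply/andP; split; [apply/(rel c1 x)|apply/(rel c2 y) => //; rewrite txy].
  move=> /(_ imgs)/bounded_allP/(_ _ (position_lt (w2b _ gw))).
  rewrite in_boxP ?w2b // gw /= -[position b g]add0n c1P ?c2P ?w2b //.
  by move=> /eqP/vector_code_inj.
apply/bounded_allP => c1 _; apply/bounded_allP => c2 _; apply/implyP => /bounded_allP imgs.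
have [x xc] := decode_configuration b 0 c1; have [y yc] := decode_configuration b 0 c2.
apply/bounded_allP => p /position_surj[g gb <-]; rewrite in_boxP //; apply/implyP => gw.
rewrite -[position b g]add0n xc // yc // (win x y) // => h hw.
have := imgs _ (position_lt (w1b _ hw)); rewrite in_boxP ?w1b // hw /=.
move=> /bounded_exP[w _ /andP[/(rel c1 x h w xc hw) -> /(rel c2 y h _ yc hw)]].
exact: vector_code_inj.
Qed.

End TestCorrectness.

(** * Recursiveness of the tests *)

Lemma recursive1_bounded_ex (N : nat -> nat) (P : nat -> nat -> bool) :
  recursive1 N -> recursive1 (fun w => P (cdr w) (car w) : nat) ->
  recursive1 (fun e => bounded_ex (N e) (P e) : nat).
Proof. exact: (recursive1_exists (P := fun i e => P e i)). Qed.

Lemma recursive1_bounded_all (N : nat -> nat) (P : nat -> nat -> bool) :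
  recursive1 N -> recursive1 (fun w => P (cdr w) (car w) : nat) ->
  recursive1 (fun e => bounded_all (N e) (P e) : nat).
Proof. exact: (recursive1_forall (P := fun i e => P e i)). Qed.

Lemma recursive1_ifb (p q q' : nat -> bool) :
  recursive1 p -> recursive1 q -> recursive1 q' ->
  recursive1 (fun e => (if p e then q e else q' e) : nat).
Proof.
by move=> rp rq rq'; apply: eq_recursive1 (recursive1_if rp rq rq') => e; case: (p e).
Qed.

Lemma recursive1_iter_cdr g h : recursive1 g -> recursive1 h ->
  recursive1 (fun e => iter (g e) cdr (h e)).
Proof.
move=> rg rh; apply: (recursive1_iter (S := fun a _ => cdr a)) => //.
exact: recursive1_cdr (recursive1_car recursive1_id).
Qed.

Ltac recursive_step :=
  cbv beta;
  match goal with
  | |- recursive1 (fun _ => ?c) => exact (recursive1_const c)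
  | |- recursive1 (fun e => e) => exact recursive1_id
  | |- recursive1 car => exact recursive_car
  | |- recursive1 cdr => exact recursive_cdr
  | H : recursive1 ?g |- recursive1 ?g => exact H
  | H : recursive1 ?g |- recursive1 (fun e => ?g e) => exact H
  | H : recursive1 ?g |- recursive1 (fun e => ?g (@?h e)) => apply (recursive1_comp H)
  | |- recursive1 (fun e => car _) => apply recursive1_car
  | |- recursive1 (fun e => cdr _) => apply recursive1_cdr
  | |- recursive1 (fun e => S _) => apply recursive1_succn
  | |- recursive1 (fun e => addn _ _) => apply recursive1_addn
  | |- recursive1 (fun e => muln _ _) => apply recursive1_muln
  | |- recursive1 (fun e => subn _ _) => apply recursive1_subn
  | |- recursive1 (fun e => expn _ _) => apply recursive1_expn
  | |- recursive1 (fun e => double _) => apply recursive1_double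
  | |- recursive1 (fun e => predn _) => apply (recursive1_comp recursive_pred)
  | |- recursive1 (fun e => half _) => apply recursive1_half
  | |- recursive1 (fun e => divn _ _) => apply recursive1_divn
  | |- recursive1 (fun e => modn _ _) => apply recursive1_modn
  | |- recursive1 (fun e => factorial _) => apply recursive1_factorial
  | |- recursive1 (fun e => pair_code _ _) => apply recursive1_pair
  | |- recursive1 (fun e => iter _ cdr _) => apply recursive1_iter_cdr
  | |- recursive1 (fun e => nat_of_bool (odd _)) => apply recursive1_odd
  | |- recursive1 (fun e => nat_of_bool (leq _ _)) => apply recursive1_leq
  | |- recursive1 (fun e => nat_of_bool (_ == _)) => apply recursive1_eqn
  | |- recursive1 (fun e => nat_of_bool (~~ _)) => apply recursive1_negb
  | |- recursive1 (fun e => nat_of_bool (_ && _)) => apply recursive1_andb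
  | |- recursive1 (fun e => nat_of_bool (_ ==> _)) => apply recursive1_implyb
  | |- recursive1 (fun e => nat_of_bool (bounded_ex _ _)) => apply recursive1_bounded_ex
  | |- recursive1 (fun e => nat_of_bool (bounded_all _ _)) => apply recursive1_bounded_all
  | |- recursive1 (fun e => nat_of_bool (if _ then _ else _)) => apply recursive1_ifb
  | |- recursive1 (fun e => if _ then _ else _) => apply recursive1_if
  end.
Ltac recursive_tac := repeat recursive_step.

Lemma recursive1_nth_code g h : recursive1 g -> recursive1 h ->
  recursive1 (fun e => nth_code (g e) (h e)).
Proof. by move=> rg rh; rewrite /nth_code; recursive_tac. Qed.

Lemma recursive1_digit B g h : recursive1 B -> recursive1 g -> recursive1 h ->
  recursive1 (fun e => digit (B e) (g e) (h e)).
Proof. by move=> rB rg rh; rewrite /digit; recursive_tac. Qed.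

Lemma recursive1_width b : recursive1 b -> recursive1 (fun e => width (b e)).
Proof. by move=> rb; rewrite /width; recursive_tac. Qed.

Section FixedParameters.

Variables (d v : nat).

Lemma recursive1_offset_plus b pc : recursive1 b -> recursive1 pc ->
  recursive1 (fun e => offset_plus d (b e) (pc e)).
Proof.
move=> rb rpc; apply: (recursive1_sum (N := fun=> d)
  (F := fun i e => code_plus (nth_code (pc e) i) * width (b e) ^ i)).
  exact: recursive1_const.
have rn : recursive1 (fun w => nth_code (pc (cdr w)) (car w)).
  by apply: recursive1_nth_code; recursive_tac.
have rw := recursive1_width rb.
by rewrite /code_plus; recursive_tac; exact: (recursive1_comp rw (recursive1_cdr recursive1_id)).
Qed.

Lemma recursive1_offset_minus b pc : recursive1 b -> recursive1 pc ->
  recursive1 (fun e => offset_minus d (b e) (pc e)).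
Proof.
move=> rb rpc; apply: (recursive1_sum (N := fun=> d)
  (F := fun i e => code_minus (nth_code (pc e) i) * width (b e) ^ i)).
  exact: recursive1_const.
have rn : recursive1 (fun w => nth_code (pc (cdr w)) (car w)).
  by apply: recursive1_nth_code; recursive_tac.
have rw := recursive1_width rb.
by rewrite /code_minus; recursive_tac; exact: (recursive1_comp rw (recursive1_cdr recursive1_id)).
Qed.

Lemma recursive1_origin b : recursive1 b -> recursive1 (fun e => origin d (b e)).
Proof.
move=> rb; apply: (recursive1_sum (N := fun=> d) (F := fun i e => b e * width (b e) ^ i)).
  exact: recursive1_const.
have rw := recursive1_width rb.
by recursive_tac; exact: (recursive1_comp rw (recursive1_cdr recursive1_id)).
Qed.

Ltac recursive_step' :=
  first [ recursive_step
        | match goal with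
          | |- recursive1 (fun e => nth_code _ _) => apply recursive1_nth_code
          | |- recursive1 (fun e => digit _ _ _) => apply recursive1_digit
          | |- recursive1 (fun e => width _) => apply recursive1_width
          | |- recursive1 (fun e => offset_plus _ _ _) => apply recursive1_offset_plus
          | |- recursive1 (fun e => offset_minus _ _ _) => apply recursive1_offset_minus
          | |- recursive1 (fun e => origin _ _) => apply recursive1_origin
          end ].
Ltac recursive_tac' := repeat recursive_step'.

Lemma recursive1_has_row n b c o p w t :
  recursive1 n -> recursive1 b -> recursive1 c -> recursive1 o -> recursive1 p ->
  recursive1 w -> recursive1 t ->
  recursive1 (fun e => has_row d v (n e) (b e) (c e) (o e) (p e) (w e) (t e) : nat).
Proof. by move=> rn rb rc ro rp rw rt; rewrite /has_row; recursive_tac'. Qed.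

Lemma recursive1_is_exception n b p i :
  recursive1 n -> recursive1 b -> recursive1 p -> recursive1 i ->
  recursive1 (fun e => is_exception d (n e) (b e) (p e) (i e) : nat).
Proof. by move=> rn rb rp ri; rewrite /is_exception; recursive_tac'. Qed.

Lemma recursive1_rule_relation n b c o p w :
  recursive1 n -> recursive1 b -> recursive1 c -> recursive1 o -> recursive1 p ->
  recursive1 w ->
  recursive1 (fun e => rule_relation d v (n e) (b e) (c e) (o e) (p e) (w e) : nat).
Proof.
move=> rn rb rc ro rp rw; rewrite /rule_relation; recursive_tac'.
- by apply: recursive1_is_exception; recursive_tac'.
- by apply: recursive1_is_exception; recursive_tac'.
- by apply: recursive1_has_row; recursive_tac'.
- by apply: recursive1_has_row; recursive_tac'.
Qed.

Lemma recursive1_in_box b r p :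
  recursive1 b -> recursive1 r -> recursive1 p ->
  recursive1 (fun e => in_box d (b e) (r e) (p e) : nat).
Proof. by move=> rb rr rp; rewrite /in_box; recursive_tac'. Qed.

Ltac recursive_step'' :=
  first [ recursive_step'
        | match goal with
          | |- recursive1 (fun e => nat_of_bool (in_box _ _ _ _)) => apply recursive1_in_box
          | |- recursive1 (fun e => nat_of_bool (rule_relation _ _ _ _ _ _ _ _)) =>
              apply recursive1_rule_relation
          end ].
Ltac recursive_tac'' := repeat recursive_step''.

Lemma recursive1_diagram n b L c :
  recursive1 n -> recursive1 b -> recursive1 L -> recursive1 c ->
  recursive1 (fun e => diagram d v (n e) (b e) (L e) (c e) : nat).
Proof. by move=> rn rb rL rc; rewrite /diagram /cells; recursive_tac''. Qed.

Lemma recursive1_iterate_test z0 n L i j :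
  recursive1 n -> recursive1 L -> recursive1 i -> recursive1 j ->
  recursive1 (fun e => iterate_test d v z0 (n e) (L e) (i e) (j e) : nat).
Proof.
move=> rn rL ri rj; rewrite /iterate_test /initial_radius /final_radius /cells.
recursive_tac''; apply: recursive1_diagram; recursive_tac''.
Qed.

Lemma recursive1_injectivity_test n w1 w2 :
  recursive1 n -> recursive1 w1 -> recursive1 w2 ->
  recursive1 (fun e => injectivity_test d v (n e) (w1 e) (w2 e) : nat).
Proof. by move=> rn r1 r2; rewrite /injectivity_test /cells; recursive_tac''. Qed.

Lemma recursive1_solution_bound j r : recursive1 r ->
  recursive1 (fun e => solution_bound d j (r e)).
Proof.
elim: j r => [|j IH] r rr; first exact: recursive1_const.
have rb := IH (fun e => level_radius d (r e)).
have rs : recursive1 (fun e => slab_radius d (r e)).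
  by rewrite /slab_radius /sheared_radius /shear_factor /shear_base /minor_radius; recursive_tac.
have rl : recursive1 (fun e => level_radius d (r e)).
  rewrite /level_radius; apply: recursive1_addn; first by recursive_tac.
  by rewrite /sheared_radius /shear_factor /shear_base /minor_radius; recursive_tac.
have {}rb := rb rl; rewrite /= /shear_factor /shear_base /minor_radius.
by recursive_tac.
Qed.

End FixedParameters.

Lemma recursive1_decidable (D : Type) (code : D -> nat) (P : D -> Prop) (F : nat -> bool) :
  recursive1 (fun e => F e : nat) -> (forall x, P x <-> F (code x)) ->
  algorithmically_decidable code P.
Proof.
move=> rF FP; exists (fun v => F (thead v)) => // x.
by rewrite FP thead_cons; case: (F _).
Qed.

Section Decision.

Variables (d : nat) (k : fieldType) (V : finLmodType k).
Hypothesis d_ge1 : 1 <= d.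
Notation G := 'rV[int]_d.
Notation v := #|{: V}|.
Notation code := (@presentation_code d k V).

(** The limit automaton presented on its own, so that the test on iterates applies to it. *)
Definition linear_part (D : presentation d V) : presentation d V :=
  @Presentation d k V (memory D) fset0 (fun _ => limit_rule D) (limit_rule D)
    (fun _ _ => erefl).

Lemma presented_linear_part D : presented_nuca (linear_part D) = linear_ca (limit_rule D).
Proof.
apply: functional_extensionality => x; apply: functional_extensionality => g.
by rewrite presented_nuca_out // inE.
Qed.

(** Memory and limit table are kept, and the list of exceptions is replaced by 0, the code of the
    empty list. *)
Definition linear_part_code (n : nat) : nat :=
  pair_code (nth_code n 0) (pair_code 0 (pair_code (nth_code n 2) 0)).

Lemma presentation_code_linear_part D :
  code (linear_part D) = linear_part_code (code D).
Proof.
have enum0 : enum {: exceptions (linear_part D)} = [::].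
  by apply: size0nil; rewrite -cardE -cardfE cardfs0.
by rewrite /linear_part_code !nth_code_code /presentation_code enum0.
Qed.

Definition zero_code : nat := vector_code (0%R : V).

Definition eventually_periodic_test (n : nat) : bool :=
  bounded_ex (v ^ 2).+1 (fun l => (1 <= l) &&
    iterate_test d v zero_code (linear_part_code n) (l + l) (l + l) l.+1).

Variables (v0 : V) (v0_neq0 : v0 != 0%R).

Lemma eventually_periodic_testP D :
  eventually_periodic (presented_nuca D) <-> eventually_periodic_test (code D).
Proof.
have mb := memory_code_box (D := D); have eb := exceptions_code_box (D := D).
rewrite (eventually_periodic_linear d_ge1 mb eb v0_neq0) -presented_linear_part.
have testP l := @iterate_testP d k V d_ge1 (linear_part D) (l + l) (l + l) l.+1
  (leqnn _) (leq_addr _ _).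
rewrite /eventually_periodic_test -presentation_code_linear_part.
split=> [[l /andP[l_gt0 le_l] Tl]|/bounded_exP[l lt_l /andP[l_gt0 /testP Tl]]].
  by apply/bounded_exP; exists l; rewrite ?ltnS // l_gt0; apply/testP.
by exists l => //; rewrite l_gt0 -ltnS.
Qed.

Lemma recursive1_linear_part_code : recursive1 linear_part_code.
Proof.
have r0 := recursive1_nth_code recursive1_id (recursive1_const 0).
have r2 := recursive1_nth_code recursive1_id (recursive1_const 2).
rewrite /linear_part_code; apply: recursive1_pair => //.
apply: recursive1_pair (recursive1_const 0) _.
exact: recursive1_pair r2 (recursive1_const 0).
Qed.

Lemma recursive1_eventually_periodic_test :
  recursive1 (fun e => eventually_periodic_test e : nat).
Proof.
rewrite /eventually_periodic_test; apply: recursive1_bounded_ex.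
  exact: recursive1_const.
apply: recursive1_andb; first exact: recursive1_leq (recursive1_const 1) recursive_car.
apply: recursive1_iterate_test.
- exact: recursive1_comp recursive1_linear_part_code recursive_cdr.
- exact: recursive1_addn recursive_car recursive_car.
- exact: recursive1_addn recursive_car recursive_car.
- exact: recursive1_succn recursive_car.
Qed.

Definition power_code (n : nat) : nat := (state_bound d v (v * n))`!.

Lemma recursive1_power_code : recursive1 power_code.
Proof.
rewrite /power_code /state_bound; apply: recursive1_factorial.
apply: recursive1_muln (recursive1_const v); apply: recursive1_expn (recursive1_const v) _.
apply: recursive1_expn _ (recursive1_const d); apply: recursive1_succn.
apply: recursive1_double; exact: recursive1_muln (recursive1_const v) recursive1_id.
Qed.

(* [j] is the second index of [iterate_test]. *)
Definition power_test (j n : nat) : bool :=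
  eventually_periodic_test n && iterate_test d v zero_code n (power_code n) (power_code n) j.

Lemma recursive1_power_test j : recursive1 (fun e => power_test j e : nat).
Proof.
apply: recursive1_andb recursive1_eventually_periodic_test _.
by apply: recursive1_iterate_test; try exact: recursive1_power_code;
  [exact: recursive1_id | exact: recursive1_const].
Qed.

Lemma power_testP D j : j <= 1 ->
  eventually_periodic (presented_nuca D) /\
  (forall x, iter (power_code (code D)) (presented_nuca D) x = other_iterate D j x)
  <-> power_test j (code D).
Proof.
move=> j1; have jL : j.-1 <= power_code (code D) by move: j1; case: j => [|[]].
rewrite eventually_periodic_testP /power_test.
split=> [[-> h]|/andP[-> h]]; last by split=> //; apply/(iterate_testP d_ge1 D (leqnn _) jL).
exact/(iterate_testP d_ge1 D (leqnn _) jL).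
Qed.

Lemma nilpotent_testP D : nilpotent (presented_nuca D) <-> power_test 0 (code D).
Proof.
have mb := memory_code_box (D := D); have eb := exceptions_code_box (D := D).
by rewrite (nilpotent_idempotent d_ge1 mb eb v0_neq0) -power_testP.
Qed.

Lemma periodic_testP D : periodic (presented_nuca D) <-> power_test 1 (code D).
Proof.
have mb := memory_code_box (D := D); have eb := exceptions_code_box (D := D).
by rewrite (periodic_idempotent d_ge1 mb eb v0_neq0) -power_testP.
Qed.

Definition injective_test (n : nat) : bool :=
  injectivity_test d v n (window_radius d V n) n.*2.+1.

Lemma injective_testP D : injective (presented_nuca D) <-> injective_test (code D).
Proof.
have mb := memory_code_box (D := D); have eb := exceptions_code_box (D := D).
rewrite /injective_test (injectivity_testP d_ge1).
split=> [inj x y|]; first exact: (injective_window mb eb inj).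
exact: (window_injective mb eb).
Qed.

Lemma recursive1_injective_test : recursive1 (fun e => injective_test e : nat).
Proof.
apply: recursive1_injectivity_test; first exact: recursive1_id.
  apply: recursive1_addn recursive1_id; apply: recursive1_solution_bound.
  apply: recursive1_addn (recursive1_const v).
  exact: recursive1_succn (recursive1_double recursive1_id).
exact: recursive1_succn (recursive1_double recursive1_id).
Qed.

End Decision.

Unset Implicit Arguments.

Theorem theorem9p6 (d : nat) (k : fieldType) (V : finLmodType k)
    (d_ge1 : (1 <= d)%N) :
  algorithmically_decidable (@presentation_code d k V)
    (fun D => nilpotent (presented_nuca D)) /\
  algorithmically_decidable (@presentation_code d k V)
    (fun D => periodic (presented_nuca D)) /\
  algorithmically_decidable (@presentation_code d k V)
    (fun D => eventually_periodic (presented_nuca D)) /\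
  algorithmically_decidable (@presentation_code d k V)
    (fun D => cayley_hamilton (presented_nuca D)) /\
  algorithmically_decidable (@presentation_code d k V)
    (fun D => injective (presented_nuca D)).
Proof.
have [[v0 v0_neq0]|V0] := classic (exists v0 : V, v0 != 0%R).
  have ep := recursive1_eventually_periodic_test d V.
  repeat split.
  - exact: recursive1_decidable (recursive1_power_test d V 0) (nilpotent_testP d_ge1 v0_neq0).
  - exact: recursive1_decidable (recursive1_power_test d V 1) (periodic_testP d_ge1 v0_neq0).
  - exact: recursive1_decidable ep (eventually_periodic_testP d_ge1 v0_neq0).
  - apply: recursive1_decidable ep _ => D.
    by rewrite (cayley_hamilton_eventually_periodic v0_neq0) (eventually_periodic_testP d_ge1 v0_neq0).
  - exact: recursive1_decidable (recursive1_injective_test d V) (@injective_testP d k V d_ge1).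
(* For [V = 0] there is a single configuration, and every presentation has all five properties. *)
have eqV (u w : V) : u = w.
  have all0 (u' : V) : u' = 0%R.
    by apply/eqP/negPn/negP => u'0; apply: V0; exists u'.
  by rewrite (all0 u) (all0 w).
have eqx (x y : 'rV[int]_d -> V) : x = y by apply: functional_extensionality.
have always (P : presentation d V -> Prop) : (forall D, P D) ->
    algorithmically_decidable (@presentation_code d k V) P.
  by move=> PD; apply: (recursive1_decidable (F := fun=> true) (recursive1_const 1)).
repeat split; apply: always => D.
- by exists 0%R, 1; split=> // x; apply: eqx.
- by exists 1; split=> // x; apply: eqx.
- by exists 1, 1; split=> // x; apply: eqx.
- by exists 1%R => [|x g]; [apply: GRing.oner_neq0|apply: eqV].
- by move=> x y _; apply: eqx.
Qed.
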